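(* Assume that: (i) $Z_1,\dots,Z_p$ are independent stationary Gaussian processes on $\mathbb{R}^d$ with mean zero, unit variance and covariance functions $K_1,\dots,K_p$; (ii) there is a fixed $\Delta>0$ such that for all $n\in\mathbb{N}$ and all $i\neq j$ in $\{1,\dots,n\}$, $\|s_i-s_j\|\ge\Delta$; (iii) there are fixed $A>0$ and $\alpha>0$ such that $|K_k(x)|\le A/(1+\|x\|^{d+\alpha})$ for all $x\in\mathbb{R}^d$ and $k=1,\dots,p$; (iv) $f:\mathbb{R}^d\to\mathbb{R}$ satisfies, for the same $A$ and $\alpha$, $|f(x)|\le A/(1+\|x\|^{d+\alpha})$ for all $x\in\mathbb{R}^d$. Let $W(f)$ be the $p^2\times1$ random vector defined, for $i=(a-1)p+b$ with $a,b\in\{1,\dots,p\}$, by $W(f)_i=n^{1/2}\{\widehat M(f)_{a,b}-M(f)_{a,b}\}$, define $W(f_0)$ in the same way with $f_0$ in place of $f$, and let $Q_n$ be the distribution of $\{W(f)^\top,W(f_0)^\top\}^\top$. Then, as $n\to\infty$, $$d_w\big[Q_n,\mathcal N\{0,V(f,f_0)\}\big]\to0,$$ and the largest eigenvalue of $V(f,f_0)$ is bounded as $n\to\infty$.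
   Context: $d,p\ge1$ are fixed integers. For each $n\in\mathbb{N}$, $s_1,\dots,s_n\in\mathcal S^d\subseteq\mathbb{R}^d$ are the $n$ observation points. $Z=(Z_1,\dots,Z_p)^\top$ is the latent field, and $X(s)=\Omega Z(s)$ is the observed field, with $\Omega$ a fixed invertible $p\times p$ matrix. $\|\cdot\|$ is the Euclidean norm, and $f_0(s)=I(s=0)$. For a function $g:\mathbb{R}^d\to\mathbb{R}$, $$\widehat M(g)=n^{-1}\sum_{i,j=1}^n g(s_i-s_j)X(s_i)X(s_j)^\top,\qquad M(g)=\mathrm{E}\{\widehat M(g)\}.$$ Definition of $V$: let $y$ be the $np\times1$ vector with $y_{(i-1)p+j}=X_j(s_i)$, $i=1,\dots,n$, $j=1,\dots,p$, and $R=\mathrm{cov}(y)$. Let $e_b(p)$ be the $b$th canonical basis vector of $\mathbb{R}^p$. For $b,l\in\{1,\dots,p\}$ let $T_{b,l}(g)$ be the $np\times np$ matrix made of $n^2$ blocks of size $p\times p$ with block $(i,j)$ equal to $g(s_i-s_j)\tfrac12\{e_b(p)e_l(p)^\top+e_l(p)e_b(p)^\top\}$. For functions $g,h$ let $\Sigma(g,h)$ be the $p^2\times p^2$ matrix with, for $i=(a-1)p+b$ and $j=(u-1)p+v$, $a,b,u,v\in\{1,\dots,p\}$, $$\Sigma(g,h)_{i,j}=2n^{-1}\mathrm{tr}\{R\,T_{a,b}(g)\,R\,T_{u,v}(h)\},\qquad \Sigma(g)=\Sigma(g,g),$$ and $$V(g,h)=\begin{pmatrix}\Sigma(g)&\Sigma(g,h)\\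 \Sigma(h,g)&\Sigma(h)\end{pmatrix}.$$ $V$ depends on $n$ and is not assumed to converge. $d_w$ is a metric generating the topology of weak convergence on the set of Borel probability measures on Euclidean space; $\mathcal N(0,V)$ is the centred normal distribution with covariance matrix $V$.
   Formalization: The function f is additionally assumed even, f(-x)=f(x); without this the claim fails (e.g. d=p=1, s_i=i, K(x)=max(0,1-|x|), f(0)=f(1)=1, f=0 elsewhere: V gives variance 2 for W(f), whose limiting variance is 3). *)

(* Defs.v *)
From HB Require Import structures.
From mathcomp Require Import all_boot all_order all_algebra.
From mathcomp Require Import all_classical all_reals all_analysis.
From mathcomp Require Import measurable_realfun mxtens.

Set Implicit Arguments.
Unset Strict Implicit.
Unset Printing Implicit Defensive.

Import Order.TTheory GRing.Theory Num.Theory.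
Import numFieldNormedType.Exports.

Local Open Scope classical_set_scope.
Local Open Scope ring_scope.

(* [`|x|] on ['rV[R]_d] is the max norm, hence a separate Euclidean norm. *)
Definition enorm (R : realType) (d : nat) (x : 'rV[R]_d) : R :=
  Num.sqrt (\sum_(i < d) x 0 i ^+ 2).

Definition borel_rV (R : realType) (q : nat) :=
  g_sigma_algebraType (@open 'rV[R]_q).

Section gaussian.
Context (R : realType) (disp : measure_display) (T : measurableType disp)
  (P : probability T R).

(* The normal law is allowed to be degenerate: [normal_prob m 0] is not the
   Dirac mass at [m], so standard deviation 0 is treated apart. *)
Definition gaussian_rv (X : T -> R) : Prop :=
  exists m sigma : R, 0 <= sigma /\
    forall B : set (measurableTypeR R), measurable B ->
      P (X @^-1` B) = if sigma == 0 then \d_m B else normal_prob m sigma B.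

Definition gaussian_vector (q : nat) (Y : T -> 'rV[R]_q) : Prop :=
  forall c : 'rV[R]_q, gaussian_rv (fun w => \sum_(i < q) c 0 i * Y w 0 i).

Definition gaussian_process (d : nat) (Z : 'rV[R]_d -> T -> R) : Prop :=
  forall (m : nat) (x : 'I_m -> 'rV[R]_d),
    gaussian_vector (fun w => \row_(i < m) Z (x i) w).

(* Stationarity: constant mean, and a covariance depending on the lag only. *)
Definition stationary_with (d : nat) (Z : 'rV[R]_d -> T -> R) (mu : R)
    (K : 'rV[R]_d -> R) : Prop :=
  (forall x, 'E_P[Z x] = mu%:E)%E /\
  (forall x y, covariance P (Z x) (Z y) = (K (x - y))%:E).

Definition process_sigma (d : nat) (Z : 'rV[R]_d -> T -> R) : set (set T) :=
  <<s [set A | exists (x : 'rV[R]_d) (B : set (measurableTypeR R)),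
         measurable B /\ A = Z x @^-1` B] >>.

Definition independent_processes (d p : nat) (Z : 'I_p -> 'rV[R]_d -> T -> R) :
    Prop :=
  forall (J : {set 'I_p}) (A : 'I_p -> set T),
    (forall k, k \in J -> process_sigma (Z k) (A k)) ->
    P (\bigcap_(k in [set` J]) A k) = (\prod_(k in J) P (A k))%E.

End gaussian.

Definition is_centred_normal (R : realType) (q : nat) (V : 'M[R]_q)
    (N : probability (borel_rV R q) R) : Prop :=
  gaussian_vector N (fun x : borel_rV R q => x) /\
  (forall i, 'E_N[fun x : borel_rV R q => (x : 'rV[R]_q) 0%R i] = 0)%E /\
  (forall i j, covariance N (fun x : borel_rV R q => (x : 'rV[R]_q) 0 i)
                            (fun x : borel_rV R q => (x : 'rV[R]_q) 0 j) =
               (V i j)%:E).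

(* N(0, V); it exists, and is unique on Borel sets, for every symmetric positive
   semidefinite [V], singular ones included. *)
Definition normal_law (R : realType) (q : nat) (V : 'M[R]_q) :
    probability (borel_rV R q) R :=
  get (is_centred_normal V).

Section weak_topology.
Context (R : realType) (q : nat).
Local Notation pr := (probability (borel_rV R q) R).

Definition bounded_continuous (phi : 'rV[R]_q -> R) : Prop :=
  continuous phi /\ exists C : R, forall x, `|phi x| <= C.

(* The sets {nu : |int F_i dnu - int F_i dmu| < e for all i < m}, with the F_i
   bounded and continuous, form a neighbourhood basis of the weak topology at
   [mu]. *)
Definition weak_open (U : set pr) : Prop :=
  forall mu : pr, U mu ->
    exists (m : nat) (F : 'I_m -> 'rV[R]_q -> R) (e : R),
      [/\ 0 < e, forall i, bounded_continuous (F i) &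
          forall nu : pr,
            (forall i, `|\int[nu]_x F i x - \int[mu]_x F i x| < e) -> U nu].

Definition metric_open (dw : pr -> pr -> R) (U : set pr) : Prop :=
  forall mu : pr, U mu ->
    exists e : R, 0 < e /\ forall nu : pr, dw mu nu < e -> U nu.

(* A value of type [pr] is a function on all subsets, constrained on Borel sets
   only; two of them are the same Borel probability measure when they agree on
   Borel sets, which is weaker than [mu = nu]. *)
Definition is_metric (dw : pr -> pr -> R) : Prop :=
  [/\ forall mu nu, 0 <= dw mu nu,
      forall mu nu, dw mu nu = 0 <->
        (forall A : set (borel_rV R q), measurable A -> mu A = nu A),
      forall mu nu, dw mu nu = dw nu mu &
      forall mu nu xi, dw mu xi <= dw mu nu + dw nu xi].

Definition metrizes_weak_topology (dw : pr -> pr -> R) : Prop :=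
  is_metric dw /\ forall U : set pr, metric_open dw U <-> weak_open U.

End weak_topology.

(* The sup of a finite set; nonempty when [V] is symmetric of positive size. *)
Definition largest_eigenvalue (R : realType) (q : nat) (V : 'M[R]_q) : R :=
  sup [set l : R | eigenvalue V l].

Definition f_zero (R : realType) (d : nat) (x : 'rV[R]_d) : R := (x == 0)%:R.

Lemma measurable_fun_rV (R : realType) (disp : measure_display)
    (T : measurableType disp) (q : nat) (f : T -> 'rV[R]_q) :
  (forall j, measurable_fun setT (fun w => f w 0 j)) ->
  measurable_fun setT (f : T -> borel_rV R q).
Proof.
move=> mf.
apply: (@measurability _ _ _ _ setT (f : T -> borel_rV R q) (@open 'rV[R]_q)) => //.
move=> _ [U oU <-]; rewrite setTI.
pose bx (c : 'rV[rat]_q * rat) : set 'rV[R]_q :=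
  [set v | forall j, `|v 0 j - ratr (c.1 0 j)| < ratr c.2].
have -> : f @^-1` U = \bigcup_(c in [set c | bx c `<=` U]) f @^-1` (bx c).
  apply/seteqP; split => w /=; last by case=> c cU; exact: cU.
  move=> Ufw.
  have /nbhs_ballP[e /= e0 eU] : nbhs (f w) U by exact: open_nbhs_nbhs.
  have [r] := @rat_in_itvoo R 0 (e / 2) (divr_gt0 e0 (ltr0n _ 2)).
  rewrite in_itv /= => /andP[r0 re].
  have /fin_all_exists[c cP] : forall j : 'I_q, exists c : rat,
      `|f w 0 j - ratr c| < ratr r.
    move=> j.
    have [|c] := @rat_in_itvoo R (f w 0 j - ratr r) (f w 0 j + ratr r).
      by rewrite ltrBlDr -addrA ltrDl addr_gt0.
    rewrite in_itv /= => /andP[c1 c2]; exists c.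
    by rewrite ltr_distlC ltrBlDr c2 /= -ltrBlDr andbT.
  exists (\row_j c j, r) => /=; last by move=> j; rewrite mxE.
  move=> v /= hv; apply: eU; split=> // i j; rewrite ord1 /ball /=.
  move: (hv j) (cP j); rewrite mxE => h1 h2.
  rewrite (le_lt_trans (ler_distD (ratr (c j)) _ _)) //.
  by rewrite (splitr e) ltrD // ?(lt_trans h2) // distrC (lt_trans h1).
rewrite bigcup_mkcond; apply: countable_bigcupT_measurable => // c.
case: ifP => // _.
have -> : f @^-1` bx c = \bigcap_(j in [set: 'I_q])
    ((fun w => `|f w 0 j - ratr (c.1 0 j)|) @^-1` `]-oo, ratr c.2[).
  apply/seteqP; split => [w h j _|w h j] /=; first by rewrite in_itv /=; exact: h.
  by have := h j I; rewrite /= in_itv.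
apply: fin_bigcap_measurable => // j _; rewrite -[X in measurable X]setTI.
have mj : measurable_fun setT (fun w => `|f w 0 j - ratr (c.1 0 j)|).
  apply: measurableT_comp => //.
  exact: measurable_funB.
by apply: mj => //; exact: measurable_itv.
Qed.

(* Below, [mxtens_unindex] sends the 0-based index i = a * p + b to (a, b). *)
Section fields.
Context (R : realType) (disp : measure_display) (T : measurableType disp)
  (P : probability T R) (d p : nat) (Omega : 'M[R]_p)
  (Z : 'I_p -> 'rV[R]_d -> {RV P >-> R}) (n : nat) (s : 'I_n -> 'rV[R]_d).
Implicit Types g h : 'rV[R]_d -> R.

Definition observed (x : 'rV[R]_d) (w : T) : 'cV[R]_p :=
  Omega *m \col_(k < p) Z k x w.

Definition Mhat g (w : T) : 'M[R]_p :=
  n%:R^-1 *: \sum_(i < n) \sum_(j < n)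
    g (s i - s j) *: (observed (s i) w *m (observed (s j) w)^T).

Definition Mmean g : 'M[R]_p :=
  \matrix_(a < p, b < p) fine ('E_P[fun w => Mhat g w a b])%E.

Definition W g (w : T) : 'rV[R]_(p * p) :=
  \row_(i < p * p) (Num.sqrt n%:R *
    (Mhat g w (mxtens_unindex i).1 (mxtens_unindex i).2 -
     Mmean g (mxtens_unindex i).1 (mxtens_unindex i).2)).

Definition W2 g h (w : T) : borel_rV R (p * p + p * p) :=
  row_mx (W g w) (W h w).

Let measurable_W2 g h : measurable_fun setT (W2 g h).
Proof.
have mobs x a : measurable_fun setT (fun w => observed x w a 0).
  under eq_fun do rewrite mxE; apply: measurable_sum => k.
  under eq_fun do rewrite [X in _ * X]mxE.
  by apply: measurable_funM => //; exact: measurable_funPT.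
have mM e a b : measurable_fun setT (fun w => Mhat e w a b).
  rewrite /Mhat; move: observed mobs => obs mobs.
  under eq_fun do rewrite mxE summxE.
  apply: measurable_funM => //; apply: measurable_sum => i.
  under eq_fun do rewrite summxE; apply: measurable_sum => j.
  under eq_fun do rewrite mxE; apply: measurable_funM => //.
  under eq_fun do rewrite mxE; apply: measurable_sum => k.
  rewrite (ord1 k); under eq_fun do rewrite [X in _ * X]mxE.
  exact: measurable_funM.
have mW e k : measurable_fun setT (fun w => W e w 0 k).
  under eq_fun do rewrite mxE; apply: measurable_funM => //.
  exact: measurable_funB.
apply: measurable_fun_rV => k; rewrite -(splitK k).
case: (fintype.split k) => l.
  rewrite (_ : (fun w => _) = (fun w => W g w 0 l)) //.
  by apply/funext => w; exact: row_mxEl.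
rewrite (_ : (fun w => _) = (fun w => W h w 0 l)) //.
by apply/funext => w; exact: row_mxEr.
Qed.

HB.instance Definition _ g h :=
  isMeasurableFun.Build _ _ _ _ (W2 g h) (measurable_W2 g h).

Definition W2_law g h : probability (borel_rV R (p * p + p * p)) R :=
  distribution P (W2 g h).

Definition yvec (k : 'I_(n * p)) (w : T) : R :=
  observed (s (mxtens_unindex k).1) w (mxtens_unindex k).2 0.

Definition Rcov : 'M[R]_(n * p) :=
  \matrix_(k < n * p, l < n * p) fine (covariance P (yvec k) (yvec l)).

(* For an even [g] this matrix T is symmetric and entry (b, l) of [Mhat g] is
   n^-1 * y^T T y; both may fail when [g] is not even. *)
Definition Tmat (b l : 'I_p) g : 'M[R]_(n * p) :=
  \matrix_(u < n * p, v < n * p)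
    (g (s (mxtens_unindex u).1 - s (mxtens_unindex v).1) *
     (2^-1 *: (delta_mx b l + delta_mx l b : 'M[R]_p))
       (mxtens_unindex u).2 (mxtens_unindex v).2).

Definition Sigma g h : 'M[R]_(p * p) :=
  \matrix_(i < p * p, j < p * p)
    (2 * n%:R^-1 *
     \tr (Rcov *m Tmat (mxtens_unindex i).1 (mxtens_unindex i).2 g *m
          Rcov *m Tmat (mxtens_unindex j).1 (mxtens_unindex j).2 h)).

Definition Vmat g h : 'M[R]_(p * p + p * p) :=
  block_mx (Sigma g g) (Sigma g h) (Sigma h g) (Sigma h h).

End fields.

(* Main.v *)
Require Import Defs.
From HB Require Import structures.
From mathcomp Require Import all_boot all_order all_algebra.
From mathcomp Require Import all_classical all_reals all_analysis.
From mathcomp Require Import measurable_realfun mxtens ring lra.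

(** Every entry of M_hat(g) is a quadratic form y T y^T / n in the vector y of
    all the observations, which is Gaussian with covariance R, and V(f, f_0) is
    the exact covariance matrix of W = (W(f), W(f_0)). So for every c the
    variable c.W is n^(-1/2) {y T_c y^T - tr(R T_c)} for some symmetric T_c, and
    has variance c V c^T ([dot_W2], [qform_Vmat]).

    Writing y = L xi with R = L L^T and L^T T_c L diagonal, c.W becomes a sum of
    independent terms n^(-1/2) D_i (xi_i^2 - 1), where the xi_i are standard
    normal and the D_i are eigenvalues of R T_c ([quadratic_form_diag]). They are
    bounded by the row sums of R T_c ([psd_diag_bound]), which are bounded
    uniformly in n: the points are separated, and f and the K_k decay faster than
    |x|^(-d) ([packing]). Since E cos(th + a (xi^2 - 1)) is e^(-a^2) cos th up to
    O(|a|^3) ([normal_cos_sqr]), the np independent terms give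
      E cos(th + c.W) = e^(- c V c^T / 2) cos th + O(n^(-1/2))
    ([quadratic_form_cos], [W2_cos_rate]). The same row sums bound the entries of
    V ([Vmat_bound]), hence its eigenvalues, and the tails of W.

    The matrix V = V_n need not converge, but it is bounded. Along any ultrafilter
    finer than n -> oo it has a limit V', and both Q_n and N(0, V_n) converge weakly
    to N(0, V'), so that d_w between them tends to 0 ([normal_approximation]).
    Weak convergence is deduced from the convergence of the expectations of the
    cosines and from tightness ([weak_cvg_of_cos]): on a large cube a continuous
    function is approximated by trigonometric polynomials that keep its bound on
    the whole space ([trigpoly_approx]).

    Characteristic functions appear throughout in the real form
    E cos(th + c.X), with all phases th; that of N(0, 1) comes from Stein's
    identity ([normal_stein], [normal_cos]), and joint normality of y from the
    product rule for independent processes ([cos_sum_independent],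
    [field_centered]). *)

Set Implicit Arguments.
Unset Strict Implicit.
Unset Printing Implicit Defensive.

Import Order.TTheory GRing.Theory Num.Theory.
Import numFieldNormedType.Exports.

Local Open Scope classical_set_scope.
Local Open Scope ring_scope.

(** * Integrals of real functions *)

Section real_integrals.
Context d (T : measurableType d) (R : realType).
Implicit Types (f g : T -> R).

Section measure.
Context (mu : {measure set T -> \bar R}).
Local Notation int := (fun f => mu.-integrable setT (EFin \o f)).

Lemma integrableRD f g : int f -> int g -> int (fun x => f x + g x).
Proof. by move=> hf hg; exact: (integrableD measurableT hf hg). Qed.

Lemma integrableRZ c f : int f -> int (fun x => c * f x).
Proof. by move=> hf; exact: (integrableZl measurableT c hf). Qed.

Lemma integrableRB f g : int f -> int g -> int (fun x => f x - g x).
Proof. by move=> hf hg; exact: (integrableB measurableT hf hg). Qed.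

Lemma integrableR_sum (I : Type) (r : seq I) (F : I -> T -> R) :
  (forall i, int (F i)) -> int (fun x => \sum_(i <- r) F i x).
Proof.
move=> hF; elim: r => [|i r ih].
  by under eq_fun do rewrite big_nil; exact: integrable0.
by under eq_fun do rewrite big_cons; exact: integrableRD.
Qed.

Lemma Rintegral_sum (I : Type) (r : seq I) (F : I -> T -> R) :
  (forall i, int (F i)) ->
  \int[mu]_x (\sum_(i <- r) F i x) = \sum_(i <- r) \int[mu]_x F i x.
Proof.
move=> hF; elim: r => [|i r ih].
  under eq_Rintegral do rewrite big_nil.
  by rewrite big_nil /Rintegral integral0.
under eq_Rintegral do rewrite big_cons.
by rewrite big_cons RintegralD// ?ih//; exact: integrableR_sum.
Qed.

Lemma le_integrableR f g : measurable_fun setT f -> int g ->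
  (forall x, `|f x| <= g x) -> int f.
Proof.
move=> mf ig fg; apply: (le_integrable measurableT _ _ ig).
  exact/measurable_EFinP.
by move=> x _; rewrite lee_fin (le_trans (fg x))// ler_norm.
Qed.

Lemma le_Rintegral_norm f g : measurable_fun setT f -> int g ->
  (forall x, `|f x| <= g x) -> `|\int[mu]_x f x| <= \int[mu]_x g x.
Proof.
move=> mf ig fg; have jf := le_integrableR mf ig fg.
apply: le_trans (le_normr_Rintegral measurableT jf) _; apply: le_Rintegral => //.
by apply: (le_integrableR _ ig) => [|x]; rewrite ?normr_id//; exact: measurableT_comp.
Qed.

Lemma measurable_intR f : int f -> measurable_fun setT f.
Proof. by move=> /measurable_int/measurable_EFinP. Qed.

End measure.

Section probability.
Context (P : probability T R).
Local Notation int := (fun f => P.-integrable setT (EFin \o f)).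

Lemma integrableR_cst c : int (fun=> c).
Proof. exact: finite_measure_integrable_cst. Qed.

Lemma integrableR_bounded f C : measurable_fun setT f ->
  (forall x, `|f x| <= C) -> int f.
Proof. by move=> mf; apply: le_integrableR mf (integrableR_cst C). Qed.

Lemma Rintegral_prob_cst c : \int[P]_x c = c.
Proof. by rewrite Rintegral_cst// [X in fine X]probability_setT mulr1. Qed.

Lemma le_Rintegral_bounded f C : measurable_fun setT f ->
  (forall x, `|f x| <= C) -> `|\int[P]_x f x| <= C.
Proof.
move=> mf fC; have := le_Rintegral_norm mf (integrableR_cst C) fC.
by rewrite Rintegral_prob_cst.
Qed.

End probability.
End real_integrals.

(** * Densities of normal laws *)

Section density.
Context (R : realType).
Local Notation mu := (@lebesgue_measure R).

Import HBNNSimple.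

(** By definition [normal_prob m s] integrates the density over sets; this
    extends from indicators to simple functions, then by monotone convergence. *)
Lemma ge0_integral_normal_prob (m s : R) (f : measurableTypeR R -> \bar R) :
  measurable_fun setT f -> (forall x, 0 <= f x)%E ->
  (\int[normal_prob m s]_x f x = \int[mu]_x (f x * (normal_pdf m s x)%:E))%E.
Proof.
move=> mf f0.
have mpdf : measurable_fun setT (EFin \o normal_pdf m s).
  by apply/measurable_EFinP; exact: measurable_normal_pdf.
have indE (E : set (measurableTypeR R)) : measurable E ->
    (\int[normal_prob m s]_x (\1_E x)%:E =
     \int[mu]_x ((\1_E x)%:E * (normal_pdf m s x)%:E))%E.
  move=> mE; rewrite integral_indic// setIT.
  rewrite -[LHS]/(\int[mu]_(x in E) (normal_pdf m s x)%:E)%E [LHS]integral_mkcond.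
  apply: eq_integral => x _; rewrite patchE indicE.
  by case: (x \in E); rewrite ?mul1e ?mul0e.
have sfE (g : {nnsfun measurableTypeR R >-> R}) :
    (\int[normal_prob m s]_x (g x)%:E =
     \int[mu]_x ((g x)%:E * (normal_pdf m s x)%:E))%E.
  under [LHS]eq_integral do rewrite fimfunE -fsumEFin//.
  rewrite [LHS]ge0_integral_fsum//; last 2 first.
    - by move=> r; exact/measurable_EFinP/measurableT_comp.
    - by move=> n x _; rewrite EFinM nnfun_muleindic_ge0.
  under [RHS]eq_integral.
    move=> x xD; rewrite fimfunE -fsumEFin// ge0_mule_fsuml; last first.
      by move=> r; rewrite EFinM nnfun_muleindic_ge0.
    over.
  rewrite [RHS]ge0_integral_fsum//; last 2 first.
    - move=> r; apply: emeasurable_funM => //.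
      by apply/measurable_EFinP; exact/measurableT_comp.
    - move=> n x _; apply: mule_ge0; last by rewrite lee_fin normal_pdf_ge0.
      by rewrite EFinM nnfun_muleindic_ge0.
  apply: eq_fsbigr => r; rewrite inE => -[y _ ry].
  have r0 : (0 <= r%:E)%E by rewrite lee_fin -ry.
  under eq_integral do rewrite EFinM.
  under [RHS]eq_integral do rewrite EFinM -muleA.
  rewrite !ge0_integralZl//.
  - by rewrite indE.
  - by apply: emeasurable_funM => //; exact/measurable_EFinP.
  - by move=> x _; apply: mule_ge0; rewrite lee_fin ?normal_pdf_ge0.
  - exact/measurable_EFinP.
pose f_ := nnsfun_approx measurableT mf.
transitivity (lim (\int[normal_prob m s]_x (f_ n x)%:E @[n --> \oo])%E).
  rewrite -monotone_convergence//=.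
  - apply: eq_integral => ? /[!inE] xD; apply/esym/cvg_lim => //=.
    exact: cvg_nnsfun_approx.
  - by move=> n; exact/measurable_EFinP/measurable_funTS.
  - by move=> n ? _; rewrite lee_fin.
  - by move=> ? _ ? ? mn; rewrite lee_fin; exact/lefP/nd_nnsfun_approx.
under eq_fun do rewrite sfE.
rewrite -monotone_convergence//=.
- apply: eq_integral => x _; apply/cvg_lim => //=.
  apply: cvgeZr => //; exact: cvg_nnsfun_approx.
- by move=> n; apply: emeasurable_funM => //; exact/measurable_EFinP/measurable_funTS.
- by move=> n ? _; rewrite mule_ge0// lee_fin ?normal_pdf_ge0.
- move=> x _ ? ? mn; apply: lee_wpmul2r; first by rewrite lee_fin normal_pdf_ge0.
  by rewrite lee_fin; exact/lefP/nd_nnsfun_approx.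
Qed.

Lemma normal_pdfS (m : R) (s : R) y : 0 < s ->
  normal_pdf m s (m + s * y) * s = normal_pdf 0 1 y.
Proof.
move=> s0; rewrite !normal_pdfE ?oner_eq0 ?gt_eqF// /normal_peak /normal_fun.
have -> : Num.sqrt (s ^+ 2 * pi *+ 2) = s * Num.sqrt (1 ^+ 2 * pi *+ 2).
  by rewrite expr1n mul1r -mulrnAr sqrtrM ?sqr_ge0// sqrtr_sqr gtr0_norm.
rewrite invfM mulrAC [X in X * _]mulrAC mulVf ?gt_eqF// mul1r.
congr (_ * expR _); rewrite addrC addKr subr0 expr1n exprMn.
rewrite -[s ^+ 2 *+ 2]mulr_natr invfM mulrA -mulrN mulrAC mulrC -mulrA.
by rewrite mulKf// expf_neq0// gt_eqF.
Qed.

Lemma normal_prob_affine (m s : R) (G : R -> R) : 0 < s ->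
  continuous G -> (forall x, 0 <= G x) ->
  (\int[normal_prob m s]_x (G x)%:E =
   \int[normal_prob 0 1]_x (G (m + s * x))%:E)%E.
Proof.
move=> s0 cG G0.
have mG : measurable_fun setT G by exact: continuous_measurable_fun.
pose F (x : R^o) : R^o := m + s * x.
have F' x : is_derive (x : R^o) 1 F s.
  by apply: is_derive_eq; rewrite add0r mul1r /GRing.scale/= mulr1.
have F'E : F^`()%classic = cst s.
  by apply/funext => x; rewrite derive1E derive_val.
transitivity (\int[mu]_x ((G x)%:E * (normal_pdf m s x)%:E))%E.
  apply: ge0_integral_normal_prob; last by move=> x; rewrite lee_fin.
  exact: measurableT_comp.
transitivity (\int[mu]_x ((G (F x))%:E * (normal_pdf 0 1 x)%:E))%E; last first.
  apply/esym; apply: (@ge0_integral_normal_prob 0 1 (EFin \o G \o F)).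
    apply: measurableT_comp => //; apply: measurableT_comp => //.
    by apply: measurable_funD => //; exact: measurable_funM.
  by move=> x; rewrite lee_fin.
rewrite -[LHS]/(\int[mu]_x (G x * normal_pdf m s x)%:E)%E.
rewrite (@increasing_ge0_integration_by_substitutionT _ F)//.
- apply: eq_integral => x _ /=; rewrite !fctE F'E /= -EFinM; congr EFin.
  by rewrite -mulrA normal_pdfS.
- by move=> x y xy; rewrite /F ltrD2l ltr_pM2l.
- by rewrite F'E => ?; exact: cvg_cst.
- by rewrite F'E; exact: is_cvg_cst.
- by rewrite F'E; exact: is_cvg_cst.
- apply/cvgrNyPle => A; have := @nbhs_ninfty_le R _ (num_real ((A - m) / s)).
  apply: filterS => x; rewrite ler_pdivlMr// lerBrDl mulrC; exact.
- apply/cvgryPge => A; have := @nbhs_pinfty_ge R _ (num_real ((A - m) / s)).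
  apply: filterS => x; rewrite ler_pdivrMr// lerBlDl mulrC; exact.
- move=> x; apply: cvgM; first exact: cG.
  by apply: continuous_normal_pdf; rewrite gt_eqF.
- by move=> x; rewrite mulr_ge0// normal_pdf_ge0.
Qed.
End density.

(** * Taylor bounds *)

Section calculus.
Context (R : realType).
Implicit Types (f df : R -> R) (a b u x t : R).

Lemma le_MVT f df (u M : R) : (forall x, is_derive (x : R^o) 1 (f : R^o -> R^o) (df x)) ->
  f 0 = 0 -> (forall c, `|c| <= `|u| -> `|df c| <= M) -> `|f u| <= M * `|u|.
Proof.
move=> fdf f0 dfM.
have cf : continuous f.
  by move=> x; apply/differentiable_continuous/derivable1_diffP; case: (fdf x).
have [u0|u0] := leP 0 u.
  have [//|c cu] := @MVT_segment _ f df _ _ u0 (fun x _ => fdf x).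
    by apply: continuous_subspaceT.
  rewrite f0 !subr0 => ->; rewrite normrM ler_wpM2r// dfM//.
  by move: cu; rewrite in_itv/= => /andP[c0 cu]; rewrite !ger0_norm.
have [|c cu] := @MVT_segment _ f df u 0 (ltW u0) (fun x _ => fdf x).
  by apply: continuous_subspaceT.
rewrite f0 !sub0r mulrN => /oppr_inj ->; rewrite normrM ler_wpM2r// dfM//.
by move: cu; rewrite in_itv/= => /andP[uc c0]; rewrite !ler0_norm// ?lerN2// ltW.
Qed.

Lemma cos_taylor1 a b : `|cos (a + b) - cos a + b * sin a| <= b ^+ 2.
Proof.
pose f b := cos (a + b) - cos a + b * sin a.
have df x : is_derive (x : R^o) 1 (f : R^o -> R^o) (- sin (a + x) + sin a).
  by apply: is_derive_eq; rewrite /GRing.scale/=; ring.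
rewrite -real_normK ?num_real// expr2.
apply: (le_MVT df) => [|c cb]; first by rewrite /f addr0 mul0r addr0 subrr.
rewrite addrC distrC; apply: le_trans cb.
pose g b := sin (a + b) - sin a.
have dg x : is_derive (x : R^o) 1 (g : R^o -> R^o) (cos (a + x)).
  by apply: is_derive_eq; rewrite /GRing.scale/=; ring.
have := @le_MVT g _ c 1 dg; rewrite mul1r; apply; first by rewrite /g addr0 subrr.
by move=> x _; rewrite ler_norml cos_geN1 cos_le1.
Qed.

Lemma sin_taylor1 a b : `|sin (a + b) - sin a - b * cos a| <= b ^+ 2.
Proof.
have := cos_taylor1 (a - pi / 2) b.
have hc x : cos (x - pi / 2) = sin x.
  by rewrite cosD cosN cos_pihalf sinN sin_pihalf; ring.
have hs x : sin (x - pi / 2) = - cos x.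
  by rewrite sinD cosN cos_pihalf sinN sin_pihalf; ring.
by rewrite [_ - _ + b]addrAC !hc hs mulrN.
Qed.

Lemma cos_taylor2 a b :
  `|cos (a + b) - (cos a - b * sin a - b ^+ 2 / 2 * cos a)| <= `|b| ^+ 3.
Proof.
pose f b := cos (a + b) - (cos a - b * sin a - b ^+ 2 / 2 * cos a).
have df x : is_derive (x : R^o) 1 (f : R^o -> R^o)
    (- (sin (a + x) - sin a - x * cos a)).
  by apply: is_derive_eq; rewrite /GRing.scale/=; field.
rewrite [leRHS]exprSr; apply: (le_MVT df) => [|c cb].
  by rewrite /f addr0 expr0n/= !mul0r !subr0 subrr.
rewrite normrN (le_trans (sin_taylor1 _ _))// -real_normK ?num_real//.
by rewrite ler_pXn2r ?nnegrE.
Qed.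

Lemma expR_taylor0 u : `|expR u - 1| <= expR `|u| * `|u|.
Proof.
pose f u := expR u - 1.
have df x : is_derive (x : R^o) 1 (f : R^o -> R^o) (expR x).
  by apply: is_derive_eq; rewrite /GRing.scale/=; ring.
apply: (le_MVT df) => [|c cu]; first by rewrite /f expR0 subrr.
by rewrite ger0_norm ?expR_ge0// ler_expR (le_trans _ cu)// ler_norm.
Qed.

Lemma expR_taylor1 u : `|expR u - 1 - u| <= u ^+ 2 * expR `|u|.
Proof.
pose f u := expR u - 1 - u.
have df x : is_derive (x : R^o) 1 (f : R^o -> R^o) (expR x - 1).
  by apply: is_derive_eq; rewrite /GRing.scale/=; ring.
rewrite -real_normK ?num_real// expr2 mulrAC (mulrC `|u| (expR _)).
apply: (le_MVT df) => [|c cu]; first by rewrite /f expR0 !subrr.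
rewrite (le_trans (expR_taylor0 _))// ler_pM ?expR_ge0//.
by rewrite ler_expR.
Qed.

(** A second-order error bound is how derivatives under an integral sign are
    obtained below: it passes through the integral without dominated convergence. *)
Lemma is_derive_quadratic f t d C :
  (forall e, `|e| <= 1 -> `|f (t + e) - f t - e * d| <= C * e ^+ 2) ->
  is_derive (t : R^o) 1 (f : R^o -> R^o) d.
Proof.
move=> h.
suff fd : h^-1 * (f (h + t) - f t) @[h --> 0^'] --> d.
  apply: DeriveDef.
    by apply/cvg_ex; exists d; under eq_fun do rewrite /GRing.scale/= mulr1.
  by apply/cvg_lim => //; under eq_fun do rewrite /GRing.scale/= mulr1.
apply/cvgrPdist_le => e e0; near=> x.
have x0 : x != 0 by near: x; exact: nbhs_dnbhs_neq.
have x1 : `|x| <= 1.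
  by near: x; apply: dnbhs0_le.
have xe : `|x| <= e / (1 + `|C|).
  by near: x; apply: dnbhs0_le; rewrite divr_gt0// ltr_pwDl.
rewrite distrC -[d](mulKf x0) -mulrBr normrM normfV ler_pdivrMl ?normr_gt0//.
rewrite [x + t]addrC (le_trans (h _ x1))// -real_normK ?num_real// expr2 mulrA.
rewrite mulrC ler_wpM2l//; move: xe; rewrite ler_pdivlMr ?ltr_pwDl//.
apply: le_trans; rewrite mulrC ler_wpM2l// (le_trans (ler_norm _))//.
by rewrite lerDr.
Unshelve. all: by end_near. Qed.

End calculus.

(** * The standard normal law *)

Section stdnormal.
Context (R : realType).
Local Notation N := (normal_prob (0 : R) 1).
Implicit Types (f g : R -> R) (s t x a th : R).

(** A class of functions integrable against every normal density and stable
    under sums, products and shifts. *)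
Definition subexp g := exists C k : R,
  [/\ 0 <= C, 0 <= k & forall x, `|g x| <= C * expR (k * `|x|)].

Lemma subexp_cst c : subexp (fun=> c).
Proof.
exists `|c|, 0; split=> // x; by rewrite mul0r expR0 mulr1.
Qed.

Lemma subexp_id : subexp id.
Proof.
exists 1, 1; split=> // x; rewrite !mul1r (le_trans _ (expR_ge1Dx _))//.
by rewrite lerDr.
Qed.

Lemma subexpD f g : subexp f -> subexp g -> subexp (fun x => f x + g x).
Proof.
move=> [C [k [C0 k0 fC]]] [D [l [D0 l0 gD]]]; exists (C + D), (k + l).
split; rewrite ?addr_ge0// => x; rewrite (le_trans (ler_normD _ _))//.
rewrite mulrDl lerD ?(le_trans (fC x))// ?(le_trans (gD x))// ler_wpM2l//;
  by rewrite ler_expR ler_wpM2r// ?lerDl ?lerDr.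
Qed.

Lemma subexpM f g : subexp f -> subexp g -> subexp (fun x => f x * g x).
Proof.
move=> [C [k [C0 k0 fC]]] [D [l [D0 l0 gD]]]; exists (C * D), (k + l).
split; rewrite ?addr_ge0 ?mulr_ge0// => x.
by rewrite normrM mulrDl expRD mulrACA ler_pM.
Qed.

Lemma subexpX f n : subexp f -> subexp (fun x => f x ^+ n).
Proof.
move=> sf; elim: n => [|n ih]; first exact: subexp_cst.
by under eq_fun do rewrite exprS; exact: subexpM.
Qed.

Lemma subexp_le f g : subexp g -> (forall x, `|f x| <= `|g x|) -> subexp f.
Proof.
by move=> [C [k [C0 k0 gC]]] fg; exists C, k; split=> // x; exact: le_trans (gC x).
Qed.

Lemma subexp_bounded f C : (forall x, `|f x| <= C) -> subexp f.
Proof.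
move=> fC; apply: (subexp_le (subexp_cst C)) => x.
exact: le_trans (ler_norm C).
Qed.

Lemma subexp_expR s : subexp (fun x => expR (s * x)).
Proof.
exists 1, `|s|; split=> // x; rewrite mul1r ger0_norm ?expR_ge0// ler_expR.
by rewrite -normrM ler_norm.
Qed.

Lemma normal_pdf_shift s x :
  normal_pdf s 1 x = expR (s * x - s ^+ 2 / 2) * normal_pdf 0 1 x.
Proof.
rewrite !normal_pdfE ?oner_eq0// /normal_peak /normal_fun mulrCA -expRD.
congr (_ * expR _); by field.
Qed.

(** Completing the square: up to the factor e^(s^2 / 2), the integrand times the
    density of N(0, 1) is the density of N(s, 1). *)
Lemma integral_expR_normal s :
  (\int[N]_x (expR (s * x))%:E = (expR (s ^+ 2 / 2))%:E)%E.
Proof.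
rewrite (@ge0_integral_normal_prob _ _ _ (fun x => (expR (s * x))%:E)); last 2 first.
- by apply/measurable_EFinP; apply: measurableT_comp => //; exact: mulrl_measurable.
- by move=> x; rewrite lee_fin expR_ge0.
transitivity (\int[@lebesgue_measure R]_x
    ((expR (s ^+ 2 / 2))%:E * (normal_pdf s 1 x)%:E))%E.
  apply: eq_integral => x _; rewrite -!EFinM (normal_pdf_shift s) mulrA -expRD.
  by rewrite [_ + (_ - _)]addrC subrK.
rewrite ge0_integralZl//=.
- by rewrite integral_normal_pdf mule1.
- by apply/measurable_EFinP; exact: measurable_normal_pdf.
- by move=> x _; rewrite lee_fin normal_pdf_ge0.
Qed.

Lemma integrable_expR_normal s :
  N.-integrable setT (fun x => (expR (s * x))%:E).
Proof.
apply/integrableP; split.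
  by apply/measurable_EFinP; apply: measurableT_comp => //; exact: mulrl_measurable.
under eq_integral do rewrite gee0_abs ?lee_fin ?expR_ge0//.
by rewrite integral_expR_normal ltry.
Qed.

Lemma integrable_subexp g : measurable_fun setT g -> subexp g ->
  N.-integrable setT (EFin \o g).
Proof.
move=> mg [C [k [C0 k0 gC]]].
have : N.-integrable setT
    (fun x => C%:E * ((expR (k * x))%:E + (expR (- k * x))%:E))%E.
  by apply: integrableZl => //; apply: integrableD => //; exact: integrable_expR_normal.
apply: le_integrable => //; first exact/measurable_EFinP.
move=> x _; rewrite /= lee_fin.
rewrite [leRHS]ger0_norm ?mulr_ge0 ?addr_ge0 ?expR_ge0//.
rewrite (le_trans (gC x))// ler_wpM2l//; have [x0|x0] := ger0P x.
  by rewrite lerDl expR_ge0.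
by rewrite mulNr -mulrN lerDr expR_ge0.
Qed.

Lemma subexp_shift g s : subexp g -> subexp (fun x => g (s + x)).
Proof.
move=> [C [k [C0 k0 gC]]]; exists (C * expR (k * `|s|)), k.
split=> [|//|x]; first by rewrite mulr_ge0 ?expR_ge0.
rewrite (le_trans (gC _))// -mulrA -expRD -mulrDr ler_wpM2l// ler_expR.
by rewrite ler_wpM2l// ler_normD.
Qed.

Lemma continuous_shift g s : continuous g -> continuous (fun x => g (s + x)).
Proof.
move=> cg x; apply: continuous_comp; last exact: cg.
by apply: (@continuousD R R^o); [exact: cst_continuous|exact: cvg_id].
Qed.

Lemma continuous_expRl s : continuous (fun x => expR (s * x)).
Proof.
move=> x; apply: continuous_comp; last exact: continuous_expR.
exact: mulrl_continuous.
Qed.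

Lemma continuous_fctD f g : continuous f -> continuous g ->
  continuous (fun x => f x + g x).
Proof. by move=> cf cg x; apply: (@continuousD R R^o); [exact: cf|exact: cg]. Qed.

Lemma continuous_fctM (U : topologicalType) (f g : U -> R) :
  continuous f -> continuous g ->
  continuous (fun y => f y * g y).
Proof. by move=> cf cg x; apply: (@continuousM R U); [exact: cf|exact: cg]. Qed.

Lemma integrable_csubexp g : continuous g -> subexp g ->
  N.-integrable setT (EFin \o g).
Proof. by move=> cg; apply: integrable_subexp; exact: continuous_measurable_fun. Qed.

(* the density ratio of N(s, 1) to N(0, 1) *)
Let w s x := expR (s * x - s ^+ 2 / 2).

Let wE s : w s = fun x => expR (- (s ^+ 2 / 2)) * expR (s * x).
Proof. by apply/funext => x; rewrite /w addrC expRD. Qed.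

Let cw s : continuous (w s).
Proof.
rewrite wE; apply: continuous_fctM; first exact: cst_continuous.
exact: continuous_expRl.
Qed.

Let sw s : subexp (w s).
Proof. by rewrite wE; apply: subexpM; [exact: subexp_cst|exact: subexp_expR]. Qed.

Let normal_shift_ge0 g s : continuous g -> (forall x, 0 <= g x) ->
  \int[N]_x g (s + x) = \int[N]_x (g x * w s x).
Proof.
move=> cg g0; congr fine.
have := normal_prob_affine s ltr01 cg g0.
under [X in _ = X -> _]eq_integral do rewrite mul1r.
move=> <-; have mg : measurable_fun setT g by exact: continuous_measurable_fun.
transitivity (\int[@lebesgue_measure R]_x ((g x)%:E * (normal_pdf s 1 x)%:E))%E.
  apply: ge0_integral_normal_prob; first exact/measurable_EFinP.
  by move=> x; rewrite lee_fin.
transitivity (\int[@lebesgue_measure R]_x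
    ((g x * w s x)%:E * (normal_pdf 0 1 x)%:E))%E; last first.
  apply/esym; apply: ge0_integral_normal_prob.
    apply/measurable_EFinP; apply: measurable_funM => //.
    exact: continuous_measurable_fun.
  by move=> x; rewrite lee_fin mulr_ge0 ?expR_ge0.
by apply: eq_integral => x _; rewrite -!EFinM (normal_pdf_shift s) mulrA.
Qed.

(** Both sides are the integral of g under N(s, 1). An exponential majorant H
    makes g the difference of the nonnegative functions g + H and H, without
    losing continuity. *)
Lemma normal_shift g s : continuous g -> subexp g ->
  \int[N]_x g (s + x) = \int[N]_x (g x * expR (s * x - s ^+ 2 / 2)).
Proof.
move=> cg sg; have [C [k [C0 k0 gC]]] := sg.
pose H x := C * (expR (k * x) + expR (- k * x)).
have cH : continuous H.
  apply: continuous_fctM; first exact: cst_continuous.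
  by apply: continuous_fctD; exact: continuous_expRl.
have sH : subexp H.
  apply: subexpM; first exact: subexp_cst.
  by apply: subexpD; exact: subexp_expR.
have H0 x : 0 <= H x by rewrite mulr_ge0 ?addr_ge0 ?expR_ge0.
have gH x : 0 <= g x + H x.
  rewrite -lerBlDr sub0r lerNl (le_trans (ler_norm _))// normrN (le_trans (gC _))//.
  rewrite ler_wpM2l//; have [x0|x0] := ger0P x; first by rewrite lerDl expR_ge0.
  by rewrite mulNr -mulrN lerDr expR_ge0.
pose G x := g x + H x.
have cG : continuous G by exact: continuous_fctD.
have sG : subexp G by exact: subexpD.
have gE x : g x = G x - H x by rewrite /G addrK.
under eq_Rintegral do rewrite gE.
under [RHS]eq_Rintegral do rewrite gE mulrBl.
rewrite !RintegralB//.
- by rewrite !normal_shift_ge0.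
- exact: (integrable_csubexp (continuous_fctM cG (@cw s)) (subexpM sG (sw s))).
- exact: (integrable_csubexp (continuous_fctM cH (@cw s)) (subexpM sH (sw s))).
- exact: (integrable_csubexp (continuous_shift cG) (subexp_shift s sG)).
- exact: (integrable_csubexp (continuous_shift cH) (subexp_shift s sH)).
Qed.

Lemma continuous_fctB f g : continuous f -> continuous g ->
  continuous (fun x => f x - g x).
Proof. by move=> cf cg x; apply: (@continuousB R R^o); [exact: cf|exact: cg]. Qed.

Lemma le_normal_expR (r : R -> R) (c k : R) : 0 <= k -> 0 <= c ->
  measurable_fun setT r ->
  (forall x, `|r x| <= c * expR (k * `|x|)) ->
  `|\int[N]_x r x| <= c * \int[N]_x expR (k * `|x|).
Proof.
move=> k0 c0 mr rc.
have sr : subexp r by exists c, k.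
have me : measurable_fun setT (fun x : R => expR (k * `|x|)).
  by apply: measurableT_comp => //; exact: measurable_funM.
have ie : N.-integrable setT (EFin \o (fun x : R => expR (k * `|x|))).
  apply: integrable_subexp => //; exists 1, k; split=> // x.
  by rewrite ger0_norm ?expR_ge0// mul1r.
rewrite -RintegralZl//; apply: le_Rintegral_norm => //; exact: integrableRZ.
Qed.

(** Stein's identity. The two sides of E g(X + s) = E (g(X) w_s(X)), where
    w_s is the density ratio of [normal_shift], are expanded to first order at
    s = 0: the left one gives E g'(X), the right one E (X g(X)). *)
Lemma normal_stein g dg : continuous g -> subexp g -> continuous dg -> subexp dg ->
  (exists C k, [/\ 0 <= C, 0 <= k & forall x s, `|s| <= 1 ->
     `|g (s + x) - g x - s * dg x| <= C * s ^+ 2 * expR (k * `|x|)]) ->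
  \int[N]_x (x * g x) = \int[N]_x dg x.
Proof.
move=> cg sg cdg sdg [C [k [C0 k0 gC]]].
have [D [l [D0 l0 gD]]] := sg.
have cid : continuous (fun x : R => x) by move=> x; exact: cvg_id.
have ccst (c : R) : continuous (fun _ : R => c) by exact: cst_continuous.
have cxg : continuous (fun x => x * g x) by exact: continuous_fctM.
have sxg : subexp (fun x => x * g x) by exact: subexpM subexp_id sg.
have ig := integrable_csubexp cg sg.
have idg := integrable_csubexp cdg sdg.
have ixg := integrable_csubexp cxg sxg.
pose r1 s x := g (s + x) - g x - s * dg x.
pose r2 s x := g x * w s x - g x - s * (x * g x).
have igs s := integrable_csubexp (continuous_shift (s := s) cg) (subexp_shift s sg).
have igw s := integrable_csubexp (continuous_fctM cg (@cw s)) (subexpM sg (sw s)).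
have E1 s : \int[N]_x r1 s x =
    \int[N]_x g (s + x) - \int[N]_x g x - s * \int[N]_x dg x.
  rewrite -RintegralZl// -!RintegralB//; first exact: integrableRB.
  exact: integrableRZ.
have E2 s : \int[N]_x r2 s x =
    \int[N]_x (g x * w s x) - \int[N]_x g x - s * \int[N]_x (x * g x).
  rewrite -RintegralZl// -!RintegralB//; first exact: integrableRB.
  exact: integrableRZ.
have bw s x : `|s| <= 1 -> `|w s x - 1 - s * x| <= (expR 1 + 1) * s ^+ 2 * expR (3 * `|x|).
  move=> s1; pose u := s * x - s ^+ 2 / 2.
  have s2 : s ^+ 2 <= `|s|.
    by rewrite -real_normK ?num_real// expr2 ler_piMl.
  have uE : `|u| <= `|s| * (1 + `|x|).
    rewrite (le_trans (ler_normB _ _))// normrM mulrDr mulr1 addrC lerD2r.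
    rewrite ger0_norm ?divr_ge0 ?sqr_ge0// (le_trans _ s2)//.
    by rewrite ler_pdivrMr// ler_peMr ?sqr_ge0// ler1n.
  have u1 : `|u| <= 1 + `|x|.
    by rewrite (le_trans uE)// ler_piMl// addr_ge0.
  have xe : 1 + `|x| <= expR `|x| by exact: expR_ge1Dx.
  have -> : w s x - 1 - s * x = (expR u - 1 - u) - s ^+ 2 / 2.
    by rewrite /w -/u {3}/u; ring.
  rewrite (le_trans (ler_normB _ _))// mulrDl mulrDl lerD//.
    rewrite (le_trans (expR_taylor1 u))//.
    have -> : expR 1 * s ^+ 2 * expR (3 * `|x|) =
        s ^+ 2 * expR `|x| ^+ 2 * expR (1 + `|x|).
      rewrite expRD -expRM_natl (_ : 3 * `|x| = 2 * `|x| + `|x|); last by ring.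
      by rewrite expRD; ring.
    apply: ler_pM; rewrite ?sqr_ge0 ?expR_ge0 ?ler_expR//.
    rewrite -[u ^+ 2]real_normK ?num_real// -[s ^+ 2]real_normK ?num_real// -exprMn.
    rewrite ler_pXn2r ?nnegrE ?mulr_ge0 ?expR_ge0//.
    by rewrite (le_trans uE)// ler_wpM2l.
  rewrite mul1r ger0_norm ?divr_ge0 ?sqr_ge0//.
  apply: (@le_trans _ _ (s ^+ 2 * 1)); last first.
    by rewrite ler_wpM2l ?sqr_ge0// -expR0 ler_expR mulr_ge0.
  by rewrite ler_wpM2l ?sqr_ge0// invf_le1 ?ler1n.
pose K1 := C * \int[N]_x expR (k * `|x|).
pose K2 := D * (expR 1 + 1) * \int[N]_x expR ((l + 3) * `|x|).
(* Both remainders are O(s^2), hence so is s times the difference to be shown null. *)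
have B s : `|s| <= 1 ->
    `|s * (\int[N]_x (x * g x) - \int[N]_x dg x)| <= s ^+ 2 * (K1 + K2).
  move=> s1.
  have -> : s * (\int[N]_x (x * g x) - \int[N]_x dg x) =
      \int[N]_x r1 s x - \int[N]_x r2 s x.
    by rewrite E1 E2 (normal_shift s cg sg); ring.
  rewrite (le_trans (ler_normB _ _))// mulrDr lerD//.
    rewrite /K1 mulrA [s ^+ 2 * C]mulrC; apply: le_normal_expR => //.
    - by rewrite mulr_ge0 ?sqr_ge0.
    - apply: continuous_measurable_fun; apply: continuous_fctB.
        by apply: continuous_fctB => //; exact: continuous_shift.
      exact: continuous_fctM.
    - by move=> x; exact: gC.
  rewrite /K2 mulrA; apply: le_normal_expR.
  - by rewrite addr_ge0.
  - apply: mulr_ge0; first exact: sqr_ge0.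
    by apply: mulr_ge0 => //; rewrite addr_ge0 ?expR_ge0.
  - apply: continuous_measurable_fun; apply: continuous_fctB.
      by apply: continuous_fctB => //; exact: continuous_fctM.
    exact: continuous_fctM.
  - move=> x; have -> : r2 s x = g x * (w s x - 1 - s * x) by rewrite /r2; ring.
    rewrite normrM mulrDl expRD.
    have -> : s ^+ 2 * (D * (expR 1 + 1)) * (expR (l * `|x|) * expR (3 * `|x|)) =
       (D * expR (l * `|x|)) * ((expR 1 + 1) * s ^+ 2 * expR (3 * `|x|)) by ring.
    by apply: ler_pM => //; exact: bw.
apply/eqP; rewrite -subr_eq0 -normr_le0; set delta := (X in `|X|).
apply/ler_addgt0Pl => e e0; rewrite addr0.
have K0 : 0 <= K1 + K2.
  by have := B 1; rewrite normr1 expr1n !mul1r => /(_ (lexx _)); exact: le_trans.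
have d0 : 0 < 1 + (K1 + K2) + e by rewrite addr_gt0// ltr_pwDl.
have := B (e / (1 + (K1 + K2) + e)).
have s0 : 0 < e / (1 + (K1 + K2) + e) by rewrite divr_gt0.
rewrite -/delta gtr0_norm// normrM gtr0_norm// expr2 -mulrA ler_pM2l// => /(_ _)/le_trans; apply.
  by rewrite ler_pdivrMr// mul1r lerDr addr_ge0.
rewrite mulrAC ler_pdivrMr// ler_wpM2l ?(ltW e0)//.
by rewrite addrAC lerDr addr_ge0// ltW.
Qed.

Lemma continuous_affine_cos th t : continuous (fun x => cos (th + t * x)).
Proof.
move=> x; apply: continuous_comp; last exact: continuous_cos.
by apply: continuous_fctD; [exact: cst_continuous|exact: mulrl_continuous].
Qed.

Lemma continuous_affine_sin th t : continuous (fun x => sin (th + t * x)).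
Proof.
move=> x; apply: continuous_comp; last exact: continuous_sin.
by apply: continuous_fctD; [exact: cst_continuous|exact: mulrl_continuous].
Qed.

Lemma normr_sin_le1 x : `|sin x| <= 1.
Proof. by rewrite ler_norml sin_geN1 sin_le1. Qed.

Lemma normal_sin_stein th t :
  \int[N]_x (x * sin (th + t * x)) = t * \int[N]_x cos (th + t * x).
Proof.
have cc := @continuous_affine_cos th t.
have scos : subexp (fun x => cos (th + t * x)).
  by apply: subexp_bounded (fun x => cos_max _).
rewrite -RintegralZl//; last exact: integrable_csubexp.
apply: normal_stein.
- exact: continuous_affine_sin.
- exact: subexp_bounded (fun x => normr_sin_le1 _).
- by apply: continuous_fctM => //; exact: cst_continuous.
- by apply: subexpM => //; exact: subexp_cst.
exists (t ^+ 2), 0; split; rewrite ?sqr_ge0// => x s s1.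
rewrite mul0r expR0 mulr1 -exprMn.
have := sin_taylor1 (th + t * x) (t * s).
have -> : th + t * (s + x) = th + t * x + t * s by ring.
by rewrite [s * (t * _)]mulrCA mulrA.
Qed.

(** By Stein's identity, t |-> E cos(th + t X) solves h' = - t h, and
    h 0 = cos th. *)
Lemma normal_cos th t :
  \int[N]_x cos (th + t * x) = expR (- (t ^+ 2 / 2)) * cos th.
Proof.
pose h t := \int[N]_x cos (th + t * x).
have icos t' : N.-integrable setT (EFin \o (fun x => cos (th + t' * x))).
  apply: integrable_csubexp; first exact: continuous_affine_cos.
  exact: subexp_bounded (fun x => cos_max _).
have ixsin t' : N.-integrable setT (EFin \o (fun x => x * sin (th + t' * x))).
  apply: integrable_csubexp.
    by apply: continuous_fctM; [move=> x; exact: cvg_id|exact: continuous_affine_sin].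
  by apply: subexpM subexp_id (subexp_bounded (fun x => normr_sin_le1 _)).
have ix2 : N.-integrable setT (EFin \o (fun x => x ^+ 2)).
  apply: integrable_csubexp; last exact: subexpX subexp_id.
  exact: exprn_continuous.
have dh u : is_derive (u : R^o) 1 (h : R^o -> R^o) (- u * h u).
  apply: (@is_derive_quadratic _ _ _ _ (\int[N]_x x ^+ 2)) => e _.
  have -> : h (u + e) - h u - e * (- u * h u) =
      \int[N]_x (cos (th + (u + e) * x) - cos (th + u * x)
                 + e * (x * sin (th + u * x))).
    rewrite RintegralD//; last 2 first.
    - exact: integrableRB.
    - exact: integrableRZ.
    by rewrite RintegralB// RintegralZl// normal_sin_stein /h; ring.
  rewrite -RintegralZr//; apply: le_Rintegral_norm.
  - apply: measurable_intR; apply: integrableRD; last exact: integrableRZ.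
    exact: integrableRB.
  - by under eq_fun do rewrite mulrC; exact: integrableRZ.
  - move=> x; have := cos_taylor1 (th + u * x) (e * x).
    have -> : th + (u + e) * x = th + u * x + e * x by ring.
    by rewrite mulrA exprMn [e ^+ 2 * _]mulrC.
pose k u := expR (u ^+ 2 / 2) * h u.
have dk u : is_derive (u : R^o) 1 (k : R^o -> R^o) 0.
  by apply: is_derive_eq; rewrite /GRing.scale/=; field.
have k0 : k 0 = cos th.
  rewrite /k /h expr0n/= mul0r expR0 mul1r.
  under eq_Rintegral do rewrite mul0r addr0.
  by rewrite Rintegral_prob_cst.
rewrite -k0 -(is_derive_0_is_cst t 0 dk) /k mulrA -expRD addNr expR0.
by rewrite mul1r.
Qed.

Lemma integrable_normal_pow n : N.-integrable setT (EFin \o (fun x => x ^+ n)).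
Proof.
apply: integrable_csubexp; first exact: exprn_continuous.
exact: subexpX subexp_id.
Qed.

Lemma normal_moment1 : \int[N]_x x = 0.
Proof.
transitivity (\int[N]_x (x * 1)).
  by apply: eq_Rintegral => x _; rewrite mulr1.
rewrite -[RHS](Rintegral_prob_cst N).
apply: (@normal_stein (fun=> 1)); do ?exact: cst_continuous; do ?exact: subexp_cst.
exists 0, 0; split=> // x s _.
by rewrite !mul0r mulr0 subrr subr0 normr0.
Qed.

Lemma normal_moment2 : \int[N]_x x ^+ 2 = 1.
Proof.
rewrite -[RHS](Rintegral_prob_cst N); under eq_Rintegral do rewrite expr2.
apply: normal_stein.
- by move=> x; exact: cvg_id.
- exact: subexp_id.
- exact: cst_continuous.
- exact: subexp_cst.
exists 0, 0; split=> // x s _.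
by rewrite !mul0r mulr1 addrK subrr normr0.
Qed.

Lemma normal_moment4 : \int[N]_x x ^+ 4 = 3.
Proof.
have -> : 3 = \int[N]_x (3 * x ^+ 2).
  by rewrite RintegralZl ?normal_moment2 ?mulr1//; exact: integrable_normal_pow.
under eq_Rintegral do rewrite exprS.
apply: normal_stein.
- exact: exprn_continuous.
- exact: subexpX subexp_id.
- by apply: continuous_fctM; [exact: cst_continuous|exact: exprn_continuous].
- by apply: subexpM; [exact: subexp_cst|exact: subexpX subexp_id].
exists 3, 1; split=> // x s s1.
have -> : (s + x) ^+ 3 - x ^+ 3 - s * (3 * x ^+ 2) = s ^+ 2 * (3 * x + s) by ring.
rewrite normrM ger0_norm ?sqr_ge0// [3 * s ^+ 2]mulrC -[leRHS]mulrA.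
apply: ler_wpM2l; first exact: sqr_ge0.
rewrite (le_trans (ler_normD _ _))// normrM ger0_norm//.
apply: (@le_trans _ _ (3 * (1 + `|x|))).
  by rewrite mulrDr mulr1 addrC lerD2r (le_trans s1)// ler1n.
by rewrite ler_wpM2l// mul1r expR_ge1Dx.
Qed.

Lemma normal_sqr_centred (u := fun x : R => x ^+ 2 - 1) :
  [/\ N.-integrable setT (EFin \o u), N.-integrable setT (EFin \o (fun x => u x ^+ 2)),
      \int[N]_x u x = 0 & \int[N]_x u x ^+ 2 = 2].
Proof.
have ip n : N.-integrable setT (EFin \o (fun x => x ^+ n)) by exact: integrable_normal_pow.
have i1 := integrableR_cst N 1.
have uE x : u x ^+ 2 = x ^+ 4 + (- 2 * x ^+ 2 + 1) by rewrite /u; ring.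
have iZ := integrableRZ (- 2) (ip 2).
split.
- exact: integrableRB.
- by under eq_fun do rewrite uE; apply: integrableRD => //; exact: integrableRD.
- by rewrite RintegralB// normal_moment2 Rintegral_prob_cst subrr.
under eq_Rintegral do rewrite uE.
rewrite RintegralD//; last exact: integrableRD.
by rewrite RintegralD// RintegralZl// normal_moment4 normal_moment2 Rintegral_prob_cst; ring.
Qed.

(** The variable X^2 - 1 is centred with variance 2, so both terms equal
    (1 - a^2) cos th up to O(|a|^3), the error being controlled by the third
    absolute moment of X^2 - 1. For |a| > 1 the trivial bound 2 suffices. *)
Lemma normal_cos_sqr : exists2 C : R, 0 <= C & forall th a,
  `|\int[N]_x cos (th + a * (x ^+ 2 - 1)) - expR (- a ^+ 2) * cos th| <= C * `|a| ^+ 3.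
Proof.
pose u (x : R) := x ^+ 2 - 1.
have cu : continuous u.
  by apply: continuous_fctB; [exact: exprn_continuous|exact: cst_continuous].
have su : subexp u.
  by apply: subexpD; [exact: subexpX subexp_id|exact: subexp_cst].
have [iu iu2 Eu Eu2] := normal_sqr_centred; rewrite -/u in iu iu2 Eu Eu2.
have cu3 : continuous (fun x => `|u x| ^+ 3).
  move=> x; apply: (@continuous_comp _ _ _ (fun x => `|u x|) (fun y => y ^+ 3)).
    by apply: continuous_comp; [exact: cu|exact: norm_continuous].
  exact: exprn_continuous.
have su3 : subexp (fun x => `|u x| ^+ 3).
  by apply: subexpX; apply: subexp_le su _ => x; rewrite normr_id.
have iu3 := integrable_csubexp cu3 su3.
have ic th a : N.-integrable setT (EFin \o (fun x => cos (th + a * u x))).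
  apply: integrable_csubexp; last exact: subexp_bounded (fun x => cos_max _).
  move=> x; apply: (@continuous_comp _ _ _ u (fun y => cos (th + a * y))); first exact: cu.
  exact: continuous_affine_cos.
have e0 (y : R) : 0 <= y -> `|expR (- y) - 1 + y| <= y ^+ 2.
  move=> y0; have y1 : 0 < 1 + y by rewrite ltr_pwDl.
  rewrite ger0_norm; last first.
    by have := expR_ge1Dx (- y); lra.
  have : expR (- y) <= (1 + y)^-1.
    by rewrite expRN lef_pV2 ?posrE ?expR_gt0// expR_ge1Dx.
  have : (1 + y)^-1 <= 1 - y + y ^+ 2.
    rewrite -div1r ler_pdivrMr//.
    have -> : (1 - y + y ^+ 2) * (1 + y) = 1 + y ^+ 3 by ring.
    by rewrite lerDl exprn_ge0.
  lra.
set m3 := \int[N]_x `|u x| ^+ 3.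
have m30 : 0 <= m3 by apply: Rintegral_ge0 => x _; rewrite exprn_ge0.
exists (m3 + 2); first by rewrite addr_ge0.
move=> th a; have [a1|a1] := leP `|a| 1; last first.
  apply: (@le_trans _ _ 2).
    rewrite (le_trans (ler_normB _ _))// (_ : 2 = 1 + 1) ?lerD//.
      apply: le_Rintegral_bounded => [|x]; last exact: cos_max.
      exact: measurable_intR (ic th a).
    rewrite normrM ger0_norm ?expR_ge0// mulr_ile1 ?expR_ge0 ?cos_max//.
    by rewrite -[leRHS]expR0 ler_expR oppr_le0 sqr_ge0.
  apply: (@le_trans _ _ (2 * `|a| ^+ 3)); last first.
    by rewrite ler_wpM2r ?exprn_ge0// lerDr.
  by rewrite ler_peMr// exprn_ege1// ltW.
pose q x := cos th - a * sin th * u x - a ^+ 2 / 2 * cos th * u x ^+ 2.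
have iq : N.-integrable setT (EFin \o q).
  apply: integrableRB; last exact: integrableRZ.
  by apply: integrableRB (integrableR_cst _ _) _; exact: integrableRZ.
have Eq : \int[N]_x q x = (1 - a ^+ 2) * cos th.
  rewrite RintegralB//; last 2 first.
  - by apply: integrableRB (integrableR_cst _ _) _; exact: integrableRZ.
  - exact: integrableRZ.
  rewrite RintegralB//; [|exact: integrableR_cst|exact: integrableRZ].
  by rewrite !RintegralZl// Eu Eu2 Rintegral_prob_cst; field.
have -> : \int[N]_x cos (th + a * u x) - expR (- a ^+ 2) * cos th =
    \int[N]_x (cos (th + a * u x) - q x) -
    (expR (- a ^+ 2) - 1 + a ^+ 2) * cos th.
  by rewrite RintegralB// Eq; ring.
rewrite (le_trans (ler_normB _ _))// [leRHS]mulrDl lerD//.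
  rewrite -RintegralZr//; apply: le_Rintegral_norm.
  - by apply: measurable_intR; exact: integrableRB.
  - by under eq_fun do rewrite mulrC; exact: integrableRZ.
  - move=> x; rewrite -exprMn -normrM mulrC; apply: le_trans (cos_taylor2 _ _).
    by rewrite /q le_eqVlt; apply/orP; left; apply/eqP; congr `|_ - _|; ring.
rewrite normrM (@le_trans _ _ (a ^+ 4 * 1))//.
  apply: ler_pM => //; last exact: cos_max.
  by rewrite (exprM a 2 2); apply: e0; exact: sqr_ge0.
rewrite mulr1 -[a ^+ 4]ger0_norm ?exprn_even_ge0// normrX exprS.
by apply: ler_wpM2r; rewrite ?exprn_ge0// (le_trans a1)// ler1n.
Qed.

End stdnormal.

(** * Gaussian random variables *)

Section gaussian_laws.
Context (R : realType) d (T : measurableType d) (P : probability T R).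
Local Notation N := (normal_prob (0 : R) 1).

Definition normal_or_dirac (m s : R) (B : set (measurableTypeR R)) : \bar R :=
  if s == 0 then \d_m B else normal_prob m s B.

Lemma ge0_integral_gaussian (X : T -> R) (m s : R) (G : R -> R) :
  measurable_fun setT X -> 0 <= s ->
  (forall B, measurable B -> P (X @^-1` B) = normal_or_dirac m s B) ->
  continuous G -> (forall x, 0 <= G x) ->
  (\int[P]_w (G (X w))%:E = \int[N]_r (G (m + s * r))%:E)%E.
Proof.
move=> mX s0 XP cG G0.
have mG : measurable_fun setT (EFin \o G : measurableTypeR R -> _).
  by apply/measurable_EFinP; exact: continuous_measurable_fun.
have := @ge0_integral_pushforward _ _ _ (measurableTypeR R) _ X mX P setT
  (EFin \o G) measurableT mG.
rewrite preimage_setT => <-; last by move=> x _; rewrite lee_fin.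
have [s00|sn0] := eqVneq s 0.
  transitivity (\int[@dirac _ (measurableTypeR R) m R]_x (EFin \o G) x)%E.
    apply: eq_measure_integral => A mA _; rewrite [LHS]XP//.
    by rewrite /normal_or_dirac s00 eqxx.
  rewrite integral_dirac// diracT mul1e s00.
  under [RHS]eq_integral do rewrite mul0r addr0.
  by rewrite integral_cst// [X in (_ * X)%E]probability_setT mule1.
transitivity (\int[normal_prob m s]_x (EFin \o G) x)%E.
  apply: eq_measure_integral => A mA _; rewrite [LHS]XP//.
  by rewrite /normal_or_dirac (negPf sn0).
by rewrite -normal_prob_affine// lt_neqAle eq_sym sn0.
Qed.

Lemma Rintegral_gaussian_bounded (X : T -> R) (m s : R) (G : R -> R) (C : R) :
  measurable_fun setT X -> 0 <= s ->
  (forall B, measurable B -> P (X @^-1` B) = normal_or_dirac m s B) ->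
  continuous G -> (forall x, `|G x| <= C) ->
  \int[P]_w G (X w) = \int[N]_r G (m + s * r).
Proof.
move=> mX s0 XP cG GC.
have mG : measurable_fun setT G by exact: continuous_measurable_fun.
have GCE (x : R) : G x = (G x + C) - C by rewrite addrK.
have GC0 (x : R) : 0 <= G x + C.
  by rewrite -lerBlDr sub0r; have := GC x; rewrite ler_norml => /andP[].
have iX : P.-integrable setT (EFin \o (fun w => G (X w))).
  by apply: (@integrableR_bounded _ _ _ _ _ C) => //; exact: measurableT_comp.
have iN : N.-integrable setT (EFin \o (fun r => G (m + s * r))).
  apply: (@integrableR_bounded _ _ _ _ _ C) => //.
  by apply: measurableT_comp => //; exact: measurable_funD.
have := ge0_integral_gaussian mX s0 XP (continuous_fctD cG (@cst_continuous _ _ C)) GC0.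
move=> /(congr1 fine).
rewrite -[LHS]/(\int[P]_w (G (X w) + C)) -[RHS]/(\int[N]_r (G (m + s * r) + C)).
rewrite !RintegralD//; try exact: integrableR_cst.
by rewrite !Rintegral_prob_cst => /addIr.
Qed.

Lemma gaussian_cos (X : T -> R) (m s th t : R) :
  measurable_fun setT X -> 0 <= s ->
  (forall B, measurable B -> P (X @^-1` B) = normal_or_dirac m s B) ->
  \int[P]_w cos (th + t * X w) = expR (- (t ^+ 2 * s ^+ 2 / 2)) * cos (th + t * m).
Proof.
move=> mX s0 XP.
rewrite (@Rintegral_gaussian_bounded X m s (fun x => cos (th + t * x)) 1)//.
- under eq_Rintegral do rewrite mulrDr addrA mulrA.
  by rewrite normal_cos exprMn.
- exact: continuous_affine_cos.
- by move=> x; exact: cos_max.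
Qed.

(** The integral is taken in the extended reals, so that integrability of X^2
    follows from it; c = 0 and c = 1 then give the first two moments. *)
Lemma gaussian_sqr (X : T -> R) (m s c : R) :
  measurable_fun setT X -> 0 <= s ->
  (forall B, measurable B -> P (X @^-1` B) = normal_or_dirac m s B) ->
  (\int[P]_w ((X w + c) ^+ 2)%:E = ((m + c) ^+ 2 + s ^+ 2)%:E)%E.
Proof.
move=> mX s0 XP.
rewrite (@ge0_integral_gaussian X m s (fun x => (x + c) ^+ 2))//; last 2 first.
- move=> x; apply: (@continuous_comp _ _ _ (fun x => x + c) (fun y => y ^+ 2)).
    apply: continuous_fctD; last exact: cst_continuous.
    by move=> y; exact: cvg_id.
  exact: exprn_continuous.
- by move=> x; exact: sqr_ge0.
have i1 := @integrable_normal_pow R 1; have i2 := @integrable_normal_pow R 2.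
have e r : (m + s * r + c) ^+ 2 =
    (m + c) ^+ 2 + (2 * (m + c) * s * r ^+ 1 + s ^+ 2 * r ^+ 2) by ring.
have i : N.-integrable setT (EFin \o (fun r => (m + s * r + c) ^+ 2)).
  under eq_fun do rewrite /= e.
  apply: integrableRD; first exact: integrableR_cst.
  by apply: integrableRD; exact: integrableRZ.
rewrite -[LHS]fineK; last exact: integrable_fin_num.
rewrite -[fine _]/(\int[N]_r (m + s * r + c) ^+ 2); congr EFin.
under eq_Rintegral do rewrite e.
rewrite RintegralD//; last 2 first.
- exact: integrableR_cst.
- by apply: integrableRD; exact: integrableRZ.
rewrite RintegralD; [|by []|exact: integrableRZ|exact: integrableRZ].
congr (_ + _); first exact: (Rintegral_prob_cst N).
by rewrite !RintegralZl// normal_moment2 normal_moment1 mulr0 add0r mulr1.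
Qed.
End gaussian_laws.

(** * Trigonometric and Bernstein polynomials *)

Section trigonometric_polynomials.
Context (R : realType) (q : nat).
Implicit Types (f g : 'rV[R]_q -> R) (c x : 'rV[R]_q).

Definition dot c x : R := \sum_(i < q) c 0 i * x 0 i.

Lemma dotDl c1 c2 x : dot (c1 + c2) x = dot c1 x + dot c2 x.
Proof. by rewrite -big_split; apply: eq_bigr => i _; rewrite mxE mulrDl. Qed.

Lemma dotNl c x : dot (- c) x = - dot c x.
Proof. by rewrite -sumrN; apply: eq_bigr => i _; rewrite mxE mulNr. Qed.

Lemma dot0l x : dot 0 x = 0.
Proof. by rewrite /dot big1// => i _; rewrite mxE mul0r. Qed.

Lemma dot_delta a t x : dot (t *: delta_mx 0 a) x = t * x 0 a.
Proof.
rewrite /dot (bigD1 a)//= big1 ?addr0 ?mxE ?eqxx ?mulr1// => i ia.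
by rewrite !mxE (negPf ia) andbF mulr0 mul0r.
Qed.

(** The functions whose expectation is determined by the expectations of the
    cosines [cos (th + dot c x)]; phases th make sines available, so that
    [trigpoly] is an algebra ([trigpolyM]). *)
Inductive trigpoly : ('rV[R]_q -> R) -> Prop :=
| trigpoly_cos th c : trigpoly (fun x => cos (th + dot c x))
| trigpolyD f g : trigpoly f -> trigpoly g -> trigpoly (fun x => f x + g x)
| trigpolyZ a f : trigpoly f -> trigpoly (fun x => a * f x).

Lemma trigpoly_cst a : trigpoly (fun=> a).
Proof.
rewrite (_ : (fun=> a) = fun x => a * cos (0 + dot 0 x)).
  exact: trigpolyZ (trigpoly_cos _ _).
by apply/funext => x; rewrite dot0l addr0 cos0 mulr1.
Qed.

Lemma trigpolyM f g : trigpoly f -> trigpoly g -> trigpoly (fun x => f x * g x).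
Proof.
move=> tf tg; elim: tf => {f} [th c|f1 f2 _ ih1 _ ih2|a f _ ih].
- elim: tg => {g} [th' c'|g1 g2 _ ih1 _ ih2|a g _ ih].
  + rewrite (_ : (fun x => _) = fun x =>
        2^-1 * (cos ((th + th') + dot (c + c') x) + cos ((th - th') + dot (c - c') x))).
      by apply: trigpolyZ; apply: trigpolyD; exact: trigpoly_cos.
    apply/funext => x; rewrite !dotDl dotNl.
    have -> : th + th' + (dot c x + dot c' x) = (th + dot c x) + (th' + dot c' x) by ring.
    have -> : th - th' + (dot c x - dot c' x) = (th + dot c x) - (th' + dot c' x) by ring.
    by move: (th + _) (th' + _) => u v; rewrite cosB cosD; field.
  + by under eq_fun do rewrite mulrDr; exact: trigpolyD.
  + by under eq_fun do rewrite mulrCA; exact: trigpolyZ.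
- by under eq_fun do rewrite mulrDl; exact: trigpolyD.
- by under eq_fun do rewrite -mulrA; exact: trigpolyZ.
Qed.

Lemma trigpoly_sum (I : Type) (r : seq I) (F : I -> 'rV[R]_q -> R) :
  (forall i, trigpoly (F i)) -> trigpoly (fun x => \sum_(i <- r) F i x).
Proof.
move=> tF; elim: r => [|i r ih].
  by under eq_fun do rewrite big_nil; exact: trigpoly_cst.
by under eq_fun do rewrite big_cons; exact: trigpolyD.
Qed.

Lemma trigpoly_prod (I : Type) (r : seq I) (F : I -> 'rV[R]_q -> R) :
  (forall i, trigpoly (F i)) -> trigpoly (fun x => \prod_(i <- r) F i x).
Proof.
move=> tF; elim: r => [|i r ih].
  by under eq_fun do rewrite big_nil; exact: trigpoly_cst.
by under eq_fun do rewrite big_cons; exact: trigpolyM.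
Qed.

Lemma trigpoly_sin t a : trigpoly (fun x => sin (t * x 0 a)).
Proof.
rewrite (_ : (fun x => _) = fun x => cos (- (pi / 2) + dot (t *: delta_mx 0 a) x)).
  exact: trigpoly_cos.
by apply/funext => x; rewrite dot_delta addrC cosBpihalf.
Qed.

End trigonometric_polynomials.

Section bernstein.
Context (R : realType).
Implicit Types (u c : R) (phi : nat -> R).

(** C(N, k) u^k (1 - u)^(N - k), by its recurrence: the probability that N
    Bernoulli(u) trials give k successes, conditioned on the first trial. The
    mean and variance then follow by induction on N. *)
Fixpoint bernstein (N k : nat) u : R :=
  match N, k with
  | 0, 0 => 1
  | 0, _.+1 => 0
  | N'.+1, 0 => (1 - u) * bernstein N' 0 u
  | N'.+1, k'.+1 => u * bernstein N' k' u + (1 - u) * bernstein N' k'.+1 u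
  end.

Lemma bernstein_ge0 N k u : 0 <= u <= 1 -> 0 <= bernstein N k u.
Proof.
move=> /andP[u0 u1]; elim: N k => [|N ih] [|k]//=.
  by rewrite mulr_ge0 ?subr_ge0.
by rewrite addr_ge0 ?mulr_ge0 ?subr_ge0.
Qed.

Lemma bernstein_gt N k u : (N < k)%N -> bernstein N k u = 0.
Proof.
elim: N k => [|N ih] [|k]//= Nk.
by rewrite !ih ?mulr0 ?addr0// ltnW.
Qed.

(** Conditioning on the first trial, for the average of [phi]. *)
Lemma bernstein_sumS N phi u :
  \sum_(k < N.+2) bernstein N.+1 k u * phi k =
  u * (\sum_(k < N.+1) bernstein N k u * phi k.+1) +
  (1 - u) * (\sum_(k < N.+1) bernstein N k u * phi k).
Proof.
rewrite big_ord_recl /=; under eq_bigr do rewrite mulrDl -!mulrA.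
rewrite big_split/= -!mulr_sumr addrCA; congr (_ + _).
rewrite -mulrA -mulrDr; congr (_ * _); rewrite [RHS]big_ord_recl /=; congr (_ + _).
rewrite [LHS]big_ord_recr/= bernstein_gt// mul0r addr0.
by apply: eq_bigr => i _.
Qed.

Lemma bernstein_sum1 N u : \sum_(k < N.+1) bernstein N k u = 1.
Proof.
elim: N => [|N ih]; first by rewrite big_ord1.
have := bernstein_sumS N (fun=> 1) u.
under eq_bigr do rewrite mulr1; move=> ->.
by under eq_bigr do rewrite mulr1; rewrite ih; ring.
Qed.

Lemma bernstein_variance N u c :
  \sum_(k < N.+1) bernstein N k u * (k%:R - c) ^+ 2 =
  N%:R * u * (1 - u) + (N%:R * u - c) ^+ 2.
Proof.
elim: N c => [|N ih] c; first by rewrite big_ord1 /=; ring.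
rewrite (bernstein_sumS N (fun k => (k%:R - c) ^+ 2)) ih.
have e k : k.+1%:R - c = k%:R - (c - 1) by rewrite -natr1; ring.
under eq_bigr do rewrite e.
by rewrite ih -natr1; ring.
Qed.

Lemma trigpoly_bernstein q N k t (a : 'I_q) :
  trigpoly (fun x : 'rV[R]_q => bernstein N k ((1 + sin (t * x 0 a)) / 2)).
Proof.
have tu : trigpoly (fun x : 'rV[R]_q => (1 + sin (t * x 0 a)) / 2).
  apply: trigpolyM (trigpoly_cst _ _).
  by apply: trigpolyD (trigpoly_cst _ _) (trigpoly_sin _ _).
have t1u : trigpoly (fun x : 'rV[R]_q => 1 - (1 + sin (t * x 0 a)) / 2).
  apply: trigpolyD (trigpoly_cst _ _) _.
  by under eq_fun do rewrite -mulN1r; exact: trigpolyZ.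
elim: N k => [|N ih] [|k] /=.
- exact: trigpoly_cst.
- exact: trigpoly_cst.
- exact: trigpolyM.
- by apply: trigpolyD; exact: trigpolyM.
Qed.

End bernstein.

(** * Approximation by trigonometric polynomials *)

Section trig_approximation.
Context (R : realType) (q : nat).
Implicit Types (F : 'rV[R]_q -> R) (x y : 'rV[R]_q).

Definition cube (B : R) : set 'rV[R]_q := [set x | forall a, `|x 0 a| <= B].

Lemma compact_cube B : compact (cube B).
Proof.
rewrite (_ : cube B = [set v | forall i, `[- B, B]%classic (v ord0 i)]).
  exact: (@rV_compact R q (fun=> `[- B, B]%classic) (fun=> @segment_compact _ _ _)).
by apply/seteqP; split => x /= h a; have := h a; rewrite in_itv/= ler_norml.
Qed.

Lemma cube_uniform_continuous F (B e : R) : continuous F -> 0 < e ->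
  exists2 h : R, 0 < h & forall x y, cube B x -> (forall a, `|x 0 a - y 0 a| < h) ->
    `|F x - F y| < e.
Proof.
move=> cF e0.
have /compact_near_coveringP/(_ R (0^'+) (fun h x => forall y,
    (forall a, `|x 0 a - y 0 a| < h) -> `|F x - F y| < e)) := @compact_cube B.
move=> /(_ _) covB.
have /filter_ex[h [h0 hP]] : \forall h \near (0 : R)^'+, 0 < h /\
    forall x, cube B x -> forall y, (forall a, `|x 0 a - y 0 a| < h) -> `|F x - F y| < e.
  apply: filterI; first exact: nbhs_right_gt.
  apply: covB => x0 _.
  have /cvgrPdist_lt/(_ (e / 2)) := cF x0.
  rewrite divr_gt0// => /(_ isT)/nbhs_ballP[r /= r0 rF].
  exists (ball x0 (r / 2), [set h | 0 < h /\ h < r / 2]) => /=.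
    split; first by apply: nbhsx_ballx; rewrite divr_gt0.
    apply: filterI; first exact: nbhs_right_gt.
    by apply: nbhs_right_lt; rewrite divr_gt0.
  move=> [x h] /= [x0x [h0 hr]] y xy.
  have bx : `|F x0 - F x| < e / 2.
    by apply: rF; apply: le_ball x0x; lra.
  have by_ : `|F x0 - F y| < e / 2.
    apply: rF; rewrite (splitr r); apply: (ball_triangle x0x).
    split; first by rewrite divr_gt0.
    by move=> i a; rewrite ord1 /ball/=; exact: lt_trans (xy a) hr.
  rewrite (splitr e) (le_lt_trans (ler_distD (F x0) _ _))//.
  by rewrite [X in X + _]distrC ltrD.
by exists h => // x y Bx; exact: hP.
Qed.

(** On [-pi/2, pi/2] the sine has a modulus of injectivity: half-sum and
    half-difference formulas, with cos m >= sin k since |m| + k <= pi/2. *)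
Lemma sin_separated (a b h : R) : 0 < h -> h <= `|a - b| ->
  `|a| <= pi / 2 -> `|b| <= pi / 2 -> 2 * sin (h / 2) ^+ 2 <= `|sin a - sin b|.
Proof.
wlog ab : a b / b <= a.
  move=> W h0; have [ba|/ltW ba] := leP b a; first exact: W.
  by rewrite distrC [in X in _ -> _ -> _ -> X]distrC => *; apply: W.
move=> h0; rewrite ger0_norm ?subr_ge0// => hab; rewrite !ler_norml.
move=> /andP[a1 a2] /andP[b1 b2].
pose m := (a + b) / 2; pose k := (a - b) / 2.
have pi0 : 0 < pi :> R by exact: pi_gt0.
have -> : sin a - sin b = 2 * (sin k * cos m).
  have -> : a = m + k by rewrite /m /k; field.
  have {1}-> : b = m - k by rewrite /m /k; field.
  by rewrite sinD sinB; ring.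
have k0 : h / 2 <= k by rewrite /k ler_pM2r// invr_gt0.
have k1 : k <= pi / 2 by rewrite /k; lra.
have s0 : 0 < sin (h / 2).
  by apply: sin_gt0_pi; apply/andP; split; lra.
have sk : sin (h / 2) <= sin k.
  rewrite le_eqVlt; move: k0; rewrite le_eqVlt => /predU1P[->|k0].
    by rewrite eqxx.
  by apply/orP; right; rewrite ltr_sin// in_itv/=; apply/andP; split; lra.
have ck : sin k <= cos m.
  have -> : sin k = cos (pi / 2 - k) by rewrite -cosN opprB cosBpihalf.
  have mk : `|m| <= pi / 2 - k by rewrite ler_norml /m /k; apply/andP; split; lra.
  rewrite -(cos_norm m); move: mk; rewrite le_eqVlt => /predU1P[->//|mk].
  apply: ltW; rewrite ltr_cos// in_itv/=; apply/andP; split=> //; try lra.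
rewrite ger0_norm; last by rewrite !mulr_ge0// (le_trans (ltW s0))// (le_trans sk).
by rewrite ler_wpM2l// expr2 ler_pM ?(ltW s0)// (le_trans sk).
Qed.

Variables (t : R) (N : nat).
Hypothesis t0 : 0 < t.

(* [u] folds the line onto [0, 1], injectively on the cube of half-side
   pi / (2 t); [node j] is the point of that cube where [u] is j / N. *)
Let u x (a : 'I_q) : R := (1 + sin (t * x 0 a)) / 2.

Let node (j : {ffun 'I_q -> 'I_N.+1}) : 'rV[R]_q :=
  \row_a (asin (2 * ((j a)%:R / N%:R) - 1) / t).

Let weight (j : {ffun 'I_q -> 'I_N.+1}) x : R :=
  \prod_a bernstein N (j a) (u x a).

Let u01 x a : 0 <= u x a <= 1.
Proof.
have := sin_geN1 (t * x 0 a); have := sin_le1 (t * x 0 a).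
by rewrite /u => *; apply/andP; split; lra.
Qed.

Let weight_ge0 j x : 0 <= weight j x.
Proof. by apply: prodr_ge0 => a _; exact: bernstein_ge0. Qed.

Let weight_sum1 x : \sum_j weight j x = 1.
Proof.
rewrite -(bigA_distr_bigA (fun a (k : 'I_N.+1) => bernstein N k (u x a))).
by rewrite big1// => a _; exact: bernstein_sum1.
Qed.

Hypothesis N0 : (0 < N)%N.

Let node_coord (j : {ffun 'I_q -> 'I_N.+1}) a :
  -1 <= (2 * ((j a)%:R / N%:R) - 1 : R) <= 1.
Proof.
have jN : 0 <= ((j a)%:R / N%:R : R) <= 1.
  rewrite divr_ge0//= ler_pdivrMr ?ltr0n// mul1r ler_nat.
  by rewrite -ltnS ltn_ord.
by move/andP: jN => [? ?]; apply/andP; split; lra.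
Qed.

Let u_node j a : u (node j) a = (j a)%:R / N%:R.
Proof.
rewrite /u mxE [t * _]mulrC divfK ?gt_eqF// asinK ?in_itv//=.
by rewrite addrC subrK mulrC mulKf.
Qed.

Let node_cube j : cube (pi / 2 / t) (node j).
Proof.
move=> a; rewrite mxE normrM [`|t^-1|]gtr0_norm ?invr_gt0// ler_pM2r ?invr_gt0//.
by rewrite ler_norml asin_geNpi2 ?asin_lepi2.
Qed.

Let weight_variance x a :
  \sum_j weight j x * (u x a - u (node j) a) ^+ 2 <= N%:R^-1.
Proof.
have Np : 0 < N%:R :> R by rewrite ltr0n.
pose G c (k : 'I_N.+1) : R := bernstein N k (u x c) *
  (if c == a then (k%:R / N%:R - u x c) ^+ 2 else 1).
have -> : \sum_j weight j x * (u x a - u (node j) a) ^+ 2 =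
    \sum_(j : {ffun 'I_q -> 'I_N.+1}) \prod_c G c (j c).
  apply: eq_bigr => j _; rewrite big_split/=; congr (_ * _).
  rewrite (bigD1 a)//= eqxx big1 ?mulr1; last by move=> c /negPf ->.
  by rewrite u_node -sqrrN opprB.
rewrite -bigA_distr_bigA (bigD1 a)//= [X in _ * X]big1 ?mulr1; last first.
  move=> c /negPf ca; rewrite -(bernstein_sum1 N (u x c)).
  by apply: eq_bigr => k _; rewrite /G ca mulr1.
rewrite /G; under eq_bigr do rewrite eqxx.
have -> : \sum_(k < N.+1) bernstein N k (u x a) * (k%:R / N%:R - u x a) ^+ 2 =
    (\sum_(k < N.+1) bernstein N k (u x a) * (k%:R - N%:R * u x a) ^+ 2) / N%:R ^+ 2.
  rewrite mulr_suml; apply: eq_bigr => k _; rewrite -mulrA; congr (_ * _).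
  by field; rewrite gt_eqF.
rewrite bernstein_variance subrr expr0n/= addr0.
have /andP[u0 u1] := u01 x a.
have uu : u x a * (1 - u x a) <= 1 by rewrite mulr_ile1 ?subr_ge0// gerBl.
rewrite ler_pdivrMr ?exprn_gt0// expr2 mulKf ?gt_eqF//.
by rewrite -mulrA ler_piMr// ltW.
Qed.

(** The approximant is the tensor Bernstein polynomial of F in the variables
    u x a. Its value at x is the average of F over random nodes whose
    coordinates u have mean u x a and variance at most 1/N. Being an average,
    it is bounded by M everywhere, also off the cube, which a compactness
    argument of Stone-Weierstrass type would not give. *)
Lemma trigpoly_tensor_bernstein F (M e K : R) :
  (forall x, `|F x| <= M) ->
  (forall x y, cube (pi / 2 / t) x -> cube (pi / 2 / t) y ->
     `|F x - F y| <= e + K * \sum_a (u x a - u y a) ^+ 2) -> 0 <= K ->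
  exists g, [/\ trigpoly g, forall x, `|g x| <= M &
     forall x, cube (pi / 2 / t) x -> `|F x - g x| <= e + K * q%:R / N%:R].
Proof.
move=> FM Fe K0; exists (fun x => \sum_j F (node j) * weight j x); split.
- apply: trigpoly_sum => j; apply: trigpolyZ; apply: trigpoly_prod => a.
  exact: trigpoly_bernstein.
- move=> x; rewrite (le_trans (ler_norm_sum _ _ _))//.
  apply: (@le_trans _ _ (\sum_j M * weight j x)); last first.
    by rewrite -mulr_sumr weight_sum1 mulr1.
  apply: ler_sum => j _.
  by rewrite normrM [`|weight _ _|]ger0_norm// ler_wpM2r.
move=> x Bx.
have -> : F x - \sum_j F (node j) * weight j x =
    \sum_j (F x - F (node j)) * weight j x.
  under [RHS]eq_bigr do rewrite mulrBl.
  by rewrite sumrB -mulr_sumr weight_sum1 mulr1.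
rewrite (le_trans (ler_norm_sum _ _ _))//.
apply: (@le_trans _ _ (\sum_j (e * weight j x +
    K * \sum_a weight j x * (u x a - u (node j) a) ^+ 2))).
  apply: ler_sum => j _; rewrite normrM [`|weight _ _|]ger0_norm//.
  rewrite -mulr_sumr [K * (_ * _)]mulrCA [e * _]mulrC -mulrDr.
  by rewrite [leLHS]mulrC ler_wpM2l// Fe.
rewrite big_split/= -mulr_sumr weight_sum1 mulr1 lerD2l -mulr_sumr -mulrA.
rewrite ler_wpM2l// exchange_big/=.
apply: le_trans (ler_sum _ (fun a _ => weight_variance x a)) _.
by rewrite sumr_const card_ord mulr_natl.
Qed.

End trig_approximation.

(** Uniform continuity on the cube, transported to the coordinates u by
    [sin_separated], gives |F x - F y| <= e / 2 when the coordinates u of x and y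
    are within del; otherwise 2 M is at most K times the squared distance. *)
Lemma trigpoly_approx (R : realType) (q : nat) (F : 'rV[R]_q -> R) (M B e : R) :
  continuous F -> (forall x, `|F x| <= M) -> 0 < B -> 0 < e ->
  exists g, [/\ trigpoly g, forall x, `|g x| <= M &
     forall x, cube B x -> `|F x - g x| <= e].
Proof.
move=> cF FM B0 e0; have e20 : 0 < e / 2 by rewrite divr_gt0.
have pi0 : 0 < pi :> R by exact: pi_gt0.
have M0 : 0 <= M by apply: le_trans (FM 0); exact: normr_ge0.
have [h0 h00 hF] := @cube_uniform_continuous _ _ F B _ cF e20.
pose h := Num.min h0 B; pose t := pi / 2 / B.
have t0 : 0 < t by rewrite !divr_gt0.
have tB : pi / 2 / t = B by rewrite /t invf_div mulrA mulrC mulrA mulVf ?mul1r ?gt_eqF ?divr_gt0.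
have hp : 0 < h by rewrite lt_min h00.
have tBE : t * B = pi / 2 by rewrite /t divfK ?gt_eqF.
have th : t * h <= pi / 2 by rewrite -tBE ler_pM2l// ge_min lexx orbT.
have thp : 0 < t * h by rewrite mulr_gt0.
pose del := sin (t * h / 2) ^+ 2.
have del0 : 0 < del.
  by rewrite exprn_gt0// sin_gt0_pi//; apply/andP; split; lra.
pose u (x : 'rV[R]_q) a : R := (1 + sin (t * x 0 a)) / 2.
have key x y : cube B x -> cube B y -> (forall a, `|u x a - u y a| < del) ->
    `|F x - F y| <= e / 2.
  move=> Bx By uxy; apply: ltW; apply: hF => // a; rewrite ltNge; apply/negP => ha.
  have := uxy a; apply/negP; rewrite -leNgt /u -mulrBl opprD addrACA subrr add0r.
  rewrite normrM [`|2^-1|]ger0_norm ?invr_ge0// ler_pdivlMr// mulrC.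
  apply: sin_separated => //.
  - by rewrite -mulrBr normrM gtr0_norm// ler_pM2l// (le_trans _ ha)// ge_min lexx.
  - by rewrite normrM gtr0_norm// -tBE ler_pM2l.
  - by rewrite normrM gtr0_norm// -tBE ler_pM2l.
pose K := 2 * M / del ^+ 2.
have K0 : 0 <= K by apply: divr_ge0; [exact: mulr_ge0|exact: sqr_ge0].
have Fe x y : cube (pi / 2 / t) x -> cube (pi / 2 / t) y ->
    `|F x - F y| <= e / 2 + K * \sum_a (u x a - u y a) ^+ 2.
  rewrite tB => Bx By; have S0 : 0 <= \sum_a (u x a - u y a) ^+ 2.
    by apply: sumr_ge0 => a _; exact: sqr_ge0.
  have [/forallP uxy|/forallPn[a]] := boolP [forall a, `|u x a - u y a| < del].
    by rewrite (le_trans (key _ _ Bx By uxy))// lerDl mulr_ge0.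
  rewrite -leNgt => ua; apply: (@le_trans _ _ (2 * M)).
    by rewrite (le_trans (ler_normB _ _))// mulr_natl mulr2n lerD.
  apply: (@le_trans _ _ (K * del ^+ 2)).
    by rewrite divfK// gt_eqF// exprn_gt0.
  apply: (@le_trans _ _ (K * \sum_a (u x a - u y a) ^+ 2)); last by rewrite lerDr ltW.
  rewrite ler_wpM2l// (bigD1 a)//= -[leLHS]addr0 lerD//; last first.
    by apply: sumr_ge0 => c _; exact: sqr_ge0.
  by rewrite -[leRHS]real_normK ?num_real// ler_pXn2r ?nnegrE// ltW.
have KQ : 0 <= K * q%:R / (e / 2).
  by apply: divr_ge0 (ltW e20); apply: mulr_ge0.
have [N NK] : exists N, K * q%:R / (e / 2) < N%:R.
  by exists (Num.bound (K * q%:R / (e / 2))); exact: archi_boundP.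
have N0 : (0 < N)%N by rewrite -(ltr_nat R) (le_lt_trans _ NK).
have [g [tg gM gF]] := trigpoly_tensor_bernstein t0 N0 FM Fe K0.
exists g; split=> // x Bx; rewrite (le_trans (gF x _)) ?tB//.
have Np : 0 < N%:R :> R by rewrite ltr0n.
by rewrite [leRHS]splitr lerD2l ler_pdivrMr// [leRHS]mulrC -ler_pdivrMr// ltW.
Qed.

(** * Weak convergence tested on cosines *)

Section weak_convergence.
Context (R : realType) (q : nat).
Local Notation pr := (probability (borel_rV R q) R).
Implicit Types (F : 'rV[R]_q -> R) (mu nu : pr).

Lemma measurable_borel_rV F : continuous F ->
  measurable_fun setT (F : borel_rV R q -> R).
Proof.
move=> cF; apply: (measurability _ (RGenOInfty.measurableE R)).
move=> /= _ [_ [a ->]] <-; rewrite setTI.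
apply: sub_sigma_algebra; apply: open_comp; last exact: interval_open.
by move=> x _; exact: cF.
Qed.

Lemma continuous_coord a : continuous (fun x : 'rV[R]_q => x 0 a).
Proof. by move=> x; exact: coord_continuous. Qed.

Lemma continuous_fct_sum (I : Type) (r : seq I) (G : I -> 'rV[R]_q -> R) :
  (forall i, continuous (G i)) -> continuous (fun x => \sum_(i <- r) G i x).
Proof.
move=> cG; elim: r => [|i r ih].
  by under eq_fun do rewrite big_nil; exact: cst_continuous.
under eq_fun do rewrite big_cons.
by move=> x; apply: (@continuousD R R^o); [exact: cG|exact: ih].
Qed.

Lemma continuous_dot (c : 'rV[R]_q) : continuous (dot c).
Proof.
apply: continuous_fct_sum => i x; apply: (@continuousM R).
  exact: cst_continuous.
exact: continuous_coord.
Qed.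

Lemma continuous_trigpoly F : trigpoly F -> continuous F.
Proof.
elim=> {F} [th c|f g _ cf _ cg|a f _ cf] x.
- apply: (@continuous_comp _ _ _ (fun x => th + dot c x) cos); last exact: continuous_cos.
  by apply: (@continuousD R R^o); [exact: cst_continuous|exact: continuous_dot].
- by apply: (@continuousD R R^o); [exact: cf|exact: cg].
- by apply: (@continuousM R); [exact: cst_continuous|exact: cf].
Qed.

Lemma bounded_trigpoly F : trigpoly F -> exists C : R, forall x, `|F x| <= C.
Proof.
elim=> {F} [th c|f g _ [C fC] _ [D gD]|a f _ [C fC]].
- by exists 1 => x; exact: cos_max.
- by exists (C + D) => x; rewrite (le_trans (ler_normD _ _))// lerD.
- by exists (`|a| * C) => x; rewrite normrM ler_wpM2l.
Qed.

Lemma integrable_bounded_continuous mu F : bounded_continuous F ->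
  mu.-integrable setT (EFin \o F).
Proof.
move=> [cF [C FC]]; apply: (@integrableR_bounded _ (borel_rV R q) _ mu F C) => //.
exact: measurable_borel_rV.
Qed.

Lemma trigpoly_bounded_continuous F : trigpoly F -> bounded_continuous F.
Proof.
by move=> tF; split; [exact: continuous_trigpoly|exact: bounded_trigpoly].
Qed.

Lemma measurable_cube B : measurable (cube B : set (borel_rV R q)).
Proof.
rewrite (_ : cube B = \bigcap_(a in [set: 'I_q])
    ((fun x : borel_rV R q => (x : 'rV[R]_q) 0 a) @^-1` `[- B, B]%classic)).
  apply: fin_bigcap_measurable => // a _; rewrite -[X in measurable X]setTI.
  exact: (measurable_borel_rV (@continuous_coord a)).
apply/seteqP; split => x /= h a.
  by move=> _ /=; rewrite in_itv/= -ler_norml; exact: h.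
by have := h a I; rewrite /= in_itv/= -ler_norml.
Qed.

Lemma cube_tight mu e : 0 < e ->
  exists2 B, 0 < B & fine (mu (~` cube B)) <= e.
Proof.
move=> e0; pose A (n : nat) : set (borel_rV R q) := ~` cube n.+1%:R.
have mA n : measurable (A n) by apply: measurableC; exact: measurable_cube.
have A0 : \bigcap_n A n = set0.
  apply/seteqP; split=> // x Ax.
  pose b := \sum_a `|x 0 a|; have b0 : 0 <= b by exact: sumr_ge0.
  have := Ax (Num.bound b) I; apply => a.
  rewrite (@le_trans _ _ b)//.
    by rewrite /b (bigD1 a)//= lerDl sumr_ge0.
  by rewrite ltW// (lt_le_trans (archi_boundP b0))// ler_nat.
have : (mu (A n) @[n --> \oo] --> mu (\bigcap_n A n))%E.
  apply: nonincreasing_cvg_mu => //.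
  - by rewrite (le_lt_trans (probability_le1 _ _))// ltry.
  - by rewrite A0.
  - move=> n m nm; apply/subsetPset; apply: subsetC => x h a.
    by rewrite (le_trans (h a))// ler_nat ltnS.
rewrite A0 measure0 => /fine_cvg/cvgrPdist_le/(_ e e0)[n _ hn].
exists n.+1%:R => //; have := hn n (leqnn n).
by rewrite sub0r normrN ger0_norm// fine_ge0.
Qed.

(** Off the cube the trigonometric approximation is no better than the bound
    2 M, which costs the mass of the complement. The same g serves all mu. *)
Lemma trigpoly_approx_integral F M e : continuous F -> (forall x, `|F x| <= M) ->
  0 < e -> forall B, 0 < B ->
  exists2 g, trigpoly g & forall mu,
   `|\int[mu]_x F x - \int[mu]_x g x| <= e + 2 * M * fine (mu (~` cube B)).
Proof.
move=> cF FM e0 B B0; have [g [tg gM Fg]] := trigpoly_approx cF FM B0 e0.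
exists g => // mu.
have iF : mu.-integrable setT (EFin \o F).
  by apply: integrable_bounded_continuous; split=> //; exists M.
have ig := integrable_bounded_continuous mu (trigpoly_bounded_continuous tg).
have mC : measurable (~` cube B : set (borel_rV R q)).
  by apply: measurableC; exact: measurable_cube.
have i1 : mu.-integrable setT (EFin \o (\1_(~` cube B) : borel_rV R q -> R)).
  exact: integrable_indic.
rewrite -RintegralB//.
have -> : e + 2 * M * fine (mu (~` cube B)) =
    \int[mu]_x (e + 2 * M * \1_(~` cube B) x).
  rewrite RintegralD//; last 2 first.
  - exact: integrableR_cst.
  - exact: integrableRZ.
  rewrite (Rintegral_prob_cst mu) RintegralZl//; congr (_ + _ * _).
  by rewrite /Rintegral integral_indic// setIT.
apply: le_Rintegral_norm.
- exact: measurable_intR (integrableRB iF ig).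
- by apply: integrableRD; [exact: integrableR_cst|exact: integrableRZ].
move=> x; rewrite indicE; have [Bx|nBx] := pselect (cube B x).
  by rewrite memNset ?mulr0 ?addr0 ?Fg//; exact/not_notP.
rewrite mem_set// mulr1 (@le_trans _ _ (2 * M))//; last by rewrite lerDr ltW.
by rewrite (le_trans (ler_normB _ _))// mulr_natl mulr2n lerD.
Qed.

(** Levy's continuity theorem for tight families, along any filter: F is
    replaced by a trigonometric polynomial, up to an error that tightness makes
    small uniformly in i. *)
Theorem weak_cvg_of_cos (I : Type) (Phi : set_system I) (mu : I -> pr) nu :
  Filter Phi ->
  (forall th c, \int[mu i]_x cos (th + dot c x) @[i --> Phi] -->
                \int[nu]_x cos (th + dot c x)) ->
  (forall e, 0 < e -> exists B, \forall i \near Phi, fine (mu i (~` cube B)) <= e) ->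
  forall F, bounded_continuous F ->
    \int[mu i]_x F x @[i --> Phi] --> \int[nu]_x F x.
Proof.
move=> FPhi hcos tight F [cF [M0 FM0]].
have tcvg g : trigpoly g -> \int[mu i]_x g x @[i --> Phi] --> \int[nu]_x g x.
  elim=> {g} [th c|f g tf cf tg cg|a f tf cf]; first exact: hcos.
  - have if_ m := integrable_bounded_continuous m (trigpoly_bounded_continuous tf).
    have ig m := integrable_bounded_continuous m (trigpoly_bounded_continuous tg).
    have eD (m : pr) : \int[m]_x (f x + g x) = \int[m]_x f x + \int[m]_x g x.
      exact: (RintegralD measurableT (if_ m) (ig m)).
    rewrite eD; under eq_fun do rewrite eD.
    exact: (@cvgD _ R^o).
  - have if_ m := integrable_bounded_continuous m (trigpoly_bounded_continuous tf).
    have eZ (m : pr) : \int[m]_x (a * f x) = a * \int[m]_x f x.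
      exact: (RintegralZl _ measurableT (if_ m)).
    rewrite eZ; under eq_fun do rewrite eZ.
    by apply: cvgM => //; exact: cvg_cst.
pose M := 1 + `|M0|.
have Mp : 0 < M by rewrite ltr_pwDl.
have FM x : `|F x| <= M.
  by rewrite (le_trans (FM0 x))// (le_trans (ler_norm _))// lerDr.
apply/cvgrPdist_le => e e0.
have e8 : 0 < e / 8 by rewrite divr_gt0.
have eM : 0 < e / (8 * M) by rewrite divr_gt0// mulr_gt0.
have [B1 tB1] := tight _ eM; have [B2 B20 tB2] := cube_tight nu eM.
pose B := Num.max B1 B2.
have B0 : 0 < B by rewrite lt_max B20 orbT.
have tB (m : pr) B' : B' <= B -> fine (m (~` cube B')) <= e / (8 * M) ->
    2 * M * fine (m (~` cube B)) <= e / 4.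
  move=> BB h; have -> : e / 4 = 2 * M * (e / (8 * M)) by field; rewrite gt_eqF.
  rewrite ler_wpM2l ?mulr_ge0 ?(ltW Mp)// (le_trans _ h)//.
  rewrite fine_le ?fin_num_measure//; try by apply: measurableC; exact: measurable_cube.
  apply: le_measure; rewrite ?inE; try by apply: measurableC; exact: measurable_cube.
  by apply: subsetC => x h' a; rewrite (le_trans (h' a)).
have [g tg hg] := trigpoly_approx_integral cF FM e8 B0.
have /cvgrPdist_le/(_ _ e8) gcvg := tcvg _ tg.
apply: filterS2 gcvg tB1 => i gi ti.
have h1 := le_trans (hg nu) (lerD (lexx _) (tB nu B2 _ tB2)).
have h2 := le_trans (hg (mu i)) (lerD (lexx _) (tB (mu i) B1 _ ti)).
have := h1; rewrite /B le_max lexx orbT => /(_ isT) {}h1.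
have := h2; rewrite /B le_max lexx => /(_ isT) {}h2.
move: h1 h2 gi; rewrite !ler_norml; clear -e0 => /andP[? ?] /andP[? ?] /andP[? ?].
by apply/andP; split; lra.
Qed.

Corollary eq_integral_of_cos mu nu :
  (forall th c, \int[mu]_x cos (th + dot c x) = \int[nu]_x cos (th + dot c x)) ->
  forall F, bounded_continuous F -> \int[mu]_x F x = \int[nu]_x F x.
Proof.
move=> h F bF.
have := @weak_cvg_of_cos nat \oo (fun=> mu) nu _ _ _ F bF.
move=> /(_ _ _) H; apply: (@cvg_unique _ (@norm_hausdorff _ R^o) _ _ _ _ (cvg_cst _) (H _ _)).
- by move=> th c; rewrite h; exact: cvg_cst.
- by move=> e e0; have [B _ hB] := cube_tight mu e0; exists B; exact: nearW.
Qed.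

End weak_convergence.

(** * Laws determined by cosines *)

Section laws.
Context (R : realType).

Definition law d (T : measurableType d) (P : probability T R) (q : nat)
    (X : T -> 'rV[R]_q)
    (mX : measurable_fun setT (X : T -> borel_rV R q)) :
    probability (borel_rV R q) R :=
  distribution P (mfun_Sub (mem_set mX) : {mfun T >-> borel_rV R q}).

Lemma Rintegral_distribution d (T : measurableType d) (P : probability T R) q
    (X : {mfun T >-> borel_rV R q}) (F : 'rV[R]_q -> R) :
  bounded_continuous F ->
  \int[distribution P X]_x F x = \int[P]_w F (X w).
Proof.
move=> [cF [C FC]]; have mF := measurable_borel_rV cF.
rewrite /Rintegral integral_distribution//; first exact/measurable_EFinP.
apply: (@integrableR_bounded _ _ _ P (F \o X) C) => [|w]; last exact: FC.
exact: measurableT_comp.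
Qed.

Lemma cos_dot_bounded_continuous q th (c : 'rV[R]_q) :
  bounded_continuous (fun x => cos (th + dot c x)).
Proof. exact: trigpoly_bounded_continuous (trigpoly_cos _ _). Qed.

Lemma eq_expectation_of_cos d1 (T1 : measurableType d1) (P1 : probability T1 R)
    d2 (T2 : measurableType d2) (P2 : probability T2 R) q
    (X1 : T1 -> 'rV[R]_q) (X2 : T2 -> 'rV[R]_q) :
  (forall i, measurable_fun setT (fun w => X1 w 0 i)) ->
  (forall i, measurable_fun setT (fun w => X2 w 0 i)) ->
  (forall th c, \int[P1]_w cos (th + dot c (X1 w)) =
                \int[P2]_w cos (th + dot c (X2 w))) ->
  forall F, bounded_continuous F -> \int[P1]_w F (X1 w) = \int[P2]_w F (X2 w).
Proof.
move=> mX1 mX2 h F bF.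
have m1 := measurable_fun_rV mX1; have m2 := measurable_fun_rV mX2.
have h1 G : bounded_continuous G -> \int[law P1 m1]_x G x = \int[P1]_w G (X1 w).
  by move=> bG; rewrite Rintegral_distribution.
have h2 G : bounded_continuous G -> \int[law P2 m2]_x G x = \int[P2]_w G (X2 w).
  by move=> bG; rewrite Rintegral_distribution.
rewrite -h1// -h2//; apply: eq_integral_of_cos => // th c.
have bc := @cos_dot_bounded_continuous _ th c.
by rewrite (h1 _ bc) (h2 _ bc).
Qed.

Definition clamp01 (z : R) : R := (1 + `|z| - `|z - 1|) / 2.

Lemma clamp01_le0 z : z <= 0 -> clamp01 z = 0.
Proof.
by move=> z0; rewrite /clamp01 !ler0_norm ?subr_le0 ?(le_trans z0)//; field.
Qed.

Lemma clamp01_ge1 z : 1 <= z -> clamp01 z = 1.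
Proof.
by move=> z1; rewrite /clamp01 !ger0_norm ?subr_ge0 ?(le_trans _ z1)//; field.
Qed.

Lemma clamp01_itv z : 0 <= clamp01 z <= 1.
Proof.
rewrite /clamp01; case: (ger0P z); case: (ger0P (z - 1)) => ? ?;
  by apply/andP; split; lra.
Qed.

Lemma continuous_clamp01 a k : continuous (fun x : R => clamp01 (k * (a - x))).
Proof.
have cz : continuous (fun x : R => k * (a - x)).
  apply: continuous_fctM; first exact: cst_continuous.
  by apply: continuous_fctB; [exact: cst_continuous|move=> x; exact: cvg_id].
have cn (g : R -> R) : continuous g -> continuous (fun x => `|g x|).
  by move=> cg x; apply: continuous_comp; [exact: cg|exact: norm_continuous].
apply: continuous_fctM; last exact: cst_continuous.
apply: continuous_fctB; last first.
  by apply: cn; apply: continuous_fctB; [exact: cz|exact: cst_continuous].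
by apply: continuous_fctD; [exact: cst_continuous|exact: cn].
Qed.

Section real_laws.
Context d1 (T1 : measurableType d1) (P1 : probability T1 R).
Context d2 (T2 : measurableType d2) (P2 : probability T2 R).
Variables (X : T1 -> R) (Y : T2 -> R).
Hypotheses (mX : measurable_fun setT X) (mY : measurable_fun setT Y).
Hypothesis XY : forall G : R -> R, continuous G -> (forall x, 0 <= G x <= 1) ->
  \int[P1]_w G (X w) = \int[P2]_w G (Y w).

(** The indicator of the open ray is the increasing limit of the indicators of
    the closed rays ending at a - 1/(n+1), and a continuous function
    fits between each of these and it. Exchanging X and Y gives equality. *)
Lemma ray_le (a : R) : (P1 (X @^-1` `]-oo, a[) <= P2 (Y @^-1` `]-oo, a[))%E.
Proof.
have mXA (A : set R) : measurable A -> measurable (X @^-1` A).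
  by move=> mA; rewrite -[X in measurable X]setTI; exact: mX.
have mYA (A : set R) : measurable A -> measurable (Y @^-1` A).
  by move=> mA; rewrite -[X in measurable X]setTI; exact: mY.
pose A (n : nat) := X @^-1` `]-oo, (a - n.+1%:R^-1)%R].
have mA n : measurable (A n) by exact: mXA.
have UA : \bigcup_n A n = X @^-1` `]-oo, a[.
  apply/seteqP; split => w /=.
    move=> [n _]; rewrite /A/= !in_itv/= => /le_lt_trans; apply.
    by rewrite ltrBlDr ltrDl invr_gt0.
  rewrite in_itv/= => Xa.
  have /ltr_add_invr[k] : X w < a by [].
  move=> Xk; exists k => //; rewrite /A/= in_itv/= lerBrDr.
  exact: ltW.
have : (P1 (A n) @[n --> \oo] --> P1 (\bigcup_n A n))%E.
  apply: nondecreasing_cvg_mu => //.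
    by rewrite UA; apply: mXA.
  move=> n m nm; apply/subsetPset => w; rewrite /A/= !in_itv/= => /le_trans; apply.
  by rewrite lerB// lef_pV2 ?posrE ?ltr0n// ler_nat.
rewrite UA => cvgA; apply: (cvge_le _ cvgA); apply: nearW => n.
have n0 : 0 < n.+1%:R :> R by rewrite ltr0n.
pose G (x : R) := clamp01 (n.+1%:R * (a - x)).
have cG : continuous G by exact: continuous_clamp01.
have G01 x : 0 <= G x <= 1 by exact: clamp01_itv.
have iG d (T : measurableType d) (P : probability T R) (Z : T -> R) :
    measurable_fun setT Z -> P.-integrable setT (EFin \o (fun w => G (Z w))).
  move=> mZ; apply: (@integrableR_bounded _ _ _ P _ 1) => [|w].
    by apply: measurableT_comp mZ; exact: continuous_measurable_fun.
  by have /andP[? ?] := G01 (Z w); rewrite ger0_norm.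
have mYa : measurable (Y @^-1` `]-oo, a[) by exact: mYA.
rewrite -(fineK (fin_num_measure P1 _ (mA n))) -(fineK (fin_num_measure P2 _ mYa)).
rewrite lee_fin (@le_trans _ _ (\int[P1]_w G (X w)))//.
  have -> : fine (P1 (A n)) = \int[P1]_w (\1_(A n) w : R).
    by rewrite /Rintegral integral_indic// setIT.
  apply: le_Rintegral => //; [exact: integrable_indic|exact: iG|].
  move=> w _; rewrite indicE; have [wA|wA] := boolP (w \in A n); last first.
    by have /andP[] := G01 (X w).
  rewrite /G clamp01_ge1//; move: wA; rewrite inE /A/= in_itv/= => Xw.
  by rewrite mulrC -ler_pdivrMr// mul1r lerBrDr addrC -lerBrDr.
rewrite XY//.
have -> : fine (P2 (Y @^-1` `]-oo, a[)) = \int[P2]_w (\1_(Y @^-1` `]-oo, a[) w : R).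
  by rewrite /Rintegral integral_indic// setIT.
apply: le_Rintegral => //; [exact: iG|exact: integrable_indic|].
move=> w _; rewrite indicE; have [wA|wA] := boolP (w \in _).
  by have /andP[] := G01 (Y w).
rewrite /G clamp01_le0//; move: wA; rewrite notin_setE/= in_itv/= => /negP.
by rewrite -leNgt => aY; rewrite pmulr_rle0// subr_le0.
Qed.

End real_laws.

Lemma eq_law_of_expectation d1 (T1 : measurableType d1) (P1 : probability T1 R)
    d2 (T2 : measurableType d2) (P2 : probability T2 R) (X : T1 -> R) (Y : T2 -> R) :
  measurable_fun setT X -> measurable_fun setT Y ->
  (forall G : R -> R, continuous G -> (forall x, 0 <= G x <= 1) ->
     \int[P1]_w G (X w) = \int[P2]_w G (Y w)) ->
  forall B : set (measurableTypeR R), measurable B ->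
    P1 (X @^-1` B) = P2 (Y @^-1` B).
Proof.
move=> mX mY XY B mB.
pose X' : {RV P1 >-> R} := mfun_Sub (mem_set mX).
pose Y' : {RV P2 >-> R} := mfun_Sub (mem_set mY).
rewrite -[LHS]/(distribution P1 X' B) -[RHS]/(distribution P2 Y' B).
apply: (@measure_unique _ R _ (@RGenInftyO.G R)
  (fun n => `]-oo, n%:R[%classic)) => //.
- exact: RGenInftyO.measurableE.
- move=> _ _ [a ->] [b ->]; exists (Num.min a b).
  apply/seteqP; split => x /=; rewrite !in_itv/= lt_min; first by case=> -> ->.
  by move=> /andP[].
- by move=> n; exists n%:R.
- apply/seteqP; split=> // x _; exists (Num.bound `|x|) => //=.
  by rewrite in_itv/= (le_lt_trans (ler_norm x))// archi_boundP.
- move=> _ [a ->]; apply/eqP; rewrite eq_le; apply/andP; split.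
    exact: (ray_le mX mY XY).
  by apply: (ray_le mY mX) => G cG G01; rewrite XY.
- by move=> n; rewrite (le_lt_trans (probability_le1 _ _))// ltry.
Qed.

(** The hypothesis says that X and a normal variable have the same
    characteristic function. *)
Lemma gaussian_rv_of_cos d (T : measurableType d) (P : probability T R)
    (X : T -> R) (s : R) : 0 <= s -> measurable_fun setT X ->
  (forall th t, \int[P]_w cos (th + t * X w) = expR (- (t ^+ 2 * s ^+ 2 / 2)) * cos th) ->
  forall B : set (measurableTypeR R), measurable B ->
    P (X @^-1` B) = normal_or_dirac 0 s B.
Proof.
move=> s0 mX hX.
suff H (N : probability (measurableTypeR R) R) :
    (forall B, measurable B -> N B = normal_or_dirac 0 s B) ->
    forall B : set (measurableTypeR R), measurable B ->
      P (X @^-1` B) = normal_or_dirac 0 s B.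
  have [s00|sn0] := eqVneq s 0.
    have := H (@dirac _ (measurableTypeR R) 0 R); apply => B _.
    by rewrite /normal_or_dirac s00 eqxx.
  by apply: (H (normal_prob 0 s)) => B _; rewrite /normal_or_dirac (negPf sn0).
move=> NE B mB; rewrite -NE//.
apply: (@eq_law_of_expectation _ _ P _ (measurableTypeR R) N X idfun) => //.
  exact: measurable_id.
move=> G cG G01.
pose F (x : 'rV[R]_1) := G (x 0 0).
have FE x : G x = F (const_mx x) by rewrite /F mxE.
under eq_Rintegral do rewrite FE; under [RHS]eq_Rintegral do rewrite FE.
apply: (@eq_expectation_of_cos _ _ P _ (measurableTypeR R) N 1 (fun w => const_mx (X w))
  (fun x => const_mx x) _ _ _ F).
- by move=> i; under eq_fun do rewrite mxE.
- by move=> i; under eq_fun do rewrite mxE; exact: measurable_id.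
- move=> th c.
  have dE x : dot c (const_mx x) = c 0 0 * x by rewrite /dot big_ord1 mxE.
  under eq_Rintegral do rewrite dE; under [RHS]eq_Rintegral do rewrite dE.
  have := @gaussian_cos R _ (measurableTypeR R) N idfun 0 s th (c 0 0)
    (@measurable_id _ _ _) s0 NE.
  by rewrite mulr0 addr0 hX => /esym.
- split; first by move=> x; apply: continuous_comp; [exact: continuous_coord|exact: cG].
  by exists 1 => x; have /andP[? ?] := G01 (x 0 0); rewrite ger0_norm.
Qed.

End laws.

(** * Independent standard normal variables *)

Section iid_normals.
Context (R : realType).
Local Notation N := (normal_prob (0 : R) 1).

Lemma Rintegral_prod_bounded d1 (T1 : measurableType d1) (P1 : probability T1 R)
    d2 (T2 : measurableType d2) (P2 : probability T2 R) (f : T1 * T2 -> R) C :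
  measurable_fun setT f -> (forall z, `|f z| <= C) ->
  measurable_fun setT (fun y => \int[P1]_x f (x, y)) /\
  \int[(P1 \x P2)%E]_z f z = \int[P2]_y \int[P1]_x f (x, y).
Proof.
move=> mf fC.
have i_f : (P1 \x P2)%E.-integrable setT (EFin \o f).
  exact: (@integrableR_bounded _ _ _ (P1 \x P2)%E f C).
have ify y : P1.-integrable setT (fun x => (f (x, y))%:E).
  apply: (@integrableR_bounded _ _ _ P1 (fun x => f (x, y)) C) => //.
  exact: measurableT_comp.
have GE y : fubini_G P1 (EFin \o f) y = (\int[P1]_x f (x, y))%:E.
  by rewrite /fubini_G /Rintegral fineK// integrable_fin_num.
split.
  apply/measurable_EFinP; rewrite (_ : EFin \o _ = fubini_G P1 (EFin \o f)).
    exact: (measurable_fubini_G i_f).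
  by apply/funext => y; rewrite GE.
rewrite /Rintegral -(integral21_prod_meas1 i_f); congr fine.
by apply: eq_integral => y _; rewrite GE.
Qed.

(** Only two consequences of independence are recorded, in a form that passes to
    a product with one more factor: characteristic functions multiply, errors
    eps i included, and variances add. With eps = 0 the first clause gives
    exact characteristic functions. *)
Definition indep_normals d (T : measurableType d) (P : probability T R) m
    (xi : 'I_m -> T -> R) :=
  [/\ forall i, measurable_fun setT (xi i),
      forall (h : 'I_m -> R -> R) (rho eps : 'I_m -> R),
        (forall i, measurable_fun setT (h i)) -> (forall i, 0 <= rho i <= 1) ->
        (forall i th, `|\int[N]_r cos (th + h i r) - rho i * cos th| <= eps i) ->
        forall th,
        `|\int[P]_w cos (th + \sum_i h i (xi i w)) - (\prod_i rho i) * cos th|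
          <= \sum_i eps i &
      forall h : 'I_m -> R -> R, (forall i, measurable_fun setT (h i)) ->
        (forall i, N.-integrable setT (EFin \o (fun r => h i r ^+ 2))) ->
        (forall i, \int[N]_r h i r = 0) ->
        (\int[P]_w ((\sum_i h i (xi i w)) ^+ 2)%:E =
         (\sum_i \int[N]_r h i r ^+ 2)%:E)%E].

Lemma indep_normals0 : indep_normals N (fun i : 'I_0 => fun=> 0 : R).
Proof.
split=> [[]//|h rho eps _ _ _ th|h _ _ _].
  under eq_Rintegral do rewrite big_ord0 addr0.
  by rewrite !big_ord0 mul1r (Rintegral_prob_cst N) subrr normr0.
under eq_integral do rewrite big_ord0 expr0n/=.
by rewrite integral0 big_ord0.
Qed.

Lemma integrable_of_sqr d (T : measurableType d) (P : probability T R) (f : T -> R) :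
  measurable_fun setT f -> P.-integrable setT (EFin \o (fun w => f w ^+ 2)) ->
  P.-integrable setT (EFin \o f).
Proof.
move=> mf if2; apply: (@le_integrableR _ _ _ P f (fun w => 1 + f w ^+ 2)) => //.
  by apply: integrableRD => //; exact: integrableR_cst.
move=> w; rewrite -[f w ^+ 2]real_normK ?num_real//.
by have := sqr_ge0 (`|f w| - 1); have := normr_ge0 (f w); nra.
Qed.

(** Fubini. In the first clause the inner integral replaces the first m factors
    by their product rho' at the cost of the first m errors, and the outer
    integral then replaces the last factor. *)
Lemma indep_normalsS d (T : measurableType d) (P : probability T R) m
    (xi : 'I_m -> T -> R) :
  indep_normals P xi ->
  indep_normals (P \x N)%E (fun (i : 'I_m.+1) (z : T * measurableTypeR R) =>
    if unlift ord0 i is Some j then xi j z.1 else z.2).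
Proof.
move=> [mxi cxi vxi].
have sE (h : 'I_m.+1 -> R -> R) (z : T * measurableTypeR R) :
    \sum_i h i (if unlift ord0 i is Some j then xi j z.1 else z.2) =
    \sum_i h (lift ord0 i) (xi i z.1) + h ord0 z.2.
  rewrite big_ord_recl unlift_none addrC; congr (_ + _).
  by apply: eq_bigr => i _; rewrite liftK.
have mS (h : 'I_m.+1 -> R -> R) : (forall i, measurable_fun setT (h i)) ->
    measurable_fun setT (fun x => \sum_i h (lift ord0 i) (xi i x)).
  by move=> mh; apply: measurable_sum => i; exact: measurableT_comp.
have mS1 (h : 'I_m.+1 -> R -> R) : (forall i, measurable_fun setT (h i)) ->
    measurable_fun setT (fun z : T * measurableTypeR R =>
      \sum_i h (lift ord0 i) (xi i z.1) + h ord0 z.2).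
  move=> mh; have mh0 : measurable_fun setT (h ord0 : measurableTypeR R -> R) by exact: mh.
  apply: measurable_funD; last exact: (measurableT_comp mh0 measurable_snd).
  exact: (measurableT_comp (mS h mh) measurable_fst).
split.
- move=> i; case: unliftP => [j _|_]; last exact: measurable_snd.
  exact: measurableT_comp.
- move=> h rho eps mh rho01 hcos th.
  under eq_Rintegral do rewrite sE.
  pose g (z : T * measurableTypeR R) :=
    cos (th + (\sum_i h (lift ord0 i) (xi i z.1) + h ord0 z.2)).
  have mg : measurable_fun setT g.
    apply: measurableT_comp; first exact: continuous_measurable_fun (@continuous_cos R).
    by apply: measurable_funD => //; exact: mS1.
  have [mI ->] := @Rintegral_prod_bounded _ _ P _ _ N g 1 mg (fun z => cos_max _).
  pose rho' := \prod_(i < m) rho (lift ord0 i).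
  have rho'01 : 0 <= rho' <= 1.
    apply: (big_ind (fun x => 0 <= x <= 1)) => [|x y /andP[x0 x1] /andP[y0 y1]|i _].
    - by rewrite ler01 lexx.
    - by rewrite mulr_ge0//= mulr_ile1.
    - exact: rho01.
  have inner y : `|\int[P]_x g (x, y) - rho' * cos (th + h ord0 y)| <=
      \sum_i eps (lift ord0 i).
    rewrite /g /=; under eq_Rintegral do rewrite [_ + h ord0 y]addrC addrA.
    exact: (cxi (fun i => h (lift ord0 i))).
  have mc : measurable_fun setT (fun y : R => cos (th + h ord0 y)).
    apply: measurableT_comp; first exact: continuous_measurable_fun (@continuous_cos R).
    exact: measurable_funD.
  have ic : N.-integrable setT (EFin \o (fun y => cos (th + h ord0 y))).
    by apply: (@integrableR_bounded _ _ _ N _ 1) => // y; exact: cos_max.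
  have iI : N.-integrable setT (EFin \o (fun y => \int[P]_x g (x, y))).
    apply: (@integrableR_bounded _ _ _ N _ 1) => // y.
    apply: le_Rintegral_bounded => [|x]; last exact: cos_max.
    exact: measurableT_comp.
  have -> : \int[N]_y \int[P]_x g (x, y) - (\prod_i rho i) * cos th =
      \int[N]_y (\int[P]_x g (x, y) - rho' * cos (th + h ord0 y)) +
      rho' * (\int[N]_y cos (th + h ord0 y) - rho ord0 * cos th).
    rewrite RintegralB//; last exact: integrableRZ.
    by rewrite RintegralZl// big_ord_recl -/rho'; ring.
  rewrite (le_trans (ler_normD _ _))// big_ord_recl addrC lerD//.
    rewrite normrM ger0_norm; last by case/andP: rho'01.
    rewrite (le_trans _ (hcos ord0 th))// ler_piMl//.
    by case/andP: rho'01.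
  apply: (@le_Rintegral_bounded _ _ _ N) => //.
  apply: measurable_funB => //.
  exact: measurable_funM.
- move=> h mh ih2 h0.
  have ih i : N.-integrable setT (EFin \o h i).
    by apply: (@integrable_of_sqr _ (measurableTypeR R) N) => //; exact: mh.
  under eq_integral do rewrite sE.
  rewrite fubini_tonelli2; last 2 first.
  - apply/measurable_EFinP; apply: measurable_funX; exact: mS1.
  - by move=> z; rewrite lee_fin sqr_ge0.
  pose S x := \sum_i h (lift ord0 i) (xi i x).
  have ES2 : (\int[P]_x (S x ^+ 2)%:E = (\sum_i \int[N]_r h (lift ord0 i) r ^+ 2)%:E)%E.
    exact: vxi.
  have iS2 : P.-integrable setT (EFin \o (fun x => S x ^+ 2)).
    apply/integrableP; split.
      by apply/measurable_EFinP; apply: measurable_funX; exact: mS.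
    under eq_integral do rewrite gee0_abs ?lee_fin ?sqr_ge0//.
    by rewrite ES2 ltry.
  have iS : P.-integrable setT (EFin \o S) by apply: integrable_of_sqr => //; exact: mS.
  set V := (\sum_i _) in ES2.
  transitivity (\int[N]_y (V + (2 * (\int[P]_x S x) * h ord0 y + h ord0 y ^+ 2))%:E)%E.
    apply: eq_integral => y _; rewrite /fubini_G.
    have E x : (S x + h ord0 y) ^+ 2 = S x ^+ 2 + (2 * h ord0 y * S x + h ord0 y ^+ 2).
      by ring.
    under eq_integral do rewrite /= -/(S _) E.
    have i2 : P.-integrable setT (EFin \o (fun x => 2 * h ord0 y * S x + h ord0 y ^+ 2)).
      by apply: integrableRD; [exact: integrableRZ|exact: integrableR_cst].
    rewrite -[LHS]fineK; last by apply: integrable_fin_num => //; exact: integrableRD.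
    congr EFin; rewrite -[LHS]/(\int[P]_x (S x ^+ 2 + (2 * h ord0 y * S x + h ord0 y ^+ 2))).
    rewrite RintegralD// RintegralD//; [|exact: integrableRZ|exact: integrableR_cst].
    rewrite RintegralZl// Rintegral_prob_cst {1}/Rintegral ES2 /=; ring.
  have i1 : N.-integrable setT (EFin \o (fun y => 2 * (\int[P]_x S x) * h ord0 y)).
    exact: integrableRZ.
  have i2 : N.-integrable setT (EFin \o (fun y =>
      2 * (\int[P]_x S x) * h ord0 y + h ord0 y ^+ 2)) by exact: integrableRD.
  rewrite -[LHS]fineK; last first.
    by apply: integrable_fin_num => //; apply: integrableRD => //; exact: integrableR_cst.
  congr EFin; rewrite -[LHS]/(\int[N]_y (V +
      (2 * (\int[P]_x S x) * h ord0 y + h ord0 y ^+ 2))).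
  rewrite RintegralD//; last exact: integrableR_cst.
  rewrite RintegralD// RintegralZl// h0 mulr0 add0r (Rintegral_prob_cst N).
  by rewrite [RHS]big_ord_recl addrC.
Qed.

Lemma exists_indep_normals m : exists d (T : measurableType d)
  (P : probability T R) (xi : 'I_m -> T -> R), indep_normals P xi.
Proof.
elim: m => [|m [d [T [P [xi h]]]]].
  by exists _, _, N; eexists; exact: indep_normals0.
by exists _, _, (P \x N)%E; eexists; exact: indep_normalsS h.
Qed.

End iid_normals.

(** * Centred Gaussian vectors *)

Section gaussian_vectors.
Context (R : realType).

Definition qform q (C : 'M[R]_q) (c : 'rV[R]_q) : R := (c *m C *m c^T) 0 0.

Lemma qformE q (C : 'M[R]_q) c :
  qform C c = \sum_i \sum_j c 0 i * c 0 j * C i j.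
Proof.
rewrite /qform mxE exchange_big/=; apply: eq_bigr => j _.
rewrite !mxE mulr_suml; apply: eq_bigr => i _; ring.
Qed.

Lemma qformD q (C : 'M[R]_q) c1 c2 : C^T = C ->
  qform C (c1 + c2) = qform C c1 + qform C c2 + 2 * (c1 *m C *m c2^T) 0 0.
Proof.
move=> CT; rewrite /qform linearD/= !mulmxDl !mulmxDr.
have e : (c2 *m C *m c1^T) 0 0 = (c1 *m C *m c2^T) 0 0.
  transitivity ((c2 *m C *m c1^T)^T 0 0); first by rewrite [RHS]mxE.
  by rewrite !trmx_mul trmxK CT mulmxA.
have mxD (M1 M2 : 'M[R]_1) : (M1 + M2) 0 0 = M1 0 0 + M2 0 0 by rewrite mxE.
by rewrite !mxD e; ring.
Qed.

Section centered.
Context d (T : measurableType d) (P : probability T R) (q : nat).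
Implicit Types (Y : T -> 'rV[R]_q) (C : 'M[R]_q).

(** Y has law N(0, C): the characteristic function at c and all its phases. In
    this form sums of independent vectors and linear images are immediate;
    [centered_gaussian_covariance] and [gaussian_vector_centered] relate it to
    moments. *)
Definition centered_gaussian Y C :=
  [/\ forall i, measurable_fun setT (fun w => Y w 0 i), forall c, 0 <= qform C c &
      forall c th, \int[P]_w cos (th + dot c (Y w)) = expR (- (qform C c / 2)) * cos th].

Lemma measurable_dot Y (c : 'rV[R]_q) :
  (forall i, measurable_fun setT (fun w => Y w 0 i)) ->
  measurable_fun setT (fun w => dot c (Y w)).
Proof. by move=> mY; apply: measurable_sum => i; exact: measurable_funM. Qed.

Lemma qformZ C t c : qform C (t *: c) = t ^+ 2 * qform C c.
Proof.
by rewrite !qformE mulr_sumr; apply: eq_bigr => i _; rewrite mulr_sumr;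
  apply: eq_bigr => j _; rewrite !mxE; ring.
Qed.

Lemma dotZ t c (x : 'rV[R]_q) : dot (t *: c) x = t * dot c x.
Proof. by rewrite /dot mulr_sumr; apply: eq_bigr => i _; rewrite mxE mulrA. Qed.

Lemma centered_gaussian_law Y C c : centered_gaussian Y C ->
  forall B : set (measurableTypeR R), measurable B ->
  P ((fun w => dot c (Y w)) @^-1` B) = normal_or_dirac 0 (Num.sqrt (qform C c)) B.
Proof.
move=> [mY C0 hY]; apply: gaussian_rv_of_cos; first exact: sqrtr_ge0.
  exact: measurable_dot.
move=> th t; under eq_Rintegral do rewrite -dotZ.
by rewrite hY qformZ sqr_sqrtr.
Qed.

Lemma gaussian_moments (X : T -> R) (m s : R) :
  measurable_fun setT X -> 0 <= s ->
  (forall B, measurable B -> P (X @^-1` B) = normal_or_dirac m s B) ->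
  [/\ P.-integrable setT (EFin \o X),
      P.-integrable setT (EFin \o (fun w => X w ^+ 2)),
      \int[P]_w X w = m & \int[P]_w X w ^+ 2 = m ^+ 2 + s ^+ 2].
Proof.
move=> mX s0 hX.
have h0 := gaussian_sqr 0 mX s0 hX; have h1 := gaussian_sqr 1 mX s0 hX.
have h0' : (\int[P]_w (X w ^+ 2)%:E = (m ^+ 2 + s ^+ 2)%:E)%E.
  by rewrite -[m]addr0 -h0; apply: eq_integral => w _; rewrite addr0.
have i2 : P.-integrable setT (EFin \o (fun w => X w ^+ 2)).
  apply/integrableP; split.
    by apply/measurable_EFinP; exact: measurable_funX.
  under eq_integral do rewrite gee0_abs ?lee_fin ?sqr_ge0//.
  by rewrite h0' ltry.
have i1 : P.-integrable setT (EFin \o X) by exact: integrable_of_sqr.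
have E2 : \int[P]_w X w ^+ 2 = m ^+ 2 + s ^+ 2.
  by rewrite /Rintegral h0'.
split=> //.
have : \int[P]_w (X w + 1) ^+ 2 = (m + 1) ^+ 2 + s ^+ 2 by rewrite /Rintegral h1.
have e w : (X w + 1) ^+ 2 = X w ^+ 2 + (2 * X w + 1) by ring.
under eq_Rintegral do rewrite e.
rewrite RintegralD//; last first.
  by apply: integrableRD; [exact: integrableRZ|exact: integrableR_cst].
rewrite RintegralD//; [|exact: integrableRZ|exact: integrableR_cst].
by rewrite RintegralZl// Rintegral_prob_cst E2 => h; lra.
Qed.

Lemma centered_gaussian_dot Y C c : centered_gaussian Y C ->
  [/\ P.-integrable setT (EFin \o (fun w => dot c (Y w))),
      P.-integrable setT (EFin \o (fun w => dot c (Y w) ^+ 2)),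
      \int[P]_w dot c (Y w) = 0 & \int[P]_w dot c (Y w) ^+ 2 = qform C c].
Proof.
move=> gY; have [mY C0 _] := gY.
have [i1 i2 e1 e2] := gaussian_moments (measurable_dot c mY) (sqrtr_ge0 _)
  (centered_gaussian_law c gY).
by split=> //; rewrite e2 expr0n/= add0r sqr_sqrtr.
Qed.

Lemma expectation_Rintegral (X : T -> R) : P.-integrable setT (EFin \o X) ->
  ('E_P[X] = (\int[P]_w X w)%:E)%E.
Proof. by move=> iX; rewrite unlock /Rintegral fineK// integrable_fin_num. Qed.

Lemma integrable_mul (X1 X2 : T -> R) :
  measurable_fun setT X1 -> measurable_fun setT X2 ->
  P.-integrable setT (EFin \o (fun w => X1 w ^+ 2)) ->
  P.-integrable setT (EFin \o (fun w => X2 w ^+ 2)) ->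
  P.-integrable setT (EFin \o (fun w => X1 w * X2 w)).
Proof.
move=> m1 m2 i1 i2.
apply: (@le_integrableR _ _ _ P _ (fun w => X1 w ^+ 2 + X2 w ^+ 2)) => [||w].
- exact: measurable_funM.
- exact: integrableRD.
rewrite normrM -[X1 w ^+ 2]real_normK ?num_real// -[X2 w ^+ 2]real_normK ?num_real//.
by have := sqr_ge0 (`|X1 w| - `|X2 w|); have := normr_ge0 (X1 w);
  have := normr_ge0 (X2 w); nra.
Qed.

(** Polarisation of the variance [qform C] of [dot c (Y w)]. *)
Lemma centered_gaussian_coord Y C : centered_gaussian Y C -> C^T = C ->
  [/\ forall i, P.-integrable setT (EFin \o (fun w => Y w 0 i)),
      forall i j, P.-integrable setT (EFin \o (fun w => Y w 0 i * Y w 0 j)),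
      forall i, \int[P]_w Y w 0 i = 0 &
      forall i j, \int[P]_w (Y w 0 i * Y w 0 j) = C i j].
Proof.
move=> gY CT; have [mY C0 _] := gY.
pose e i : 'rV[R]_q := 1 *: delta_mx 0 i.
have de i x : dot (e i) x = x 0 i by rewrite dot_delta mul1r.
have h i := centered_gaussian_dot (e i) gY.
have i1 i : P.-integrable setT (EFin \o (fun w => Y w 0 i)).
  by have [+ _ _ _] := h i; under eq_fun do rewrite /= de.
have i2 i : P.-integrable setT (EFin \o (fun w => Y w 0 i ^+ 2)).
  by have [_ + _ _] := h i; under eq_fun do rewrite /= de.
have i2' i j : P.-integrable setT (EFin \o (fun w => Y w 0 i * Y w 0 j)).
  exact: integrable_mul.
split=> // [i|i j].
  by have [_ _ + _] := h i; under eq_Rintegral do rewrite de.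
have [_ _ _ Ei] := h i; have [_ _ _ Ej] := h j.
have [_ _ _] := centered_gaussian_dot (e i + e j) gY.
rewrite qformD// -Ei -Ej.
under eq_Rintegral do rewrite dotDl !de.
under [X in _ = X + _ + _ -> _]eq_Rintegral do rewrite de.
under [X in _ = _ + X + _ -> _]eq_Rintegral do rewrite de.
have E w : (Y w 0 i + Y w 0 j) ^+ 2 =
  Y w 0 i ^+ 2 + (Y w 0 j ^+ 2 + 2 * (Y w 0 i * Y w 0 j)) by ring.
under eq_Rintegral do rewrite E.
rewrite RintegralD//; last by apply: integrableRD => //; exact: integrableRZ.
rewrite RintegralD//; last exact: integrableRZ.
rewrite RintegralZl// addrA => /addrI/(mulfI _)->; last by rewrite pnatr_eq0.
by rewrite /e !scale1r -rowE trmx_delta -colE !mxE.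
Qed.

Lemma centered_gaussian_covariance Y C : centered_gaussian Y C -> C^T = C ->
  [/\ gaussian_vector P Y, (forall i, 'E_P[fun w => Y w 0%R i] = 0)%E &
      forall i j, covariance P (fun w => Y w 0 i) (fun w => Y w 0 j) = (C i j)%:E].
Proof.
move=> gY CT; have [i1 i2 e1 e2] := centered_gaussian_coord gY CT.
have E0 i : ('E_P[fun w => Y w 0%R i] = 0)%E.
  by rewrite expectation_Rintegral// e1.
split=> //.
- move=> c; exists 0, (Num.sqrt (qform C c)); split; first exact: sqrtr_ge0.
  exact: centered_gaussian_law.
- move=> i j; rewrite unlock !E0/= -e2 -expectation_Rintegral//.
  by congr expectation; apply/funext => w; rewrite !fctE/= !subr0.
Qed.

(** The law of each combination of coordinates is normal; its mean and variance
    are read off from the moments of Y. *)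
Lemma gaussian_vector_centered Y C :
  (forall i, measurable_fun setT (fun w => Y w 0 i)) ->
  gaussian_vector P Y -> (forall i, 'E_P[fun w => Y w 0%R i] = 0)%E ->
  (forall i j, covariance P (fun w => Y w 0 i) (fun w => Y w 0 j) = (C i j)%:E) ->
  centered_gaussian Y C.
Proof.
move=> mY gY E0 covY.
have dotE c w : dot c (Y w) = \sum_(i < q) c 0 i * Y w 0 i by [].
have law c := gY c.
have mc i : exists m s, [/\ 0 <= s, m = 0 & forall B : set (measurableTypeR R),
   measurable B -> P ((fun w => Y w 0 i) @^-1` B) = normal_or_dirac m s B].
  have [m [s [s0 hB]]] := law (1 *: delta_mx 0 i).
  have e : (fun w => \sum_(j < q) (1 *: delta_mx 0 i : 'rV[R]_q) 0 j * Y w 0 j) =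
           (fun w => Y w 0 i).
    by apply/funext => w; rewrite -[LHS]/(dot _ _) dot_delta mul1r.
  rewrite e in hB; exists m, s; split=> //.
  have [_ _ <- _] := gaussian_moments (mY i) s0 hB.
  by rewrite /Rintegral -[X in fine X]/(\int[P]_w (Y w 0 i)%:E)%E;
     have := E0 i; rewrite unlock => ->.
have i1 i : P.-integrable setT (EFin \o (fun w => Y w 0 i)).
  by have [m [s [s0 _ hB]]] := mc i; have [] := gaussian_moments (mY i) s0 hB.
have i2 i : P.-integrable setT (EFin \o (fun w => Y w 0 i ^+ 2)).
  by have [m [s [s0 _ hB]]] := mc i; have [] := gaussian_moments (mY i) s0 hB.
have i12 i j : P.-integrable setT (EFin \o (fun w => Y w 0 i * Y w 0 j)).
  exact: integrable_mul.
have e1 i : \int[P]_w Y w 0 i = 0.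
  by have := E0 i; rewrite unlock /Rintegral => ->.
have e2 i j : \int[P]_w (Y w 0 i * Y w 0 j) = C i j.
  have := covY i j; rewrite unlock !E0/=.
  rewrite (_ : (_ * _)%R = fun w => Y w 0 i * Y w 0 j).
    by rewrite expectation_Rintegral// => -[].
  by apply/funext => w; rewrite !fctE/= !subr0.
have dot2 c w : dot c (Y w) ^+ 2 = \sum_i \sum_j c 0 i * c 0 j * (Y w 0 i * Y w 0 j).
  rewrite expr2 mulr_suml; apply: eq_bigr => i _; rewrite mulr_sumr.
  by apply: eq_bigr => j _; ring.
have Ed c : \int[P]_w dot c (Y w) = 0.
  rewrite Rintegral_sum => [|i]; last exact: integrableRZ.
  by rewrite big1// => i _; rewrite RintegralZl// e1 mulr0.
have Ed2 c : \int[P]_w dot c (Y w) ^+ 2 = qform C c.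
  under eq_Rintegral do rewrite dot2.
  rewrite Rintegral_sum => [|i]; last by apply: integrableR_sum => j; exact: integrableRZ.
  rewrite qformE; apply: eq_bigr => i _.
  rewrite Rintegral_sum => [|j]; last exact: integrableRZ.
  by apply: eq_bigr => j _; rewrite RintegralZl// e2.
split=> // [c|c th].
  by rewrite -Ed2; apply: Rintegral_ge0 => w _; exact: sqr_ge0.
have [m [s [s0 hB]]] := law c.
have md := measurable_dot c mY.
have [_ _ em es] := gaussian_moments md s0 hB.
have m0 : m = 0 by rewrite -em Ed.
have s2 : s ^+ 2 = qform C c by rewrite -Ed2 es m0 expr0n/= add0r.
under eq_Rintegral do rewrite -[dot _ _]mul1r.
by rewrite (gaussian_cos th 1 md s0 hB) m0 mulr0 addr0 expr1n mul1r s2.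
Qed.

End centered.
End gaussian_vectors.

(** * Sums of independent variables *)

Section independent_sums.
Context (R : realType) d (T : measurableType d) (P : probability T R) (p : nat).
Variable X : 'I_p -> T -> R.
Hypothesis mX : forall k, measurable_fun setT (X k).
Hypothesis indepX : forall B : 'I_p -> set R, (forall k, measurable (B k)) ->
  P (\bigcap_(k in [set: 'I_p]) (X k @^-1` B k)) = (\prod_k P (X k @^-1` B k))%E.

(* [discr N] rounds [-1, 1] down to the grid of step 2 / N. *)
Let v (N l : nat) : R := -1 + 2 * l%:R / N%:R.
Let cell N l : set R := `[v N l, v N l.+1[%classic.
Let discr (N : nat) (x : R) : R := \sum_(l < N.+1) v N l * \1_(cell N l) x.

Let vS N l : v N l.+1 = v N l + 2 / N%:R.
Proof. by rewrite /v -natr1; ring. Qed.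

Let discr_approx N x : (0 < N)%N -> `|x| <= 1 ->
  `|x - discr N x| <= 2 / N%:R /\ `|discr N x| <= 1.
Proof.
move=> N0 x1; have Np : 0 < N%:R :> R by rewrite ltr0n.
move: x1; rewrite ler_norml => /andP[xN1 x1].
pose y := (x + 1) * N%:R / 2; have y0 : 0 <= y.
  by rewrite /y divr_ge0// mulr_ge0// -lerBlDr sub0r.
pose l0 := Num.truncn y; have /andP[l0y yl0] := truncn_itv y0.
rewrite -/l0 in l0y yl0.
have l0N : (l0 < N.+1)%N.
  rewrite ltnS -(ler_nat R) (le_trans l0y)// /y ler_pdivrMr// mulrC ler_pM2l//.
  by rewrite -lerBrDr (le_trans x1)//; lra.
have xE : x = -1 + 2 * y / N%:R by rewrite /y; field; rewrite gt_eqF.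
have xin l : (x \in cell N l) = (l == l0).
  apply/idP/eqP => [|->]; rewrite inE /cell/= in_itv/= xE /v.
    rewrite lerD2l ltrD2l !ler_pM2r ?invr_gt0// !ltr_pM2r ?invr_gt0//.
    rewrite ler_pM2l// ltr_pM2l// => /andP[ly yl].
    by apply/esym/eqP; rewrite truncn_eq// ly.
  by rewrite lerD2l ltrD2l ler_pM2r ?invr_gt0// ltr_pM2r ?invr_gt0//
     ler_pM2l// ltr_pM2l// l0y.
have dE : discr N x = v N l0.
  rewrite /discr (bigD1 (Ordinal l0N))//= indicE xin eqxx mulr1 big1 ?addr0//.
  move=> l ll0; rewrite indicE xin (_ : _ == _ = false) ?mulr0//.
  by apply/negbTE; apply: contra ll0 => /eqP e; apply/eqP/val_inj.
have : x \in cell N l0 by rewrite xin.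
rewrite inE /cell/= in_itv/= vS => /andP[h1 h2].
rewrite dE; split; rewrite ler_norml; apply/andP; split; try lra.
by rewrite /v lerDl divr_ge0// mulr_ge0.
Qed.

Lemma normr_prod_le1 (I : Type) (r : seq I) (Q : pred I) (a : I -> R) :
  (forall i, `|a i| <= 1) -> `|\prod_(i <- r | Q i) a i| <= 1.
Proof.
move=> a1; apply: (big_ind (fun y => `|y| <= 1)) => [|x y x1 y1|i _] //.
  by rewrite normr1.
by rewrite normrM mulr_ile1.
Qed.

(** Telescoping: the factors are exchanged one at a time. *)
Lemma normr_prodB (r : seq 'I_p) (a b : 'I_p -> R) :
  (forall k, `|a k| <= 1) -> (forall k, `|b k| <= 1) ->
  `|\prod_(k <- r) a k - \prod_(k <- r) b k| <= \sum_(k <- r) `|a k - b k|.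
Proof.
move=> a1 b1; elim: r => [|k r ih]; first by rewrite !big_nil subrr normr0.
have pb : `|\prod_(j <- r) b j| <= 1.
  exact: normr_prod_le1.
rewrite !big_cons.
have -> : a k * \prod_(j <- r) a j - b k * \prod_(j <- r) b j =
  (a k - b k) * \prod_(j <- r) b j +
  a k * (\prod_(j <- r) a j - \prod_(j <- r) b j) by ring.
rewrite (le_trans (ler_normD _ _))// !normrM lerD//; first by rewrite ler_piMr.
by rewrite (le_trans _ ih)// ler_piMl.
Qed.

Section product.
Variable g : 'I_p -> R -> R.
Hypothesis mg : forall k, measurable_fun setT (g k).
Hypothesis g1 : forall k x, `|g k x| <= 1.

Let A N k l : set T := X k @^-1` (g k @^-1` cell N l).

Let mgcell N k l : measurable (g k @^-1` cell N l).
Proof. by rewrite -[X in measurable X]setTI; apply: mg => //; exact: measurable_itv. Qed.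

Let mA N k l : measurable (A N k l).
Proof. by rewrite -[X in measurable X]setTI; apply: mX => //; exact: mgcell. Qed.

Let mgX k : measurable_fun setT (fun w => g k (X k w)).
Proof. exact: measurableT_comp. Qed.

Let mdiscr N k : measurable_fun setT (fun w => discr N (g k (X k w))).
Proof.
apply: measurable_sum => l; apply: measurable_funM => //.
have mi : measurable_fun setT (\1_(cell N l) : R -> R).
  by apply: measurable_indic; exact: measurable_itv.
exact: (measurableT_comp mi (mgX k)).
Qed.

Let iI (B : set T) : measurable B -> P.-integrable setT (EFin \o (\1_B : T -> R)).
Proof. by move=> mB; apply: integrable_indic. Qed.

Let iA N k l : P.-integrable setT (EFin \o (\1_(A N k l) : T -> R)).
Proof. exact: iI. Qed.

Let discrX N k w : discr N (g k (X k w)) = \sum_(l < N.+1) v N l * \1_(A N k l) w.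
Proof. by apply: eq_bigr => l _; rewrite !indicE. Qed.

Let discrE N k : (0 < N)%N ->
  \int[P]_w discr N (g k (X k w)) = \sum_(l < N.+1) v N l * fine (P (A N k l)).
Proof.
move=> N0; under eq_Rintegral do rewrite discrX.
rewrite Rintegral_sum => [|l].
  apply: eq_bigr => l _; rewrite RintegralZl; [|by []|exact: iA].
  by congr (_ * _); rewrite /Rintegral (integral_indic _ measurableT (mA N k l)) setIT.
by apply: integrableRZ; exact: iA.
Qed.

(* For functions with finitely many values this is the product rule for events. *)
Let prod_discr N : (0 < N)%N ->
  \int[P]_w \prod_k discr N (g k (X k w)) = \prod_k \int[P]_w discr N (g k (X k w)).
Proof.
move=> N0; under [RHS]eq_bigr do rewrite discrE//.
rewrite bigA_distr_bigA /=.
pose B (phi : {ffun 'I_p -> 'I_N.+1}) := \bigcap_(k in [set: 'I_p]) A N k (phi k).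
have mB phi : measurable (B phi) by apply: fin_bigcap_measurable.
have E w : \prod_k discr N (g k (X k w)) =
    \sum_(phi : {ffun 'I_p -> 'I_N.+1}) (\prod_k v N (phi k)) * \1_(B phi) w.
  under eq_bigr do rewrite discrX.
  rewrite bigA_distr_bigA; apply: eq_bigr => phi _; rewrite big_split/=; congr (_ * _).
  rewrite indicE; have [wB|wB] := boolP (w \in B phi).
    rewrite big1// => k _; rewrite indicE mem_set//.
    by move: wB; rewrite inE => /(_ k I).
  have [k wk] : exists k, ~ A N k (phi k) w.
    by apply/existsNP => h; move: wB; rewrite notin_setE; apply => k _; exact: h.
  by rewrite (bigD1 k)//= indicE memNset// mul0r.
under eq_Rintegral do rewrite E.
rewrite Rintegral_sum => [|phi]; last first.
  by apply: integrableRZ; exact: iI (mB phi).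
apply: eq_bigr => phi _; rewrite RintegralZl; [|by []|exact: iI (mB phi)].
rewrite big_split/=; congr (_ * _).
rewrite /Rintegral (integral_indic _ measurableT (mB phi)) setIT.
transitivity (fine (\prod_k P (A N k (phi k)))%E).
  by congr fine; exact: (indepX (fun k => mgcell N k (phi k))).
rewrite -[RHS]/(fine (\prod_k fine (P (A N k (phi k))))%:E); congr fine.
rewrite -prodEFin; apply: eq_bigr => k _.
by rewrite fineK// fin_num_measure.
Qed.

Lemma expectation_prod_bounded :
  \int[P]_w \prod_k g k (X k w) = \prod_k \int[P]_w g k (X k w).
Proof.
have ip (h : 'I_p -> T -> R) : (forall k, measurable_fun setT (h k)) ->
    (forall k w, `|h k w| <= 1) -> P.-integrable setT (EFin \o (fun w => \prod_k h k w)).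
  move=> mh h1; apply: (@integrableR_bounded _ _ _ P _ 1).
    by apply: measurable_prod => k _; exact: mh.
  by move=> w; exact: normr_prod_le1.
have d1 N (N0 : (0 < N)%N) k w : `|discr N (g k (X k w))| <= 1.
  by have [] := discr_approx N0 (g1 k (X k w)).
have dd N (N0 : (0 < N)%N) k w :
    `|g k (X k w) - discr N (g k (X k w))| <= 2 / N%:R.
  by have [] := discr_approx N0 (g1 k (X k w)).
have i1 k : P.-integrable setT (EFin \o (fun w => g k (X k w))).
  exact: (@integrableR_bounded _ _ _ P _ 1).
have i2 N (N0 : (0 < N)%N) k : P.-integrable setT (EFin \o (fun w => discr N (g k (X k w)))).
  by apply: (@integrableR_bounded _ _ _ P _ 1) => // w; exact: d1.
apply/eqP; rewrite -subr_eq0 -normr_le0; apply/ler_addgt0Pl => e e0; rewrite addr0.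
have [N NE] : exists N, 4 * p%:R / e < N%:R.
  exists (Num.bound (4 * p%:R / e)); apply: archi_boundP.
  by rewrite divr_ge0 ?mulr_ge0// ltW.
have N0 : (0 < N)%N.
  by rewrite -(ltr_nat R) (le_lt_trans _ NE)// divr_ge0 ?mulr_ge0// ltW.
have Np : 0 < N%:R :> R by rewrite ltr0n.
have c2 : \sum_(k < p) 2 / N%:R = 2 * p%:R / N%:R :> R.
  by rewrite sumr_const card_ord -mulr_natr; ring.
rewrite (le_trans (ler_distD (\int[P]_w \prod_k discr N (g k (X k w))) _ _))//.
rewrite (@le_trans _ _ (2 * p%:R / N%:R + 2 * p%:R / N%:R))//; last first.
  rewrite (_ : _ + _ = 4 * p%:R / N%:R); last by ring.
  by rewrite ler_pdivrMr// [leRHS]mulrC -ler_pdivrMr// ltW.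
rewrite lerD//.
  rewrite -RintegralB//; [|exact: ip|apply: ip => //; exact: d1].
  apply: le_Rintegral_bounded => [|w].
    by apply: measurable_funB; apply: measurable_prod => k _; [exact: mgX|exact: mdiscr].
  apply: le_trans (normr_prodB _ _ _) _ => // [k|]; first exact: d1.
  by rewrite -c2; apply: ler_sum => k _; exact: dd.
rewrite prod_discr//; apply: le_trans (normr_prodB _ _ _) _.
- by move=> k; apply: le_Rintegral_bounded => // w; exact: d1.
- by move=> k; apply: le_Rintegral_bounded.
- rewrite -c2; apply: ler_sum => k _; rewrite -RintegralB//; last exact: i2.
  apply: le_Rintegral_bounded => [|w]; first exact: measurable_funB.
  by rewrite distrC; exact: dd.
Qed.

End product.

Variable e : 'I_p -> R.
Hypothesis cosX : forall k th, \int[P]_w cos (th + X k w) = e k * cos th.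

(* Induction on the summands: cos (S + x) = cos S cos x - cos (S - pi/2) sin x moves
   one of them into the product, so the product must carry arbitrary bounded factors. *)
Let cos_sum_prod (r : seq 'I_p) : uniq r -> forall (g : 'I_p -> R -> R) th,
  (forall k, measurable_fun setT (g k)) -> (forall k x, `|g k x| <= 1) ->
  \int[P]_w (cos (th + \sum_(k <- r) X k w) * \prod_(k | k \notin r) g k (X k w)) =
  (\prod_(k <- r) e k) * cos th * \prod_(k | k \notin r) \int[P]_w g k (X k w).
Proof.
elim: r => [_|a r ih /= /andP[ar ur]] g th mg g1.
  under eq_Rintegral do rewrite big_nil addr0; rewrite big_nil mul1r.
  rewrite RintegralZl; last 2 first.
  - by [].
  - apply: (@integrableR_bounded _ _ _ P _ 1).
      by apply: measurable_prod => k _; exact: measurableT_comp.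
    by move=> w; exact: normr_prod_le1.
  by rewrite expectation_prod_bounded.
pose g' (h : R -> R) k := if k == a then h else g k.
have mg' (h : R -> R) : measurable_fun setT h -> forall k, measurable_fun setT (g' h k).
  by move=> mh k; rewrite /g'; case: ifP.
have g1' (h : R -> R) : (forall x, `|h x| <= 1) -> forall k x, `|g' h k x| <= 1.
  by move=> h1 k x; rewrite /g'; case: ifP.
have pg' h (F : 'I_p -> (R -> R) -> R) :
    \prod_(k | k \notin r) F k (g' h k) = F a h * \prod_(k | k \notin a :: r) F k (g k).
  rewrite (bigD1 a)//= /g' eqxx; congr (_ * _).
  apply: eq_big => [k|k /andP[_ /negPf ->]//].
  by rewrite inE negb_or andbC.
have mcos : measurable_fun setT (@cos R) := continuous_measurable_fun (@continuous_cos R).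
have msin : measurable_fun setT (@sin R) := continuous_measurable_fun (@continuous_sin R).
have cos1 x : `|@cos R x| <= 1 by exact: cos_max.
have sin1 x : `|@sin R x| <= 1 by exact: normr_sin_le1.
have E w : cos (th + \sum_(k <- a :: r) X k w) * \prod_(k | k \notin a :: r) g k (X k w) =
  cos (th + \sum_(k <- r) X k w) * \prod_(k | k \notin r) g' cos k (X k w) -
  cos ((th - pi / 2) + \sum_(k <- r) X k w) * \prod_(k | k \notin r) g' sin k (X k w).
  rewrite (pg' cos (fun k h => h (X k w))) (pg' sin (fun k h => h (X k w))) big_cons.
  set S := \sum_(k <- r) _.
  have -> : th + (X a w + S) = (th + S) + X a w by ring.
  by rewrite [th - _ + S]addrAC cosBpihalf cosD; ring.
under eq_Rintegral do rewrite E.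
have i1 (h : R -> R) t : measurable_fun setT h -> (forall x, `|h x| <= 1) ->
    P.-integrable setT (EFin \o (fun w => cos (t + \sum_(k <- r) X k w) *
       \prod_(k | k \notin r) g' h k (X k w))).
  move=> mh h1; apply: (@integrableR_bounded _ _ _ P _ 1).
    apply: measurable_funM.
      apply: (measurableT_comp mcos); apply: measurable_funD => //.
      exact: measurable_sum.
    under eq_fun do rewrite big_mkcond.
    apply: measurable_prod => k _; case: (k \notin r) => //.
    by apply: measurableT_comp => //; exact: mg'.
  move=> w; rewrite normrM mulr_ile1//.
  by apply: normr_prod_le1 => k; exact: g1'.
rewrite RintegralB ?i1// !ih//; try exact: mg'; try exact: g1'.
rewrite (pg' cos (fun k h => \int[P]_w h (X k w))).
rewrite (pg' sin (fun k h => \int[P]_w h (X k w))).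
have ca : \int[P]_w cos (X a w) = e a.
  by under eq_Rintegral do rewrite -[X _ _]add0r; rewrite cosX cos0 mulr1.
have sa : \int[P]_w sin (X a w) = 0.
  under eq_Rintegral do rewrite -cosBpihalf addrC.
  by rewrite cosX cosN cos_pihalf mulr0.
by rewrite ca sa big_cons; ring.
Qed.

Lemma cos_sum_independent th :
  \int[P]_w cos (th + \sum_k X k w) = (\prod_k e k) * cos th.
Proof.
have pE (F : 'I_p -> R) : \prod_(k | k \notin index_enum 'I_p) F k = 1.
  by apply: big_pred0 => k; rewrite mem_index_enum.
transitivity (\int[P]_w (cos (th + \sum_k X k w) *
    \prod_(k | k \notin index_enum 'I_p) (fun _ _ => 1) k (X k w))).
  by apply: eq_Rintegral => w _; rewrite pE mulr1.
have := @cos_sum_prod (index_enum 'I_p) (index_enum_uniq _) (fun _ _ => 1) th.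
move=> /(_ (fun=> measurable_cst _)) -> => [|k x]; last by rewrite normr1.
by rewrite pE mulr1.
Qed.

End independent_sums.

(** * The Gaussian field *)

Section gaussian_fields.
Context (R : realType) disp (T : measurableType disp) (P : probability T R).
Context (d p : nat) (Z : 'I_p -> 'rV[R]_d -> {RV P >-> R}) (K : 'I_p -> 'rV[R]_d -> R).
Hypothesis hZgauss : forall k, gaussian_process P (Z k).
Hypothesis hZstat : forall k, stationary_with P (Z k) 0 (K k).
Hypothesis hZindep : independent_processes P Z.

Lemma covariance_even k x : K k (- x) = K k x.
Proof.
have [_ c] := hZstat k; have := c 0 x; have := c x 0.
by rewrite covarianceC subr0 sub0r => -> [].
Qed.

Lemma process_centered k m (x : 'I_m -> 'rV[R]_d) :
  centered_gaussian P (fun w => \row_i Z k (x i) w) (\matrix_(i, j) K k (x i - x j)).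
Proof.
have [E0 c] := hZstat k.
have e i : (fun w => (\row_j Z k (x j) w) 0 i) = Z k (x i).
  by apply/funext => w; rewrite mxE.
apply: gaussian_vector_centered.
- by move=> i; rewrite e; exact: measurable_funPT.
- exact: hZgauss.
- by move=> i; rewrite e; exact: E0.
- by move=> i j; rewrite !e mxE; exact: c.
Qed.

(** A linear combination of values of one process is measurable for the
    sigma-algebra of that process: this is where independence of processes
    gives independence of the summands in [field_centered]. *)
Lemma process_combination_sigma k m (x : 'I_m -> 'rV[R]_d) (c : 'I_m -> R)
    (B : set R) : measurable B ->
  process_sigma (Z k) ((fun w => \sum_i c i * Z k (x i) w) @^-1` B).
Proof.
move=> mB; rewrite /process_sigma; set G := (X in <<s X >>).
pose TG := g_sigma_algebraType G.
have mZ y : measurable_fun setT (Z k y : TG -> R).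
  move=> _ A mA; rewrite setTI; apply: sub_sigma_algebra.
  by exists y, A; split.
have : measurable_fun setT ((fun w => \sum_i c i * Z k (x i) w) : TG -> R).
  by apply: measurable_sum => i; apply: measurable_funM => //; exact: mZ.
by move=> /(_ measurableT _ mB); rewrite setTI.
Qed.

Definition field_covariance m (x : 'I_m -> 'rV[R]_d) (b : 'I_m -> 'I_p -> R) : 'M[R]_m :=
  \matrix_(u, v) \sum_k b u k * b v k * K k (x u - x v).

Lemma tr_field_covariance m (x : 'I_m -> 'rV[R]_d) b :
  (field_covariance x b)^T = field_covariance x b.
Proof.
apply/matrixP => u v; rewrite !mxE; apply: eq_bigr => k _.
by rewrite -opprB covariance_even; ring.
Qed.

(** A combination of the entries is a sum over k of combinations of values of Z k,
    which are independent and normal: variances add up to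
    [qform (field_covariance x b)]. *)
Lemma field_centered m (x : 'I_m -> 'rV[R]_d) (b : 'I_m -> 'I_p -> R) :
  centered_gaussian P (fun w => \row_u \sum_k b u k * Z k (x u) w)
    (field_covariance x b).
Proof.
pose ck k (c : 'rV[R]_m) : 'rV[R]_m := \row_u (c 0 u * b u k).
pose X c k w := dot (ck k c) (\row_i Z k (x i) w).
have XE c k : X c k = fun w => \sum_i (c 0 i * b i k) * Z k (x i) w.
  by apply/funext => w; apply: eq_bigr => i _; rewrite !mxE.
have dotE c w : dot c (\row_u \sum_k b u k * Z k (x u) w) = \sum_k X c k w.
  under [RHS]eq_bigr do rewrite XE.
  rewrite exchange_big/=; apply: eq_bigr => u _; rewrite mxE mulr_sumr.
  by apply: eq_bigr => k _; rewrite mulrA.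
have qE c : qform (field_covariance x b) c =
    \sum_k qform (\matrix_(i, j) K k (x i - x j)) (ck k c).
  rewrite qformE; under [RHS]eq_bigr do rewrite qformE.
  rewrite [RHS]exchange_big/=; apply: eq_bigr => u _.
  rewrite [RHS]exchange_big/=; apply: eq_bigr => v _.
  rewrite mxE mulr_sumr; apply: eq_bigr => k _.
  by rewrite !mxE; ring.
have mX c k : measurable_fun setT (X c k).
  by apply: measurable_dot => i; under eq_fun do rewrite mxE; exact: measurable_funPT.
split.
- move=> i; under eq_fun do rewrite mxE.
  by apply: measurable_sum => k; apply: measurable_funM => //; exact: measurable_funPT.
- move=> c; rewrite qE; apply: sumr_ge0 => k _.
  by have [_ + _] := process_centered k x.
move=> c th; under eq_Rintegral do rewrite dotE.
pose e k := expR (- (qform (\matrix_(i, j) K k (x i - x j)) (ck k c) / 2)).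
rewrite (@cos_sum_independent _ _ _ P _ (X c) (mX c) _ e).
- congr (_ * _); rewrite -expR_sum; congr expR.
  by rewrite qE mulr_suml -sumrN.
- move=> B mB.
  have := @hZindep [set: 'I_p]%SET (fun k => X c k @^-1` B k).
  rewrite (_ : [set` [set: 'I_p]%SET] = [set: 'I_p]); last first.
    by apply/seteqP; split=> // k _ /=; rewrite inE.
  move=> ->; last by move=> k _; rewrite XE; exact: process_combination_sigma.
  by apply: eq_bigl => k; rewrite inE.
- by move=> k th'; have [_ _ ->] := process_centered k x.
Qed.

End gaussian_fields.

(** * Symmetric matrices *)

Section spectral.
Context (R : realType).

Lemma dot_mulmx n (x y : 'rV[R]_n) : dot x y = (x *m y^T) 0 0.
Proof. by rewrite mxE; apply: eq_bigr => i _; rewrite mxE. Qed.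

Lemma dotC n (x y : 'rV[R]_n) : dot x y = dot y x.
Proof. by apply: eq_bigr => i _; rewrite mulrC. Qed.

Lemma dotDr n (x y z : 'rV[R]_n) : dot x (y + z) = dot x y + dot x z.
Proof. by rewrite !(dotC x) dotDl. Qed.

Lemma dotZr n t (x y : 'rV[R]_n) : dot x (t *: y) = t * dot x y.
Proof. by rewrite !(dotC x) dotZ. Qed.

Lemma dot_ge0 n (x : 'rV[R]_n) : 0 <= dot x x.
Proof. by apply: sumr_ge0 => i _; rewrite -expr2 sqr_ge0. Qed.

Lemma dot_eq0 n (x : 'rV[R]_n) : dot x x = 0 -> x = 0.
Proof.
move=> /eqP; rewrite psumr_eq0 => [|i _]; last by rewrite -expr2 sqr_ge0.
move=> /allP h; apply/rowP => i; rewrite mxE.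
by have := h i (mem_index_enum _); rewrite /= mulf_eq0 orbb => /eqP.
Qed.

Lemma continuous_qform n (B : 'M[R]_n) : continuous (qform B).
Proof.
rewrite (_ : qform B = fun x => \sum_i \sum_j x 0 i * x 0 j * B i j).
  apply: continuous_fct_sum => i; apply: continuous_fct_sum => j.
  apply: continuous_fctM; last exact: cst_continuous.
  by apply: continuous_fctM; exact: continuous_coord.
by apply/funext => x; rewrite qformE.
Qed.

Lemma qform1 n (x : 'rV[R]_n) : qform 1%:M x = dot x x.
Proof. by rewrite /qform mulmx1 dot_mulmx. Qed.

Lemma dot_delta1 n (a : 'I_n) : dot (delta_mx 0 a) (delta_mx 0 a) = 1 :> R.
Proof. by rewrite -[X in dot X _]scale1r dot_delta mul1r mxE !eqxx. Qed.

(** A maximum of the quadratic form on the compact unit sphere, extended to all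
    vectors by homogeneity. *)
Lemma Rayleigh_max n (S : 'M[R]_n.+1) : exists2 v : 'rV[R]_n.+1, dot v v = 1 &
  forall x, qform S x <= qform S v * dot x x.
Proof.
pose A : set 'rV[R]_n.+1 := [set x | dot x x = 1].
have Ae : A (delta_mx 0 0) by exact: dot_delta1.
have cA : compact A.
  apply: (subclosed_compact _ (@compact_cube R n.+1 1)).
    rewrite (_ : A = qform 1%:M @^-1` [set 1]).
      by apply: preimage_closed => [x _|]; [exact: continuous_qform|exact: closed_eq].
    by apply/seteqP; split=> x; rewrite /A/= qform1.
  move=> x Ax a; rewrite -(expr_le1 (n := 2))// real_normK ?num_real//.
  by rewrite -Ax /dot (bigD1 a)//= -expr2 lerDl sumr_ge0// => i _; rewrite -expr2 sqr_ge0.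
have [v Av vmax] := @EVT_max_rV R _ (qform S) A (ex_intro _ _ Ae) cA
  (continuous_subspaceT (@continuous_qform _ S)).
exists v; first by move: Av; rewrite inE.
move=> x; have [x0|x0] := eqVneq (dot x x) 0.
  by rewrite x0 mulr0 (dot_eq0 x0) qformE big1// => i _; rewrite big1// => j _; rewrite mxE !mul0r.
have xp : 0 < dot x x by rewrite lt_neqAle eq_sym x0 dot_ge0.
pose t := (Num.sqrt (dot x x))^-1.
have t2 : t ^+ 2 = (dot x x)^-1 by rewrite exprVn sqr_sqrtr// ltW.
have := vmax (t *: x); rewrite inE /A/= qformZ t2 => /(_ _).
rewrite dotZ dotZr mulrA -expr2 t2 mulVf// => /(_ erefl).
by rewrite mulrC ler_pdivrMr.
Qed.

(** The reflection exchanging v and the first basis vector. *)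
Lemma householder n (v : 'rV[R]_n.+1) : dot v v = 1 ->
  exists2 H : 'M[R]_n.+1, H *m H^T = 1%:M & row 0 H = v.
Proof.
move=> v1; set e : 'rV[R]_n.+1 := delta_mx 0 0.
have ee : dot e e = 1 by exact: dot_delta1.
have re (M : 'M[R]_n.+1) : row 0 M = e *m M by exact: rowE.
have [ev|ve] := eqVneq e v.
  by exists 1%:M; rewrite ?trmx1 ?mulmx1// row1.
have [u uE] : exists u, u = v - e by exists (v - e).
have [N NE] : exists N, N = dot u u by exists (dot u u).
have N0 : N != 0.
  apply/eqP; rewrite NE => /dot_eq0/eqP; rewrite uE subr_eq0 eq_sym.
  by apply/negP.
have uu : u *m u^T = N%:M.
  by apply/matrixP => i j; rewrite !ord1 -dot_mulmx mxE eqxx NE.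
have eu : e *m u^T = (dot e u)%:M.
  by apply/matrixP => i j; rewrite !ord1 -dot_mulmx mxE eqxx.
have euE : dot e u = - (N / 2).
  rewrite NE uE -[- e]scaleN1r dotDl !dotDr !dotZ !dotZr v1 ee (dotC v e).
  by field.
have [k kE] : exists k, k = 2 / N by exists (2 / N).
have kN : k * k * N = k + k by rewrite kE; field.
have keu : k * dot e u = -1 by rewrite kE euE; field.
clear kE NE euE v1 ee ve.
have [M ME] : exists M, M = u^T *m u by exists (u^T *m u).
have MT : M^T = M by rewrite ME trmx_mul trmxK.
have MM : M *m M = N *: M.
  by rewrite ME mulmxA -[_ *m u^T]mulmxA uu mul_mx_scalar -scalemxAl.
have eM : e *m M = dot e u *: u by rewrite ME mulmxA eu mul_scalar_mx.
clear uu eu ME.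
exists (1%:M - k *: M).
  have -> : (1%:M - k *: M)^T = 1%:M - k *: M.
    by rewrite raddfB/= trmx1 linearZ/= MT.
  rewrite mulmxBr mulmx1 mulmxBl mul1mx -scalemxAr -scalemxAl MM !scalerA.
  by rewrite kN scalerDl opprB addrK subrK.
rewrite re mulmxBr mulmx1 -scalemxAr eM scalerA keu scaleN1r opprK uE.
by rewrite addrC subrK.
Qed.

(** First-order condition at a maximum: the choice t = b / (1 + |k|) makes the
    linear term win unless b = 0. *)
Lemma eq0_of_parabola (b k : R) : (forall t, 2 * t * b <= t ^+ 2 * k) -> b = 0.
Proof.
move=> h; have K0 : 0 < 1 + `|k| by rewrite ltr_pwDl.
have := h (b / (1 + `|k|)); rewrite exprMn exprVn => hb.
have b2 : b ^+ 2 <= 0; last by apply/eqP; rewrite -sqrf_eq0 eq_le b2 sqr_ge0.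
have : 2 * b ^+ 2 <= b ^+ 2 * (k / (1 + `|k|)).
  have := ler_wpM2r (ltW K0) hb.
  rewrite (_ : 2 * _ * _ * _ = 2 * b ^+ 2); last by field; rewrite gt_eqF.
  by rewrite (_ : b ^+ 2 / _ * k * _ = b ^+ 2 * (k / (1 + `|k|)))//; field; rewrite gt_eqF.
have : b ^+ 2 * (k / (1 + `|k|)) <= b ^+ 2 * 1.
  rewrite ler_wpM2l ?sqr_ge0// ler_pdivrMr// mul1r (le_trans (ler_norm k))//.
  by rewrite lerDr.
by rewrite mulr1; have := sqr_ge0 b; lra.
Qed.

(** Spectral theorem, by induction on the dimension: a maximiser v of the
    Rayleigh quotient is sent to the first basis vector, and optimality of v
    makes the first row of the conjugated matrix vanish off the diagonal. *)
Lemma symmetric_orthogonal_diag n (S : 'M[R]_n) : S^T = S ->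
  exists (U : 'M[R]_n) (D : 'rV[R]_n),
    U *m U^T = 1%:M /\ U *m S *m U^T = diag_mx D.
Proof.
elim: n S => [|n ih] S ST.
  by exists 1%:M, 0; split; apply/matrixP => -[].
have [v v1 vmax] := Rayleigh_max S.
have [H HH Hv] := householder v1.
have [A AH] : exists A : 'M[R]_(1 + n), A = H *m S *m H^T by eexists.
have AT : A^T = A by rewrite AH !trmx_mul trmxK ST mulmxA.
have Hdot i j : dot (row i H) (row j H) = (i == j)%:R.
  have := congr1 (fun M : 'M[R]_n.+1 => M i j) HH; rewrite !mxE => <-.
  by apply: eq_bigr => k _; rewrite !mxE.
have AE i j : A i j = (row i H *m S *m (row j H)^T) 0 0.
  rewrite AH -row_mul [LHS]mxE [RHS]mxE; apply: eq_bigr => k _.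
  by rewrite [(row i _) 0 k]mxE [(row j H)^T k 0]mxE [(row j H) 0 k]mxE [H^T k j]mxE.
have A0 j : j != 0 -> A 0 j = 0.
  move=> j0; rewrite AE Hv; set w := row j H; set b := (_ *m _) 0 0.
  have vw : dot v w = 0 by rewrite -Hv Hdot eq_sym (negPf j0).
  have ww : dot w w = 1 by rewrite Hdot eqxx.
  (* The perturbation v + t w of the maximiser. *)
  apply: (@eq0_of_parabola _ (qform S v - qform S w)) => t.
  have := vmax (v + t *: w).
  rewrite qformD// qformZ !dotDl !dotDr !dotZ !dotZr v1 ww [dot w v]dotC vw.
  rewrite linearZ/= -scalemxAr mxE -/b; lra.
pose A' : 'M[R]_n := drsubmx A.
have ur0 : ursubmx A = 0.
  apply/matrixP => i j; rewrite !mxE (_ : lshift n i = 0) ?A0//.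
  by apply/val_inj; rewrite ord1.
have AB : A = block_mx (ulsubmx A) 0 0 A'.
  rewrite -{1}[A]submxK ur0; congr block_mx.
  by rewrite -{1}AT -trmx_ursub ur0 trmx0.
have A'T : A'^T = A' by rewrite /A' trmx_drsub AT.
have [U' [D' [UU' UAU']]] := ih A' A'T.
pose U : 'M[R]_(1 + n) := block_mx 1%:M 0 0 U'.
have UU : U *m U^T = 1%:M.
  rewrite /U tr_block_mx !trmx0 trmx1 mulmx_block !(mul0mx, mulmx0) mul1mx.
  by rewrite !(addr0, add0r) UU' -scalar_mx_block.
exists (U *m H), (row_mx (A 0 0)%:M D'); split.
  by rewrite trmx_mul mulmxA -[U *m H *m _]mulmxA HH mulmx1 UU.
rewrite trmx_mul !mulmxA -[U *m H *m S]mulmxA -[U *m (H *m S) *m _]mulmxA -AH.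
have -> : U *m A *m U^T = block_mx (ulsubmx A) 0 0 (U' *m A' *m U'^T).
  rewrite {1}AB (tr_block_mx 1%:M 0 0 U') !trmx0 trmx1 !mulmx_block.
  by rewrite !(mul0mx, mulmx0, mul1mx, mulmx1, addr0, add0r).
transitivity (block_mx (diag_mx (A 0 0)%:M) 0 0 (diag_mx D')); last first.
  exact/esym/(@diag_mx_row R n 1).
rewrite UAU'; suff -> : ulsubmx A = diag_mx (A 0 0)%:M by [].
apply/matrixP => i j; rewrite !ord1 !mxE eqxx.
by congr (A _ _); apply/val_inj.
Qed.

Lemma psd_sqrt n (S : 'M[R]_n) : S^T = S -> (forall c, 0 <= qform S c) ->
  exists L : 'M[R]_n, L *m L^T = S.
Proof.
move=> ST S0; have [U [D [UU USU]]] := symmetric_orthogonal_diag ST.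
have UU' := mulmx1C UU.
have D0 i : 0 <= D 0 i.
  have := S0 (row i U); rewrite /qform tr_row -!row_mul.
  have -> : row i (U *m S *m col i U^T) 0 0 = (U *m S *m U^T) i i.
    rewrite [LHS]mxE [LHS]mxE [RHS]mxE; apply: eq_bigr => k _.
    by rewrite [col _ _ _ _]mxE.
  by rewrite USU !mxE eqxx.
pose E : 'rV[R]_n := \row_i Num.sqrt (D 0 i).
exists (U^T *m diag_mx E).
rewrite trmx_mul trmxK tr_diag_mx mulmxA -[U^T *m _ *m _]mulmxA.
rewrite (_ : diag_mx E *m diag_mx E = diag_mx D).
  by rewrite -USU !mulmxA UU' mul1mx -mulmxA UU' mulmx1.
apply/matrixP => i j; rewrite mulmx_diag !mxE.
by rewrite -expr2 sqr_sqrtr.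
Qed.

(** L is a square root L0 of C rotated into an eigenbasis of L0^T M L0: a
    Gaussian vector of covariance C and the quadratic form M are reduced
    together to independent coordinates and a diagonal form. *)
Lemma psd_diag n (C M : 'M[R]_n) : C^T = C -> (forall c, 0 <= qform C c) ->
  M^T = M -> exists (L : 'M[R]_n) (D : 'rV[R]_n),
    L *m L^T = C /\ L^T *m M *m L = diag_mx D.
Proof.
move=> CT C0 MT; have [L0 LL0] := psd_sqrt CT C0.
have ST : (L0^T *m M *m L0)^T = L0^T *m M *m L0.
  by rewrite !trmx_mul trmxK MT mulmxA.
have [U [D [UU USU]]] := symmetric_orthogonal_diag ST.
exists (L0 *m U^T), D; split.
  by rewrite trmx_mul trmxK mulmxA -[L0 *m U^T *m U]mulmxA (mulmx1C UU) mulmx1.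
by rewrite trmx_mul trmxK -USU !mulmxA.
Qed.

End spectral.

(** * Row sums *)

Section row_sums.
Context (R : realType).

Lemma ler_sum_const m (F : 'I_m -> R) a :
  (forall i, F i <= a) -> \sum_i F i <= m%:R * a.
Proof.
move=> Fa; apply: (@le_trans _ _ (\sum_(i < m) a)); first exact: ler_sum.
by rewrite sumr_const card_ord -[leLHS]mulr_natl.
Qed.

(** The operator norm for the supremum norm is at most a. Unlike the Euclidean
    operator norm it is read off the entries, and it still bounds eigenvalues. *)
Definition row_bounded m n (A : 'M[R]_(m, n)) (a : R) :=
  forall i, \sum_j `|A i j| <= a.

Lemma row_bounded_mul m n q (A : 'M[R]_(m, n)) (B : 'M[R]_(n, q)) a b :
  0 <= b -> row_bounded A a -> row_bounded B b -> row_bounded (A *m B) (a * b).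
Proof.
move=> b0 Aa Bb i; apply: (@le_trans _ _ (\sum_k \sum_j `|A i k| * `|B k j|)).
  rewrite exchange_big/=; apply: ler_sum => j _; rewrite mxE.
  rewrite (le_trans (ler_norm_sum _ _ _))//; apply: ler_sum => k _.
  by rewrite normrM.
apply: (@le_trans _ _ (\sum_k `|A i k| * b)).
  by apply: ler_sum => k _; rewrite -mulr_sumr ler_wpM2l.
by rewrite -mulr_suml ler_wpM2r.
Qed.

Lemma le_trace n (A : 'M[R]_n) a : row_bounded A a -> `|\tr A| <= n%:R * a.
Proof.
move=> Aa; rewrite (le_trans (ler_norm_sum _ _ _))//.
apply: ler_sum_const => i.
rewrite (le_trans _ (Aa i))// (bigD1 i)//= lerDl.
by apply: sumr_ge0.
Qed.

(** A nonzero column i of L is an eigenvector of C M for the eigenvalue D 0 i;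
    if the column vanishes, so does D 0 i. *)
Lemma psd_diag_bound n (C M L : 'M[R]_n) (D : 'rV[R]_n) a :
  L *m L^T = C -> L^T *m M *m L = diag_mx D -> 0 <= a -> row_bounded (C *m M) a ->
  forall i, `|D 0 i| <= a.
Proof.
move=> LL LML a0 CMa i.
have e r : \sum_k (C *m M) r k * L k i = D 0 i * L r i.
  have : (C *m M *m L) r i = (L *m diag_mx D) r i by rewrite -LML -LL !mulmxA.
  by rewrite mxE mul_mx_diag mxE mulrC.
pose r := [arg max_(k > i) `|L k i|]%O.
have rmax k : `|L k i| <= `|L r i|.
  by rewrite /r; case: arg_maxP => // j _ h; exact: h.
have [r0|r0] := eqVneq (L r i) 0.
  have L0 k : L k i = 0.
    by apply/eqP; rewrite -normr_le0 (le_trans (rmax k))// r0 normr0.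
  have := congr1 (fun B : 'M[R]_n => B i i) LML; rewrite !mxE eqxx mulr1n => <-.
  by rewrite big1 ?normr0// => k _; rewrite L0 mulr0.
rewrite -(@ler_pM2r _ `|L r i|) ?normr_gt0// -normrM -e.
rewrite (le_trans (ler_norm_sum _ _ _))//.
apply: (@le_trans _ _ (\sum_k `|(C *m M) r k| * `|L r i|)).
  by apply: ler_sum => k _; rewrite normrM ler_wpM2l.
by rewrite -mulr_suml ler_wpM2r.
Qed.

Lemma eigenvalue_bound q (V : 'M[R]_q) b l : (forall i j, `|V i j| <= b) ->
  eigenvalue V l -> `|l| <= q%:R * b.
Proof.
move=> Vb /eigenvalueP[v vV v0].
have [i0 vi0] : exists i, v 0 i != 0.
  by apply/existsP; apply: contra_neqT v0 => /existsPn h; apply/rowP => i;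
    rewrite mxE; apply/eqP; have := h i; rewrite negbK.
pose r := [arg max_(k > i0) `|v 0 k|]%O.
have rmax k : `|v 0 k| <= `|v 0 r|.
  by rewrite /r; case: arg_maxP => // j _ h; exact: h.
have r0 : 0 < `|v 0 r| by rewrite (lt_le_trans _ (rmax i0))// normr_gt0.
rewrite -(ler_pM2r r0) -normrM.
have -> : l * v 0 r = \sum_k v 0 k * V k r.
  by have := congr1 (fun B : 'rV[R]_q => B 0 r) vV; rewrite !mxE.
rewrite (le_trans (ler_norm_sum _ _ _))// -mulrA; apply: ler_sum_const => k.
by rewrite normrM mulrC ler_pM.
Qed.

End row_sums.

(** * Sums over separated points *)

Section packing.
Context (R : realType).

(** Discrete form of the derivative of x |-> x^(-b), making the sums of
    [sum_powRN_bounded] telescope. *)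
Lemma powRN_diff (b u v : R) : 0 < b -> 0 < u -> u <= v ->
  b * (v - u) * v `^ (- (1 + b)) <= u `^ (- b) - v `^ (- b).
Proof.
move=> b0 u0 uv; have v0 : 0 < v by exact: lt_le_trans uv.
have -> : v `^ (- (1 + b)) = v^-1 * v `^ (- b).
  by rewrite opprD powRD ?(gt_eqF v0) ?implybT// powR_inv1// ltW.
(* (v / u)^b is at least 1 + b ln (v / u), and ln (v / u) at least (v - u) / v. *)
have ub : u `^ (- b) = expR (b * ln (v / u)) * v `^ (- b).
  rewrite /powR (gt_eqF u0) (gt_eqF v0) -expRD ln_div ?posrE//.
  by congr expR; ring.
rewrite ub -[X in _ <= _ - X]mul1r -mulrBl mulrA ler_wpM2r ?powR_ge0//.
have lnuv : (v - u) / v <= ln (v / u).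
  have := @le_ln1Dx R (u / v - 1); rewrite ltrBrDr addrC subrr divr_gt0//.
  rewrite [1 + _]addrC subrK -[in ln (v / u)]invf_div lnV ?posrE ?divr_gt0//.
  by move=> /(_ isT); rewrite mulrBl mulfV ?gt_eqF//; lra.
rewrite lerBrDl (le_trans _ (expR_ge1Dx _))// lerD2l -mulrA.
by rewrite ler_wpM2l// ltW.
Qed.

Lemma sum_powRN_bounded (b h : R) : 0 < b -> 0 < h -> forall N,
  \sum_(m < N) (1 + h * m%:R) `^ (- (1 + b)) <= 1 + (b * h)^-1.
Proof.
move=> b0 h0 N; have bh : 0 < b * h by rewrite mulr_gt0.
have v0 m : 0 < 1 + h * m%:R :> R by rewrite ltr_pwDl// mulr_ge0// ltW.
suff : \sum_(m < N.+1) (1 + h * m%:R) `^ (- (1 + b)) <=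
    1 + (b * h)^-1 * (1 - (1 + h * N%:R) `^ (- b)).
  rewrite big_ord_recr/= => S; apply: (@le_trans _ _ _ _ _ (le_trans _ S)).
    by rewrite lerDl powR_ge0.
  by rewrite lerD2l ger_pMr ?invr_gt0// gerBl powR_ge0.
elim: N => [|N ih].
  by rewrite big_ord1 mulr0 addr0 !powR1 subrr mulr0 addr0.
rewrite big_ord_recr/= (le_trans (lerD ih (lexx _)))// -addrA lerD2l.
have := @powRN_diff b (1 + h * N%:R) (1 + h * N.+1%:R) b0 (v0 _).
rewrite lerD2l ler_wpM2l ?ler_nat// ?(ltW h0)// => /(_ isT).
set x := _ `^ (- b); set y := _ `^ (- b); set z := _ `^ _.
rewrite (_ : b * _ = b * h); last by rewrite -natr1; ring.
move=> le; rewrite -(ler_pM2l bh) mulrDr !mulrA mulfV ?gt_eqF// !mul1r; lra.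
Qed.

Lemma enorm_coord d (x : 'rV[R]_d) a : `|x 0 a| <= enorm x.
Proof.
rewrite -sqrtr_sqr ler_wsqrtr// (bigD1 a)//= lerDl sumr_ge0// => i _.
exact: sqr_ge0.
Qed.

Lemma enorm_le d (x : 'rV[R]_d) h : 0 <= h -> (forall a, `|x 0 a| <= h) ->
  enorm x <= d%:R * h.
Proof.
move=> h0 xh; apply: (@le_trans _ _ (Num.sqrt ((d%:R * h) ^+ 2))); last first.
  by rewrite sqrtr_sqr ger0_norm// mulr_ge0.
apply: ler_wsqrtr; apply: (@le_trans _ _ (\sum_(i < d) h ^+ 2)).
  by apply: ler_sum => i _; rewrite -real_normK ?num_real// ler_pXn2r// nnegrE.
rewrite sumr_const card_ord -[leLHS]mulr_natl exprMn ler_wpM2r ?sqr_ge0// -natrX.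
by rewrite ler_nat; case: d {x xh} => // k; rewrite leq_pmulr.
Qed.

(** The radial weight is dominated by a product of one-dimensional weights: each
    coordinate is at most the norm, and the exponent g is shared out among the
    d coordinates. *)
Lemma decay_le_prod d (x : 'rV[R]_d) (g : R) : (0 < d)%N -> 0 < g ->
  (1 + enorm x `^ g)^-1 <= 2 `^ g * \prod_a (1 + `|x 0 a|) `^ (- (g / d%:R)).
Proof.
move=> d0 g0; set e := enorm x; have e0 : 0 <= e by exact: sqrtr_ge0.
have dd : d%:R != 0 :> R by rewrite pnatr_eq0 -lt0n.
have prodE : (1 + e) `^ (- g) = \prod_(a < d) (1 + e) `^ (- (g / d%:R)).
  rewrite prodr_const card_ord -powR_mulrn ?powR_ge0// -powRrM.
  by congr (_ `^ _); field.
have e1 : 0 < 1 + e by rewrite ltr_pwDl.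
apply: (@le_trans _ _ (2 `^ g * (1 + e) `^ (- g))); last first.
  rewrite ler_wpM2l ?powR_ge0// prodE; apply: ler_prod => a _.
  rewrite powR_ge0/= !powRN lef_pV2 ?posrE ?powR_gt0 ?ltr_pwDl//.
  rewrite ge0_ler_powR ?nnegrE ?addr_ge0 ?divr_ge0 ?(ltW g0)// lerD2l.
  exact: enorm_coord.
rewrite powRN -ler_pdivrMr ?invr_gt0 ?powR_gt0// invrK mulrC.
rewrite ler_pdivrMr ?ltr_pwDl ?powR_ge0//.
have [e_le1|/ltW e_ge1] := leP e 1.
  apply: (@le_trans _ _ (2 `^ g)); last by rewrite ler_peMr ?powR_ge0// lerDl powR_ge0.
  by rewrite ge0_ler_powR ?nnegrE ?(ltW g0) ?(ltW e1)//; lra.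
apply: (@le_trans _ _ ((2 * e) `^ g)).
  by rewrite ge0_ler_powR ?nnegrE ?(ltW g0) ?(ltW e1) ?mulr_ge0//; lra.
by rewrite powRM// ler_wpM2l ?powR_ge0// lerDr.
Qed.

(** Cut space into cells by the signs and the integer parts of x a / h. With
    h = D / (d + 1) a cell has diameter less than D, so points and occupied
    cells correspond one to one, and a sum over cells of a product weight is a
    product of one-dimensional sums, convergent because g / d > 1. *)
Lemma packing d (D al : R) : (0 < d)%N -> 0 < D -> 0 < al ->
  exists2 C : R, 0 <= C & forall n (s : 'I_n -> 'rV[R]_d),
    (forall i j, i != j -> D <= enorm (s i - s j)) ->
    forall i, \sum_j (1 + enorm (s i - s j) `^ (d%:R + al))^-1 <= C.
Proof.
move=> d0 D0 al0; have dp : 0 < d%:R :> R by rewrite ltr0n.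
pose h := D / d.+1%:R; have h0 : 0 < h by rewrite divr_gt0.
have dh : d%:R * h < D.
  by rewrite /h mulrCA gtr_pMr// ltr_pdivrMr// mul1r ltr_nat.
pose g := d%:R + al; have g0 : 0 < g by rewrite addr_gt0.
pose b := al / d%:R; have b0 : 0 < b by rewrite divr_gt0.
have gb : g / d%:R = 1 + b by rewrite /g /b mulrDl mulfV ?gt_eqF.
pose u (m : nat) : R := (1 + h * m%:R) `^ (- (1 + b)).
have u0 m : 0 <= u m by exact: powR_ge0.
exists (2 `^ g * (2 * (1 + (b * h)^-1)) ^+ d).
  by rewrite mulr_ge0 ?powR_ge0// exprn_ge0// mulr_ge0// addr_ge0// invr_ge0 mulr_ge0 ?ltW.
move=> n s sep i; pose x j a : R := (s i - s j) 0 a.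
pose t j a := Num.truncn (`|x j a| / h).
have tP j a : h * (t j a)%:R <= `|x j a| < h * (t j a).+1%:R.
  have := @truncn_itv R (`|x j a| / h); rewrite divr_ge0 ?(ltW h0)// => /(_ isT).
  by rewrite ler_pdivlMr// ltr_pdivrMr// ![_ * h]mulrC.
pose N := (\max_j \max_a t j a).+1.
have tN j a : (t j a < N)%N.
  by rewrite ltnS (leq_trans _ (leq_bigmax j))// (leq_bigmax a).
pose c j : {ffun 'I_d -> bool * 'I_N} := [ffun a => (0 <= x j a, Ordinal (tN j a))].
have cinj : injective c.
  move=> j k jk; apply/eqP/negPn/negP => jk0.
  have := sep _ _ jk0; rewrite leNgt => /negP; apply; apply: le_lt_trans dh.
  apply: enorm_le => [|a]; first exact: ltW.
  have -> : (s j - s k) 0 a = x k a - x j a by rewrite /x !mxE; ring.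
  have := congr1 (fun f : {ffun _ -> _} => f a) jk; rewrite !ffunE => -[sg tE].
  have := tP j a; have := tP k a; rewrite tE -natr1.
  rewrite mulrDr mulr1 => /andP[k1 k2] /andP[j1 j2].
  move: sg k1 k2 j1 j2; have [xj|xj] := leP 0 (x j a); have [xk|xk] := leP 0 (x k a) => //.
    move=> _; rewrite (ger0_norm xj) (ger0_norm xk) => k1 k2 j1 j2.
    rewrite ler_norml; apply/andP; split; lra.
  move=> _; rewrite (ltr0_norm xj) (ltr0_norm xk) => k1 k2 j1 j2.
  rewrite ler_norml; apply/andP; split; lra.
apply: (@le_trans _ _ (\sum_j 2 `^ g * \prod_a u (c j a).2)).
  apply: ler_sum => j _; rewrite (le_trans (@decay_le_prod _ _ g d0 g0))//.
  rewrite ler_wpM2l ?powR_ge0//; apply: ler_prod => a _.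
  have v0 : 0 < 1 + h * (t j a)%:R by rewrite ltr_pwDl// mulr_ge0// ltW.
  have w0 : 0 < 1 + `|(s i - s j) 0 a| by rewrite ltr_pwDl.
  have b1 : 0 <= 1 + b by rewrite addr_ge0 ?ltW.
  rewrite powR_ge0/= gb ffunE/= /u !powRN lef_pV2 ?posrE ?(powR_gt0 _ v0) ?(powR_gt0 _ w0)//.
  rewrite ge0_ler_powR ?nnegrE ?(ltW v0) ?(ltW w0)// lerD2l.
  by have /andP[] := tP j a.
rewrite -mulr_sumr ler_wpM2l ?powR_ge0//.
apply: (@le_trans _ _ (\sum_(F : {ffun 'I_d -> bool * 'I_N}) \prod_a u (F a).2)).
  rewrite -(big_imset (fun F : {ffun 'I_d -> bool * 'I_N} => \prod_a u (F a).2) (in2W cinj))/=.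
  rewrite [leRHS](bigID (mem (c @: 'I_n)))/= lerDl.
  by apply: sumr_ge0 => F _; apply: prodr_ge0.
rewrite -(bigA_distr_bigA (fun _ (q : bool * 'I_N) => u q.2))/= prodr_const card_ord.
have S0 : 0 <= (b * h)^-1 by rewrite invr_ge0 mulr_ge0 ?ltW.
rewrite lerXn2r ?nnegrE ?sumr_ge0// ?mulr_ge0 ?addr_ge0//.
have -> : \sum_(q : bool * 'I_N) u q.2 = \sum_(c : bool) \sum_(m < N) u m.
  by rewrite pair_bigA.
rewrite sumr_const card_bool -[leLHS]mulr_natl ler_wpM2l//.
exact: sum_powRN_bounded.
Qed.

End packing.

(** * Quadratic forms of Gaussian vectors *)

Section quadratic_forms.
Context (R : realType).
Local Notation N := (normal_prob (0 : R) 1).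

Lemma measurable_norm_gt (B : R) : measurable ([set x | B < `|x|] : set (measurableTypeR R)).
Proof.
rewrite (_ : [set x | B < `|x|] = Num.Def.normr @^-1` `]B, +oo[); last first.
  by apply/seteqP; split=> x /=; rewrite in_itv/= andbT.
rewrite -[X in measurable X]setTI.
have mn : measurable_fun setT (Num.Def.normr : R -> R) by exact: normr_measurable.
by apply: mn => //; exact: measurable_itv.
Qed.

(** Chebyshev's inequality. *)
Lemma second_moment_tail d (T : measurableType d) (P : probability T R)
    (X : T -> R) v B : measurable_fun setT X ->
  (\int[P]_w (X w ^+ 2)%:E <= v%:E)%E -> 0 < B ->
  fine (P (X @^-1` [set x | B < `|x|])) <= v / B ^+ 2.
Proof.
move=> mX Xv B0; have B2 : 0 < B ^+ 2 by rewrite exprn_gt0.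
have mA : measurable (X @^-1` [set x | B < `|x|]).
  by rewrite -[X in measurable X]setTI; apply: mX => //; exact: measurable_norm_gt.
rewrite ler_pdivlMr// mulrC -lee_fin EFinM fineK ?fin_num_measure//.
apply: le_trans Xv; rewrite -[X in P X]setIT -integral_indic//.
rewrite -ge0_integralZl//; last 2 first.
- by apply/measurable_EFinP; exact: measurable_indic.
- by rewrite lee_fin ltW.
apply: ge0_le_integral => //.
- by move=> w _; rewrite mule_ge0// lee_fin// ltW.
- by apply: measurable_funeM; apply/measurable_EFinP; exact: measurable_indic.
- by apply/measurable_EFinP; exact: measurable_funX.
move=> w _; rewrite -EFinM lee_fin indicE; case: (boolP (w \in _)) => [|_].
  rewrite inE/= => /ltW Bx; rewrite mulr1 -[leRHS]real_normK ?num_real//.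
  by rewrite ler_pXn2r ?nnegrE// ltW.
by rewrite mulr0 sqr_ge0.
Qed.

Lemma normals_centered d (T : measurableType d) (P : probability T R) m
    (xi : 'I_m -> T -> R) n (L : 'M[R]_(n, m)) : indep_normals P xi ->
  centered_gaussian P (fun w => (\row_i xi i w) *m L^T) (L *m L^T).
Proof.
move=> [mxi cosxi _].
have dotL (c : 'rV[R]_n) (y : 'rV[R]_m) : dot c (y *m L^T) = dot (c *m L) y.
  by rewrite !dot_mulmx trmx_mul trmxK mulmxA.
have qL (c : 'rV[R]_n) : qform (L *m L^T) c = dot (c *m L) (c *m L).
  by rewrite /qform dot_mulmx trmx_mul !mulmxA.
split.
- move=> i; under eq_fun do rewrite mxE.
  apply: measurable_sum => j; apply: measurable_funM => //.
  by under eq_fun do rewrite mxE; exact: mxi.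
- by move=> c; rewrite qL dot_ge0.
move=> c th; pose b i := (c *m L) 0 i.
have := cosxi (fun i r => b i * r) (fun i => expR (- (b i ^+ 2 / 2))) (fun=> 0).
move=> /(_ _ _ _ th); rewrite sumr_const mul0rn normr_le0 subr_eq0 => H.
transitivity (\int[P]_w cos (th + \sum_i b i * xi i w)).
  apply: eq_Rintegral => w _; rewrite dotL; congr (cos (_ + _)).
  by apply: eq_bigr => i _; rewrite mxE.
rewrite (eqP (H _ _ _)).
- rewrite -expR_sum; congr (expR _ * _); rewrite qL /dot mulr_suml -sumrN.
  by apply: eq_bigr => i _; rewrite -expr2.
- by move=> i; exact: measurable_funM.
- by move=> i; rewrite expR_ge0/= -expR0 ler_expR oppr_le0 divr_ge0 ?sqr_ge0.
- by move=> i th'; rewrite normal_cos subrr normr0.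
Qed.

Section one_form.
Context d (T : measurableType d) (P : probability T R) m (Y : T -> 'rV[R]_m).
Variables (C M : 'M[R]_m).
Hypotheses (YC : centered_gaussian P Y C) (CT : C^T = C) (MT : M^T = M).

(** Y has the law of L xi for the L of [psd_diag], so Y M Y^T has the law of
    the weighted sum of squares of [xi]; D lists eigenvalues of C M, whence the
    traces and the bound. *)
Lemma quadratic_form_diag : exists D : 'rV[R]_m,
  [/\ \tr (C *m M) = \sum_i D 0 i,
      \tr (C *m M *m C *m M) = \sum_i D 0 i ^+ 2,
      forall a, 0 <= a -> row_bounded (C *m M) a -> forall i, `|D 0 i| <= a &
      exists d' (T' : measurableType d') (P' : probability T' R)
        (xi : 'I_m -> T' -> R), indep_normals P' xi /\
        forall G : R -> R, continuous G -> (exists b, forall x, `|G x| <= b) ->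
        \int[P]_w G (qform M (Y w)) = \int[P']_w G (\sum_i D 0 i * xi i w ^+ 2)].
Proof.
have [mY C0 cosY] := YC; have [L [D [LL LML]]] := psd_diag CT C0 MT.
exists D; split.
- by rewrite -LL -mulmxA mxtrace_mulC -[_ *m M *m _]mulmxA mulmxA LML mxtrace_diag.
- rewrite -LL -!mulmxA mxtrace_mulC !mulmxA LML.
  rewrite -[_ *m M *m L]mulmxA -mulmxA [L^T *m _]mulmxA LML.
  rewrite mulmx_diag mxtrace_diag.
  by apply: eq_bigr => i _; rewrite mxE expr2.
- by move=> a a0 CMa; apply: (psd_diag_bound LL LML a0 CMa).
have [d' [T' [P' [xi ixi]]]] := exists_indep_normals R m.
exists d', T', P', xi; split=> // G cG [b Gb].
have [mX _ cosX] := normals_centered L ixi.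
have := @eq_expectation_of_cos R _ _ P _ _ P' m Y _ mY mX.
move=> /(_ _ (fun y => G (qform M y))) => ->.
- apply: eq_Rintegral => w _; congr G; rewrite /qform trmx_mul trmxK.
  rewrite -!mulmxA [L^T *m (_ *m _)]mulmxA [L^T *m M *m _]mulmxA LML.
  rewrite mulmxA mul_mx_diag mxE; apply: eq_bigr => i _.
  by rewrite !mxE mulrAC -expr2 mulrC.
- by move=> th c; rewrite cosY cosX LL.
split; last by exists b.
by move=> y; apply: continuous_comp; [exact: continuous_qform|exact: cG].
Qed.

End one_form.
End quadratic_forms.

Section quadratic_estimates.
Context (R : realType).
Local Notation N := (normal_prob (0 : R) 1).

Lemma normal_sqr_scaled (c : R) (h := fun r : R => c * (r ^+ 2 - 1)) :
  [/\ measurable_fun setT h, N.-integrable setT (EFin \o (fun r => h r ^+ 2)),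
      \int[N]_r h r = 0 & \int[N]_r h r ^+ 2 = 2 * c ^+ 2].
Proof.
have [iu iu2 Eu Eu2] := normal_sqr_centred R.
have hE r : h r ^+ 2 = c ^+ 2 * (r ^+ 2 - 1) ^+ 2 by rewrite /h exprMn.
have ih : N.-integrable setT (EFin \o h) by exact: integrableRZ.
split.
- exact: measurable_intR ih.
- by under eq_fun do rewrite hE; exact: integrableRZ.
- by rewrite RintegralZl// Eu mulr0.
by under eq_Rintegral do rewrite hE; rewrite RintegralZl// Eu2 mulrC.
Qed.

(** A centred quadratic form is close to normal when its eigenvalues k D_i are
    small: the sum of the errors c0 |k D_i|^3 of [normal_cos_sqr] is of order
    m k^3, where k^2 m stays bounded in the application. *)
Lemma quadratic_form_cos : exists2 c0 : R, 0 <= c0 &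
  forall d (T : measurableType d) (P : probability T R) m (Y : T -> 'rV[R]_m)
    (C M : 'M[R]_m), centered_gaussian P Y C -> C^T = C -> M^T = M ->
  forall a k th, 0 <= a -> 0 <= k -> row_bounded (C *m M) a ->
  `|\int[P]_w cos (th + k * (qform M (Y w) - \tr (C *m M))) -
    expR (- (k ^+ 2 * \tr (C *m M *m C *m M))) * cos th| <=
  c0 * (m%:R * (k * a) ^+ 3).
Proof.
have [c0 c00 cosN] := normal_cos_sqr R.
exists c0 => // d T P m Y C M YC CT MT a k th a0 k0 CMa.
have [D [trD trD2 Da [d' [T' [P' [xi [[mxi cosxi _] YD]]]]]]] :=
  quadratic_form_diag YC CT MT.
pose t := \tr (C *m M); pose h i r := k * D 0 i * (r ^+ 2 - 1).
have -> : \int[P]_w cos (th + k * (qform M (Y w) - t)) =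
    \int[P']_w cos (th + \sum_i h i (xi i w)).
  transitivity (\int[P]_w cos (th - k * t + k * qform M (Y w))).
    by apply: eq_Rintegral => w _; congr cos; ring.
  rewrite (YD (fun x => cos (th - k * t + k * x))).
  - apply: eq_Rintegral => w _; congr cos; rewrite -addrA; congr (_ + _).
    rewrite /t trD addrC -mulrBr -sumrB mulr_sumr; apply: eq_bigr => i _.
    by rewrite /h; ring.
  - exact: continuous_affine_cos.
  - by exists 1 => x; exact: cos_max.
have -> : expR (- (k ^+ 2 * \tr (C *m M *m C *m M))) =
    \prod_i expR (- (k * D 0 i) ^+ 2).
  rewrite trD2 mulr_sumr -sumrN expR_sum.
  by apply: eq_bigr => i _; rewrite exprMn.
apply: (@le_trans _ _ (\sum_i c0 * `|k * D 0 i| ^+ 3)).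
  apply: cosxi => [i|i|i th'].
  - by have [] := normal_sqr_scaled (k * D 0 i).
  - by rewrite expR_ge0/= -expR0 ler_expR oppr_le0 sqr_ge0.
  - exact: cosN.
rewrite -mulr_sumr ler_wpM2l//; apply: ler_sum_const => i; rewrite normrM (ger0_norm k0).
rewrite ler_pXn2r ?nnegrE ?mulr_ge0// ler_wpM2l//; exact: Da.
Qed.

Lemma quadratic_form_tail d (T : measurableType d) (P : probability T R) m
    (Y : T -> 'rV[R]_m) (C M : 'M[R]_m) :
  centered_gaussian P Y C -> C^T = C -> M^T = M -> forall k B, 0 < B ->
  fine (P ((fun w => k * (qform M (Y w) - \tr (C *m M))) @^-1` [set x | B < `|x|]))
    <= 2 * (k ^+ 2 * \tr (C *m M *m C *m M)) / B ^+ 2.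
Proof.
move=> YC CT MT k B B0.
have [D [trD trD2 _ [d' [T' [P' [xi [[mxi _ sqrxi] YD]]]]]]] :=
  quadratic_form_diag YC CT MT.
have [mY _ _] := YC.
pose h i r := k * D 0 i * (r ^+ 2 - 1).
have hP i := normal_sqr_scaled (k * D 0 i).
pose X w := k * (qform M (Y w) - \tr (C *m M)).
pose X' w := \sum_i h i (xi i w).
have mX : measurable_fun setT X.
  apply: measurable_funM => //; apply: measurable_funB => //.
  under eq_fun do rewrite qformE; apply: measurable_sum => i.
  by apply: measurable_sum => j; do 2 apply: measurable_funM => //.
have mX' : measurable_fun setT X'.
  apply: measurable_sum => i; have [mh _ _ _] := hP i.
  by apply: (measurableT_comp mh); exact: mxi.
(* Second moments are not bounded tests: the tail probability itself is
   transported to the space of xi. *)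
have XX' : forall B : set (measurableTypeR R), measurable B ->
    P (X @^-1` B) = P' (X' @^-1` B).
  apply: eq_law_of_expectation => // G cG G01.
  rewrite (YD (fun x => G (k * (x - \tr (C *m M))))).
  - apply: eq_Rintegral => w _; congr G.
    rewrite trD -sumrB mulr_sumr; apply: eq_bigr => i _.
    by rewrite /h; ring.
  - move=> x; apply: continuous_comp; last exact: cG.
    apply: continuous_fctM; first exact: cst_continuous.
    by apply: continuous_fctB; [move=> y; exact: cvg_id|exact: cst_continuous].
  - by exists 1 => x; have /andP[g0 g1] := G01 (k * (x - \tr (C *m M)));
      rewrite ger0_norm.
have mB := measurable_norm_gt B.
rewrite -/X XX'//; apply: second_moment_tail => //.
rewrite /X' (sqrxi h) ?lee_fin.
- rewrite trD2 mulr_sumr mulr_sumr le_eqVlt; apply/orP; left; apply/eqP.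
  by apply: eq_bigr => i _; have [_ _ _ ->] := hP i; rewrite exprMn.
- by move=> i; have [] := hP i.
- by move=> i; have [] := hP i.
- by move=> i; have [] := hP i.
Qed.

End quadratic_estimates.

(** * The statistics as quadratic forms *)

Section statistics.
Context (R : realType).

Lemma centered_gaussian_qform d (T : measurableType d) (P : probability T R) m
    (Y : T -> 'rV[R]_m) (C M : 'M[R]_m) : centered_gaussian P Y C -> C^T = C ->
  M^T = M -> P.-integrable setT (EFin \o (fun w => qform M (Y w))) /\
  \int[P]_w qform M (Y w) = \tr (C *m M).
Proof.
move=> YC CT MT; have [_ iYY _ EYY] := centered_gaussian_coord YC CT.
have iz i j : P.-integrable setT (EFin \o (fun w => Y w 0 i * Y w 0 j * M i j)).
  by under eq_fun do rewrite mulrC; apply: integrableRZ; exact: iYY.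
have is_ i : P.-integrable setT (EFin \o (fun w => \sum_j Y w 0 i * Y w 0 j * M i j)).
  by apply: integrableR_sum => j; exact: iz.
split; first by under eq_fun do rewrite qformE; exact: integrableR_sum.
under eq_Rintegral do rewrite qformE.
rewrite Rintegral_sum//; apply: eq_bigr => i _.
rewrite Rintegral_sum// mxE; apply: eq_bigr => j _.
under eq_Rintegral do rewrite mulrC.
by rewrite RintegralZl// EYY mulrC -[in LHS]MT mxE.
Qed.

Lemma sum_mxtens n p (F : 'I_(n * p) -> R) :
  \sum_u F u = \sum_i \sum_a F (mxtens_index (i, a)).
Proof.
rewrite pair_bigA (reindex (@mxtens_index n p))/=; last first.
  by exists (@mxtens_unindex n p) => u _; [exact: mxtens_indexK|exact: mxtens_unindexK].
by apply: eq_bigr => -[].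
Qed.

Lemma sum_delta_mx p (F : 'I_p -> 'I_p -> R) b c :
  \sum_k \sum_l F k l * (delta_mx b c : 'M[R]_p) k l = F b c.
Proof.
rewrite (bigD1 b)//= (bigD1 c)//= mxE !eqxx mulr1 big1 ?addr0 => [|l lc]; last first.
  by rewrite mxE eqxx (negPf lc) mulr0.
rewrite big1 ?addr0// => k kb; apply: big1 => l _.
by rewrite mxE (negPf kb) mulr0.
Qed.

Lemma tr_Tmat d p n (s : 'I_n -> 'rV[R]_d) (b l : 'I_p) g :
  (forall x, g (- x) = g x) -> (Tmat s b l g)^T = Tmat s b l g.
Proof.
move=> geven; apply/matrixP => u v.
rewrite [LHS]mxE [LHS]mxE [RHS]mxE -geven opprB; congr (_ * _).
by rewrite !mxE; congr (_ * _); rewrite addrC; congr (_%:R + _%:R);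
  congr nat_of_bool; rewrite andbC.
Qed.

(** n^(-1/2), in a form that is also the factor of the statistics when n = 0 *)
Definition rate n : R := Num.sqrt n%:R * n%:R^-1.

Lemma rate_ge0 n : 0 <= rate n.
Proof. by rewrite mulr_ge0// invr_ge0. Qed.

Lemma rate_sqr n : rate n ^+ 2 = n%:R^-1.
Proof.
rewrite /rate exprMn sqr_sqrtr// expr2 mulrA; have [->|n0] := eqVneq (n%:R : R) 0.
  by rewrite mul0r invr0 mulr0.
by rewrite mulfV// mul1r.
Qed.

Lemma rate_cvg0 : rate n @[n --> \oo] --> 0.
Proof.
apply/cvgrPdist_le => e e0; exists (Num.bound (e ^- 2)) => // n /= en.
have n0 : 0 < n%:R :> R.
  by rewrite (lt_le_trans _ (_ : (Num.bound (e ^- 2))%:R <= _)) ?ler_nat//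
     (le_lt_trans _ (archi_boundP _))// invr_ge0 sqr_ge0.
rewrite sub0r normrN ger0_norm ?rate_ge0//.
rewrite -(ler_pXn2r (ltn0Sn 1)) ?nnegrE ?rate_ge0 ?(ltW e0)// rate_sqr.
rewrite -[leRHS]invrK lef_pV2 ?posrE ?invr_gt0 ?exprn_gt0//.
rewrite ltW// (lt_le_trans (archi_boundP _)) ?ler_nat// invr_ge0 sqr_ge0//.
Qed.

Section field.
Context disp (T : measurableType disp) (P : probability T R).
Context (d p : nat) (Omega : 'M[R]_p) (Z : 'I_p -> 'rV[R]_d -> {RV P >-> R}).
Context (K : 'I_p -> 'rV[R]_d -> R) (n : nat) (s : 'I_n -> 'rV[R]_d).
Hypothesis hZgauss : forall k, gaussian_process P (Z k).
Hypothesis hZstat : forall k, stationary_with P (Z k) 0 (K k).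
Hypothesis hZindep : independent_processes P Z.

Definition observations (w : T) : 'rV[R]_(n * p) := \row_u yvec Omega Z s u w.

Local Notation sites := (fun u : 'I_(n * p) => s (mxtens_unindex u).1).
Local Notation weights := (fun u : 'I_(n * p) => Omega (mxtens_unindex u).2).

Lemma observations_field :
  centered_gaussian P observations (field_covariance K sites weights).
Proof.
have := field_centered hZgauss hZstat hZindep sites weights.
congr (centered_gaussian P _ _); apply/funext => w; apply/rowP => u.
rewrite [LHS]mxE [RHS]mxE /yvec /observed [RHS]mxE; apply: eq_bigr => k _.
by rewrite [X in _ = _ * X]mxE.
Qed.

Lemma Rcov_field : Rcov Omega Z s = field_covariance K sites weights.
Proof.
have [_ _ cov] := centered_gaussian_covariance observations_field
  (tr_field_covariance hZstat sites weights).
apply/matrixP => u v; rewrite [LHS]mxE.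
transitivity (fine (field_covariance K sites weights u v)%:E) => //.
rewrite -cov; congr (fine (covariance P _ _)); apply/funext => w; by rewrite mxE.
Qed.

Lemma tr_Rcov : (Rcov Omega Z s)^T = Rcov Omega Z s.
Proof. by rewrite Rcov_field (tr_field_covariance hZstat). Qed.

Lemma observations_centered : centered_gaussian P observations (Rcov Omega Z s).
Proof. by rewrite Rcov_field; exact: observations_field. Qed.

(** The matrix T symmetrises the indices b and c; for even g, exchanging the two
    points shows that this does not change the double sum. *)
Lemma qform_Tmat g b c w : (forall x, g (- x) = g x) ->
  Mhat Omega Z s g w b c = n%:R^-1 * qform (Tmat s b c g) (observations w).
Proof.
move=> geven; rewrite qformE.
pose o i k := observed Omega Z (s i) w k 0.
pose S b c := \sum_i \sum_j g (s i - s j) * (o i b * o j c).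
have SC : S c b = S b c.
  rewrite /S exchange_big/=; apply: eq_bigr => i _; apply: eq_bigr => j _.
  by rewrite -geven opprB; congr (_ * _); exact: mulrC.
have -> : Mhat Omega Z s g w b c = n%:R^-1 * S b c.
  rewrite /Mhat mxE summxE; congr (_ * _); apply: eq_bigr => i _.
  rewrite summxE; apply: eq_bigr => j _; rewrite mxE; congr (_ * _).
  by rewrite mxE big_ord1 [_^T _ _]mxE.
congr (_ * _); transitivity (2^-1 * (S b c + S c b)); first by rewrite SC; field.
rewrite sum_mxtens -big_split/= mulr_sumr; apply: eq_bigr => i _.
under [RHS]eq_bigr do rewrite sum_mxtens.
rewrite exchange_big/= -big_split/= mulr_sumr; apply: eq_bigr => j _.
transitivity (g (s i - s j) / 2 *
    (\sum_k \sum_l o i k * o j l * (delta_mx b c : 'M[R]_p) k l +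
     \sum_k \sum_l o i k * o j l * (delta_mx c b : 'M[R]_p) k l)).
  rewrite (sum_delta_mx (fun k l => o i k * o j l)).
  by rewrite (sum_delta_mx (fun k l => o i k * o j l)); field.
rewrite -big_split/= mulr_sumr; apply: eq_bigr => k _.
rewrite -big_split/= mulr_sumr; apply: eq_bigr => l _.
rewrite ![observations _ _ _]mxE /yvec [Tmat _ _ _ _ _ _]mxE !mxtens_indexK/=.
rewrite -/(o i k) -/(o j l) [X in _ = _ * (_ * X)]mxE [X in _ = _ * (_ * (_ * X))]mxE.
ring.
Qed.

Context (g h : 'rV[R]_d -> R).
Hypotheses (geven : forall x, g (- x) = g x) (heven : forall x, h (- x) = h x).
Local Notation q := (p * p + p * p)%N.
Local Notation Rc := (Rcov Omega Z s).

Definition stat_mx (i : 'I_q) : 'M[R]_(n * p) :=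
  match fintype.split i with
  | inl l => Tmat s (mxtens_unindex l).1 (mxtens_unindex l).2 g
  | inr l => Tmat s (mxtens_unindex l).1 (mxtens_unindex l).2 h
  end.

Lemma tr_stat_mx i : (stat_mx i)^T = stat_mx i.
Proof. by rewrite /stat_mx; case: fintype.split => l; exact: tr_Tmat. Qed.

Lemma Mmean_trace e b c : (forall x, e (- x) = e x) ->
  Mmean Omega Z s e b c = n%:R^-1 * \tr (Rc *m Tmat s b c e).
Proof.
move=> even; rewrite mxE.
have [iq Eq] := centered_gaussian_qform observations_centered tr_Rcov
  (tr_Tmat s b c even).
rewrite (_ : (fun w => _) = fun w => n%:R^-1 * qform (Tmat s b c e) (observations w)).
  rewrite expectation_Rintegral; last exact: integrableRZ.
  by rewrite /= RintegralZl// Eq.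
by apply/funext => w; rewrite qform_Tmat.
Qed.

Lemma W2_coord w i : (W2 Omega Z s g h w : 'rV[R]_q) 0 i =
  rate n * (qform (stat_mx i) (observations w) - \tr (Rc *m stat_mx i)).
Proof.
have WE e l : (forall x, e (- x) = e x) -> W Omega Z s e w 0 l =
    rate n * (qform (Tmat s (mxtens_unindex l).1 (mxtens_unindex l).2 e) (observations w) -
      \tr (Rc *m Tmat s (mxtens_unindex l).1 (mxtens_unindex l).2 e)).
  by move=> even; rewrite mxE qform_Tmat// Mmean_trace// -mulrBr mulrA.
rewrite /stat_mx /W2 mxE; case: fintype.split => l; exact: WE.
Qed.

Lemma Vmat_coord i j : Vmat Omega Z s g h i j =
  2 * n%:R^-1 * \tr (Rc *m stat_mx i *m Rc *m stat_mx j).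
Proof.
rewrite /Vmat /block_mx /stat_mx mxE.
by case: (fintype.split i) => l; rewrite mxE; case: (fintype.split j) => r; rewrite mxE.
Qed.

Definition comb_mx (c : 'rV[R]_q) : 'M[R]_(n * p) := \sum_i c 0 i *: stat_mx i.

Lemma tr_comb_mx c : (comb_mx c)^T = comb_mx c.
Proof.
rewrite /comb_mx raddf_sum; apply: eq_bigr => i _.
by rewrite /= linearZ/= tr_stat_mx.
Qed.

Lemma comb_mxE (F : 'M[R]_(n * p) -> R) c :
  (forall M1 M2, F (M1 + M2) = F M1 + F M2) -> (forall t M, F (t *: M) = t * F M) ->
  F (comb_mx c) = \sum_i c 0 i * F (stat_mx i).
Proof.
move=> FD FZ; rewrite /comb_mx; have F0 : F 0 = 0.
  by rewrite -(scale0r 0) FZ mul0r.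
by rewrite (big_morph F FD F0); apply: eq_bigr => i _; rewrite FZ.
Qed.

(** The matrices of the statistics combine linearly into [comb_mx c]; the trace
    is the mean of the resulting quadratic form. *)
Lemma dot_W2 c w : dot c (W2 Omega Z s g h w) =
  rate n * (qform (comb_mx c) (observations w) - \tr (Rc *m comb_mx c)).
Proof.
rewrite (comb_mxE (F := fun M => qform M (observations w))); last 2 first.
- by move=> M1 M2; rewrite /qform mulmxDr mulmxDl mxE.
- by move=> t M; rewrite /qform -scalemxAr -scalemxAl mxE.
rewrite (comb_mxE (F := fun M => \tr (Rc *m M))); last 2 first.
- by move=> M1 M2; rewrite mulmxDr mxtraceD.
- by move=> t M; rewrite -scalemxAr mxtraceZ.
rewrite -sumrB mulr_sumr; apply: eq_bigr => i _.
by rewrite W2_coord -mulrBr mulrCA.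
Qed.

(** The matrix V is the exact covariance: this is the variance of the quadratic
    form in [dot_W2]. *)
Lemma qform_Vmat c : qform (Vmat Omega Z s g h) c =
  2 * (rate n ^+ 2 * \tr (Rc *m comb_mx c *m Rc *m comb_mx c)).
Proof.
rewrite qformE.
rewrite (comb_mxE (F := fun M => \tr (Rc *m M *m Rc *m comb_mx c))); last 2 first.
- by move=> M1 M2; rewrite mulmxDr !mulmxDl mxtraceD.
- by move=> t M; rewrite -scalemxAr -!scalemxAl mxtraceZ.
rewrite rate_sqr mulrA mulr_sumr; apply: eq_bigr => i _.
rewrite (comb_mxE (F := fun M => \tr (Rc *m stat_mx i *m Rc *m M))); last 2 first.
- by move=> M1 M2; rewrite mulmxDr mxtraceD.
- by move=> t M; rewrite -scalemxAr mxtraceZ.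
rewrite !mulr_sumr; apply: eq_bigr => j _; rewrite Vmat_coord; ring.
Qed.

Lemma tr_Vmat : (Vmat Omega Z s g h)^T = Vmat Omega Z s g h.
Proof.
apply/matrixP => i j; rewrite [LHS]mxE !Vmat_coord; congr (_ * _).
by rewrite -[in LHS]mulmxA mxtrace_mulC mulmxA.
Qed.

Section bounds.
Variable G : R.
Hypotheses (gG : forall i, \sum_j `|g (s i - s j)| <= G)
  (hG : forall i, \sum_j `|h (s i - s j)| <= G)
  (KG : forall l i, \sum_j `|K l (s i - s j)| <= G) (G0 : 0 <= G).

Definition mx_mass := \sum_b \sum_l `|Omega b l|.
Definition Rcov_mass := p%:R * (p%:R * (mx_mass ^+ 2 * G)).

Lemma mx_mass_ge0 : 0 <= mx_mass.
Proof. by apply: sumr_ge0 => b _; apply: sumr_ge0. Qed.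

Lemma le_mx_mass b l : `|Omega b l| <= mx_mass.
Proof.
rewrite /mx_mass (bigD1 b)//= (bigD1 l)//= -addrA lerDl addr_ge0// ?sumr_ge0// => *.
exact: sumr_ge0.
Qed.

Lemma Rcov_mass_ge0 : 0 <= Rcov_mass.
Proof. by rewrite !mulr_ge0// mx_mass_ge0. Qed.

Lemma row_bounded_stat_mx i : row_bounded (stat_mx i) (p%:R * G).
Proof.
have TG e (b c : 'I_p) : (forall i, \sum_j `|e (s i - s j)| <= G) ->
    row_bounded (Tmat s b c e) (p%:R * G).
  move=> eG u; rewrite sum_mxtens.
  apply: (@le_trans _ _ (p%:R * \sum_j `|e (s (mxtens_unindex u).1 - s j)|)); last first.
    by rewrite ler_wpM2l.
  rewrite mulr_sumr; apply: ler_sum => j _.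
  apply: ler_sum_const => l.
  rewrite mxE mxtens_indexK/= normrM ler_piMr// !mxE normrM ger0_norm ?invr_ge0//.
  rewrite mulrC ler_pdivrMr// mul1r (le_trans (ler_normD _ _))//.
  by rewrite (_ : 2 = 1 + 1)// lerD//; case: (_ && _); rewrite ?normr1 ?normr0.
by rewrite /stat_mx; case: fintype.split => l; exact: TG.
Qed.

Lemma row_bounded_Rcov : row_bounded Rc Rcov_mass.
Proof.
move=> u; rewrite Rcov_field sum_mxtens exchange_big.
apply: ler_sum_const => b.
apply: (@le_trans _ _ (\sum_j \sum_l mx_mass ^+ 2 *
    `|K l (s (mxtens_unindex u).1 - s j)|)).
  apply: ler_sum => j _; rewrite mxE; cbv beta; rewrite mxtens_indexK.
  rewrite (le_trans (ler_norm_sum _ _ _))//; apply: ler_sum => l _.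
  by rewrite !normrM ler_wpM2r// expr2 ler_pM// le_mx_mass.
rewrite exchange_big/=; apply: ler_sum_const => l.
by rewrite -mulr_sumr ler_wpM2l ?sqr_ge0//; exact: KG.
Qed.

Lemma row_bounded_Rcov_comb c :
  row_bounded (Rc *m comb_mx c) (Rcov_mass * (\sum_i `|c 0 i| * (p%:R * G))).
Proof.
apply: row_bounded_mul row_bounded_Rcov _.
  by apply: sumr_ge0 => i _; rewrite !mulr_ge0.
move=> u; apply: (@le_trans _ _ (\sum_v \sum_i `|c 0 i| * `|stat_mx i u v|)).
  apply: ler_sum => v _; rewrite summxE (le_trans (ler_norm_sum _ _ _))//.
  by apply: ler_sum => i _; rewrite mxE normrM.
rewrite exchange_big/=; apply: ler_sum => i _; rewrite -mulr_sumr ler_wpM2l//.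
exact: row_bounded_stat_mx.
Qed.

(** The trace of an np x np matrix with bounded row sums is O(n), which the factor
    1 / n compensates. *)
Lemma Vmat_bound i j : `|Vmat Omega Z s g h i j| <=
  2 * (p%:R * (Rcov_mass * (p%:R * G) * Rcov_mass * (p%:R * G))).
Proof.
have R0 := Rcov_mass_ge0; have pG : 0 <= p%:R * G by rewrite mulr_ge0.
rewrite Vmat_coord -mulrA normrM (ger0_norm (ler0n _ 2)) ler_wpM2l//.
rewrite normrM ger0_norm ?invr_ge0//.
set b := (X in _ <= p%:R * X).
have b0 : 0 <= b by exact: mulr_ge0 (mulr_ge0 (mulr_ge0 R0 pG) R0) pG.
have /le_trace tr_le : row_bounded (Rc *m stat_mx i *m Rc *m stat_mx j) b.
  apply: row_bounded_mul (row_bounded_stat_mx j) => //.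
  apply: row_bounded_mul row_bounded_Rcov => //.
  exact: row_bounded_mul row_bounded_Rcov (row_bounded_stat_mx i).
move: b b0 tr_le => b b0 tr_le.
apply: (@le_trans _ _ (n%:R^-1 * ((n * p)%:R * b))); first by rewrite ler_wpM2l ?invr_ge0.
rewrite natrM !mulrA; have [->|n0] := eqVneq (n%:R : R) 0.
  by rewrite mulr0 !mul0r mulr_ge0.
by rewrite mulVf// mul1r.
Qed.

End bounds.

End field.

Lemma measure_bigU_le d (T : measurableType d) (P : probability T R) (I : Type)
    (r : seq I) (F : I -> set T) : (forall i, measurable (F i)) ->
  (P (\big[setU/set0]_(i <- r) F i) <= \sum_(i <- r) P (F i))%E.
Proof.
move=> mF; elim: r => [|i r ih]; first by rewrite !big_nil measure0.
rewrite !big_cons (le_trans (measureU2 _ _ _))//; last exact: leeD2l.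
exact: bigsetU_measurable.
Qed.

Lemma tail_cube d (T : measurableType d) (P : probability T R) q
    (Y : T -> 'rV[R]_q) B v : (forall i, measurable_fun setT (fun w => Y w 0 i)) ->
  (forall i, fine (P ((fun w => Y w 0 i) @^-1` [set x | B < `|x|])) <= v) ->
  fine (P (Y @^-1` (~` cube B))) <= q%:R * v.
Proof.
move=> mY Yv; pose F i := (fun w => Y w 0 i) @^-1` [set x | B < `|x|].
have mF i : measurable (F i).
  by rewrite -[X in measurable X]setTI; apply: mY => //; exact: measurable_norm_gt.
have -> : Y @^-1` (~` cube B) = \big[setU/set0]_i F i.
  rewrite -bigcup_seq; apply/seteqP; split=> w /=.
    move=> /existsNP[i /negP]; rewrite -ltNge => h; exists i => //.
    exact: mem_index_enum.
  by move=> [i _ h] /(_ i); rewrite leNgt; apply/negP/negPn.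
rewrite -lee_fin fineK ?fin_num_measure//; last exact: bigsetU_measurable.
apply: le_trans (measure_bigU_le _ _ mF) _.
apply: (@le_trans _ _ (\sum_i v%:E)%E); last first.
  by rewrite sumEFin lee_fin; exact: ler_sum_const.
apply: lee_sum => i _; have := Yv i; rewrite -lee_fin fineK//.
exact: fin_num_measure (mF i).
Qed.

Section sequence.
Context disp (T : measurableType disp) (P : probability T R).
Context (d p : nat) (Omega : 'M[R]_p) (Z : 'I_p -> 'rV[R]_d -> {RV P >-> R}).
Context (K : 'I_p -> 'rV[R]_d -> R) (s : forall n, 'I_n -> 'rV[R]_d).
Hypothesis hZgauss : forall k, gaussian_process P (Z k).
Hypothesis hZstat : forall k, stationary_with P (Z k) 0 (K k).
Hypothesis hZindep : independent_processes P Z.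
Context (g h : 'rV[R]_d -> R).
Hypotheses (geven : forall x, g (- x) = g x) (heven : forall x, h (- x) = h x).
Variable G : R.
Hypotheses (gG : forall n i, \sum_j `|g (@s n i - @s n j)| <= G)
  (hG : forall n i, \sum_j `|h (@s n i - @s n j)| <= G)
  (KG : forall n l i, \sum_j `|K l (@s n i - @s n j)| <= G) (G0 : 0 <= G).
Local Notation q := (p * p + p * p)%N.
Local Notation V n := (Vmat Omega Z (@s n) g h).

Lemma Vmat_bounded : exists v, forall n i j, `|V n i j| <= v.
Proof.
by eexists => n i j; apply: (Vmat_bound Omega hZgauss hZstat hZindep).
Qed.

(** [quadratic_form_cos] with m = n p and k = [rate n]: the error is of order
    n k^3 = k. *)
Lemma W2_cos_rate c : exists2 b : R, 0 <= b & forall n th,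
  `|\int[P]_w cos (th + dot c (W2 Omega Z (@s n) g h w)) -
    expR (- (qform (V n) c / 2)) * cos th| <= b * rate n.
Proof.
have [c0 c00 H] := quadratic_form_cos R.
pose a := Rcov_mass Omega G * (\sum_i `|c 0 i| * (p%:R * G)).
have a0 : 0 <= a.
  rewrite mulr_ge0 ?Rcov_mass_ge0//.
  by apply: sumr_ge0 => i _; rewrite !mulr_ge0.
have ac n : row_bounded (Rcov Omega Z (@s n) *m comb_mx (@s n) g h c) a.
  exact: (row_bounded_Rcov_comb Omega hZgauss hZstat hZindep (@gG n) (@hG n) (@KG n) G0).
exists (c0 * (p%:R * a ^+ 3)); first exact: mulr_ge0 c00 (mulr_ge0 (ler0n _ _) (exprn_ge0 _ a0)).
clearbody a; move=> n th; pose M := comb_mx (@s n) g h c.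
have YC := observations_centered Omega (@s n) hZgauss hZstat hZindep.
have RT := tr_Rcov Omega (@s n) hZgauss hZstat hZindep.
have MT : M^T = M by exact: tr_comb_mx.
have := H _ _ P _ _ _ M YC RT MT a (rate n) th a0 (rate_ge0 n) (ac n).
have -> : rate n ^+ 2 * \tr (Rcov Omega Z (@s n) *m M *m Rcov Omega Z (@s n) *m M) =
    qform (V n) c / 2.
  by rewrite qform_Vmat; rewrite -/M; field.
rewrite (_ : (fun w => cos (th + dot c (W2 Omega Z (@s n) g h w))) =
   fun w => cos (th + rate n *
      (qform M (observations Omega Z (@s n) w) - \tr (Rcov Omega Z (@s n) *m M)))).
  move=> /le_trans; apply; rewrite -mulrA ler_wpM2l// natrM.
  have -> : n%:R * p%:R * (rate n * a) ^+ 3 = p%:R * a ^+ 3 * (n%:R * rate n ^+ 2 * rate n).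
    by ring.
  rewrite ler_wpM2l ?mulr_ge0 ?exprn_ge0// rate_sqr ler_piMl ?rate_ge0//.
  by have [->|n0] := eqVneq (n%:R : R) 0; rewrite ?mul0r// mulfV.
apply/funext => w; congr (cos (_ + _)).
exact: (dot_W2 Omega (@s n) hZgauss hZstat hZindep).
Qed.

Lemma W2_tail v B n : 0 < B -> (forall i, `|V n i i| <= v) ->
  fine (W2_law Omega Z (@s n) g h (~` cube B)) <= q%:R * (v / B ^+ 2).
Proof.
move=> B0 Vv; have B2 : 0 < B ^+ 2 by rewrite exprn_gt0.
apply: (@tail_cube _ _ P _ (fun w => W2 Omega Z (@s n) g h w)) => [i|i].
  apply: (@measurableT_comp _ _ _ _ _ _ (fun x : borel_rV R q => (x : 'rV[R]_q) 0 i)).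
    by apply: measurable_borel_rV; exact: continuous_coord.
  exact: measurable_funPT.
have YC := observations_centered Omega (@s n) hZgauss hZstat hZindep.
have RT := tr_Rcov Omega (@s n) hZgauss hZstat hZindep.
have MT := tr_stat_mx (@s n) geven heven i.
have := quadratic_form_tail YC RT MT (rate n) B0.
rewrite rate_sqr mulrA -(Vmat_coord Omega Z (@s n) g h).
rewrite (_ : (fun w => rate n * _) = fun w => (W2 Omega Z (@s n) g h w : 'rV[R]_q) 0 i).
  move=> /le_trans; apply; rewrite ler_wpM2r ?invr_ge0 ?(ltW B2)//.
  exact: le_trans (ler_norm _) (Vv i).
by apply/funext => w; rewrite (W2_coord Omega (@s n) hZgauss hZstat hZindep).
Qed.

Lemma Vmat_psd n c : 0 <= qform (V n) c.
Proof.
have YC := observations_centered Omega (@s n) hZgauss hZstat hZindep.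
have RT := tr_Rcov Omega (@s n) hZgauss hZstat hZindep.
have MT : (comb_mx (@s n) g h c)^T = comb_mx (@s n) g h c by exact: tr_comb_mx.
have [D [_ trD _ _]] := quadratic_form_diag YC RT MT.
rewrite qform_Vmat trD.
by rewrite !mulr_ge0 ?sqr_ge0// sumr_ge0// => i _; exact: sqr_ge0.
Qed.

End sequence.
End statistics.

(** * The laws N(0, V) and the metric *)

Section normal_laws.
Context (R : realType) (q : nat).
Local Notation pr := (probability (borel_rV R q) R).

Lemma measurable_coord i :
  measurable_fun setT (fun x : borel_rV R q => (x : 'rV[R]_q) 0 i).
Proof. by apply: measurable_borel_rV; exact: continuous_coord. Qed.

(** The law of a square root of V applied to independent standard normals. *)
Lemma exists_centred_normal (V : 'M[R]_q) : V^T = V -> (forall c, 0 <= qform V c) ->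
  exists nu : pr, is_centred_normal V nu.
Proof.
move=> VT V0; have [L LL] := psd_sqrt VT V0.
have [d [T [P [xi ixi]]]] := exists_indep_normals R q.
have := normals_centered L ixi; rewrite LL => -[mY _ cosY].
have mX := measurable_fun_rV mY.
exists (law P mX).
have XV : centered_gaussian (law P mX) (fun x : borel_rV R q => x) V.
  split=> // [i|c th]; first exact: measurable_coord.
  rewrite (Rintegral_distribution P _ (cos_dot_bounded_continuous th c)).
  exact: cosY.
by have [] := centered_gaussian_covariance XV VT; split.
Qed.

Lemma normal_law_centered (V : 'M[R]_q) : V^T = V -> (forall c, 0 <= qform V c) ->
  centered_gaussian (normal_law V) (fun x : borel_rV R q => x) V.
Proof.
move=> VT V0; have [nu nuV] := exists_centred_normal VT V0.
have [gN [EN cN]] : is_centred_normal V (normal_law V).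
  by rewrite /normal_law; apply: getPex; exists nu.
by apply: gaussian_vector_centered => // i; exact: measurable_coord.
Qed.

Lemma normal_law_tail (V : 'M[R]_q) v B : V^T = V -> (forall c, 0 <= qform V c) ->
  (forall i, V i i <= v) -> 0 < B ->
  fine (normal_law V (~` cube B)) <= q%:R * (v / B ^+ 2).
Proof.
move=> VT V0 Vv B0; have NV := normal_law_centered VT V0.
apply: (@tail_cube _ _ _ (normal_law V) q (fun x : borel_rV R q => x)) => i.
  exact: measurable_coord.
have [_ iYY _ EYY] := centered_gaussian_coord NV VT.
apply: second_moment_tail => //; first exact: measurable_coord.
have := expectation_Rintegral (iYY i i); rewrite unlock EYY.
under [X in (X <= _)%E]eq_integral do rewrite expr2.
by move=> ->; rewrite lee_fin.
Qed.

End normal_laws.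

Section weak_metric.
Context (R : realType) (q : nat).
Local Notation pr := (probability (borel_rV R q) R).

(** Balls of [dw] are open for [dw], hence weakly open, hence contain a basic
    weak neighbourhood of their centre. *)
Lemma weak_cvg_metric (dw : pr -> pr -> R) (I : Type) (Phi : set_system I)
    (mu : I -> pr) (nu : pr) : metrizes_weak_topology dw -> Filter Phi ->
  (forall F, bounded_continuous F -> \int[mu i]_x F x @[i --> Phi] --> \int[nu]_x F x) ->
  forall e, 0 < e -> \forall i \near Phi, dw nu (mu i) < e.
Proof.
move=> [[dw0 dweq dwC dwD] topo] FPhi muF e e0.
pose U : set pr := [set m | dw nu m < e].
have /topo Uo : metric_open dw U.
  move=> m Um; exists (e - dw nu m); split; first by rewrite subr_gt0.
  move=> m'; rewrite ltrBrDl; exact: le_lt_trans.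
have Unu : U nu by rewrite /U/= (dweq nu nu).2.
have [m [F [e' [e'0 bF Fe']]]] := Uo nu Unu.
have near_all : \forall i \near Phi, forall a : 'I_m,
    `|\int[mu i]_x F a x - \int[nu]_x F a x| < e'.
  apply: filter_forall => a.
  have /cvgrPdist_lt/(_ e' e'0) := muF _ (bF a).
  by apply: filterS => i; rewrite distrC.
by apply: filterS near_all => i; exact: Fe'.
Qed.

End weak_metric.

(** * Normal approximation with a bounded covariance *)

Section normal_approximation.
Context (R : realType) (q : nat).
Local Notation pr := (probability (borel_rV R q) R).

Lemma ultra_fmap (T T' : Type) (f : T -> T') (U : set_system T) :
  UltraFilter U -> UltraFilter (f @ U).
Proof.
move=> ultraU; apply: Build_UltraFilter => G PG UG.
apply/seteqP; split=> // A GA.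
have [UA|UnA] := in_ultra_setVsetC (f @^-1` A) ultraU; first exact: UA.
have /UG GnA : (f @ U) (~` A) by exact: UnA.
by case: (filter_not_empty G); rewrite -(setICr A); exact: filterI.
Qed.

(** If u n >= e infinitely often, some ultrafilter finer than infinity contains
    these n. This replaces the extraction of subsequences. *)
Lemma cvg_of_ultra (u : nat -> R) : (forall n, 0 <= u n) ->
  (forall U : set_system nat, UltraFilter U -> \oo `<=` U ->
     forall e, 0 < e -> \forall n \near U, u n < e) ->
  u n @[n --> \oo] --> 0.
Proof.
move=> u0 ultra; apply/cvgrPdist_lt => e e0; pose A := [set n | u n < e].
suff : \oo A by apply: filterS => n; rewrite sub0r normrN ger0_norm.
apply: contrapT => nA; pose F := within (~` A) \oo.
have PF : ProperFilter F.
  apply: Build_ProperFilter_ex => B; rewrite /F /within/= => FB.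
  apply: contrapT => /forallNP B0; apply: nA; apply: filterS FB => n nAB.
  by apply: contrapT => /nAB; exact: B0.
have [U [ultraU FU]] := ultraFilterLemma PF.
have UA : U A by apply: ultra e0 => // B ooB; apply: FU; apply: filterS ooB.
have UnA : U (~` A) by apply: FU; exact: nearW.
by case: (filter_not_empty U); rewrite -(setICr A); exact: filterI.
Qed.

Lemma exists_tail_radius (c v e : R) : 0 <= c -> 0 <= v -> 0 < e ->
  exists2 B, 0 < B & c * (v / B ^+ 2) <= e.
Proof.
move=> c0 v0 e0; have cv : 0 <= c * v / e by rewrite !mulr_ge0// invr_ge0 ltW.
have B1 : 1 <= 1 + c * v / e by rewrite lerDl.
have B0 := lt_le_trans ltr01 B1; exists (1 + c * v / e) => //.
rewrite mulrA ler_pdivrMr ?exprn_gt0// -ler_pdivrMl// mulrC.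
by rewrite (@le_trans _ _ (1 + c * v / e)) ?lerDr// expr2 ler_peMl// ltW.
Qed.

(** V n need not converge, but it does along an ultrafilter, since its entries
    stay in a compact set. Along it mu n and N(0, V n) have the same weak
    limit N(0, W), W being the limit of V n. *)
Lemma normal_approximation (dw : pr -> pr -> R) (mu : nat -> pr)
    (V : nat -> 'M[R]_q) v : metrizes_weak_topology dw ->
  (forall n, (V n)^T = V n) -> (forall n c, 0 <= qform (V n) c) ->
  (forall n i j, `|V n i j| <= v) ->
  (forall c th, \int[mu n]_x cos (th + dot c x) -
     expR (- (qform (V n) c / 2)) * cos th @[n --> \oo] --> 0) ->
  (forall e, 0 < e -> exists B, forall n, fine (mu n (~` cube B)) <= e) ->
  dw (mu n) (normal_law (V n)) @[n --> \oo] --> 0.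
Proof.
move=> dwP VT V0 Vv cosmu tight; have [[dw0 _ dwC dwD] _] := dwP.
apply: cvg_of_ultra => // U ultraU ooU e e0.
have [x [_ xU]] : cube v `&` [set x | mxvec (V n) @[n --> U] --> x] !=set0.
  have := @compact_cube R (q * q) v; rewrite compact_ultra; apply.
    exact: ultra_fmap.
  by apply: nearW => n k; case/mxvec_indexP: k => i j; rewrite mxvecE.
pose W := vec_mx x : 'M[R]_q.
have WV i j : V n i j @[n --> U] --> W i j.
  rewrite /W mxE; under eq_fun do rewrite -mxvecE.
  exact: (cvg_comp _ _ xU (@continuous_coord R (q * q) (mxvec_index i j) x)).
have qWV c : qform (V n) c @[n --> U] --> qform W c.
  have cq : continuous (fun y : 'rV[R]_(q * q) => qform (vec_mx y) c).
    rewrite (_ : (fun y => _) = fun y : 'rV[R]_(q * q) =>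
        \sum_i \sum_j c 0 i * c 0 j * y 0 (mxvec_index i j)).
      apply: continuous_fct_sum => i; apply: continuous_fct_sum => j.
      by apply: continuous_fctM; [exact: cst_continuous|exact: continuous_coord].
    apply/funext => y; rewrite qformE; apply: eq_bigr => i _.
    by apply: eq_bigr => j _; rewrite mxE.
  under eq_fun do rewrite -[V _]mxvecK.
  exact: (cvg_comp _ _ xU (cq x)).
have WT : W^T = W.
  apply/matrixP => i j; rewrite mxE.
  apply: (@cvg_unique R (@Rhausdorff R) _ _ _ _ (WV j i) _).
  rewrite (_ : (fun n => V n j i) = fun n => V n i j); first exact: WV.
  by apply/funext => n; rewrite -[in LHS](VT n) mxE.
have W0 c : 0 <= qform W c by apply: (cvgr_to_ge (qWV c)); exact: nearW.
have WC := normal_law_centered WT W0.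
have expqV c : expR (- (qform (V n) c / 2)) @[n --> U] --> expR (- (qform W c / 2)).
  have h : - (qform (V n) c / 2) @[n --> U] --> - (qform W c / 2).
    by apply: (@cvgN _ R^o); apply: cvgM; [exact: qWV|exact: cvg_cst].
  exact: (cvg_comp _ _ h (@continuous_expR R _)).
(* Applied to mu itself and to the normal laws N(0, V n). *)
have dwU (m : nat -> pr) :
    (forall c th, \int[m n]_x cos (th + dot c x) -
      expR (- (qform (V n) c / 2)) * cos th @[n --> U] --> 0) ->
    (forall e, 0 < e -> exists B, forall n, fine (m n (~` cube B)) <= e) ->
    \forall n \near U, dw (normal_law W) (m n) < e / 2.
  move=> cosm tm; apply: weak_cvg_metric => //; last exact: divr_gt0.
  apply: weak_cvg_of_cos => [th c|e' e'0].
    have [_ _ cosW] := WC; rewrite cosW.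
    rewrite (_ : (fun n => _) = fun n => (\int[m n]_x cos (th + dot c x) -
      expR (- (qform (V n) c / 2)) * cos th) + expR (- (qform (V n) c / 2)) * cos th).
      rewrite -[X in _ --> X]add0r; apply: (@cvgD _ R^o); first exact: cosm.
      by apply: cvgM; [exact: expqV|exact: cvg_cst].
    by apply/funext => n; rewrite subrK.
  by have [B mB] := tm _ e'0; exists B; apply: nearW.
have muU : \forall n \near U, dw (normal_law W) (mu n) < e / 2.
  by apply: dwU => // c th A /(cosmu c th); exact: ooU.
have NU : \forall n \near U, dw (normal_law W) (normal_law (V n)) < e / 2.
  apply: dwU => [c th|e' e'0].
    have cos0 n : \int[normal_law (V n)]_x cos (th + dot c x) -
        expR (- (qform (V n) c / 2)) * cos th = 0.
      have [_ _ cosV] := normal_law_centered (VT n) (V0 n).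
      by rewrite cosV subrr.
    by under eq_fun do rewrite cos0; exact: cvg_cst.
  have [B B0 vB] := exists_tail_radius (ler0n R q) (normr_ge0 v) e'0.
  exists B => n; apply: le_trans vB; apply: normal_law_tail => // i.
  by rewrite (le_trans (ler_norm _))// (le_trans (Vv n i i))// ler_norm.
apply: filterS2 muU NU => n mun Nn; rewrite (splitr e).
by apply: le_lt_trans (dwD _ (normal_law W) _) _; rewrite dwC ltrD.
Qed.

Lemma largest_eigenvalue_bound (V : 'M[R]_q) v : 0 <= v ->
  (forall i j, `|V i j| <= v) -> `|largest_eigenvalue V| <= q%:R * v.
Proof.
move=> v0 Vv; rewrite /largest_eigenvalue; set E := [set l | _].
have [->|/set0P[l El]] := eqVneq E set0; first by rewrite sup0 normr0 mulr_ge0.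
have Eb l' : E l' -> - (q%:R * v) <= l' <= q%:R * v.
  by move=> El'; rewrite -ler_norml; exact: eigenvalue_bound El'.
rewrite ler_norml; apply/andP; split.
  have /andP[le_l _] := Eb _ El; rewrite (le_trans le_l)//.
  by apply: ub_le_sup => //; exists (q%:R * v) => l' /Eb/andP[].
by apply: ge_sup; [exists l|move=> l' /Eb/andP[]].
Qed.

End normal_approximation.

(** * Sample covariances of the observed field *)

(** The kernel f_0 is at least as concentrated as the decay profile of f and K. *)
Lemma f_zero_decay (R : realType) d (x : 'rV[R]_d) g : g != 0 ->
  `|f_zero x| <= (1 + enorm x `^ g)^-1.
Proof.
move=> g0; rewrite /f_zero; have [->|_] := eqVneq x 0; last first.
  by rewrite normr0 invr_ge0 addr_ge0// powR_ge0.
have -> : enorm (0 : 'rV[R]_d) = 0.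
  by rewrite /enorm big1 ?sqrtr0// => i _; rewrite mxE expr0n.
by rewrite powR0// addr0 invr1 normr1.
Qed.

Theorem proposition3 (R : realType) (d p : nat) (hd : (1 <= d)%N)
    (hp : (1 <= p)%N)
    (disp : measure_display) (T : measurableType disp) (P : probability T R)
    (S : set 'rV[R]_d) (s : forall n : nat, 'I_n -> 'rV[R]_d)
    (hS : forall (n : nat) (i : 'I_n), S (s n i))
    (Omega : 'M[R]_p) (hOmega : Omega \in unitmx)
    (Z : 'I_p -> 'rV[R]_d -> {RV P >-> R}) (K : 'I_p -> 'rV[R]_d -> R)
    (hZgauss : forall k : 'I_p, gaussian_process P (Z k))
    (hZstat : forall k : 'I_p, stationary_with P (Z k) 0 (K k))
    (hZvar : forall (k : 'I_p) (x : 'rV[R]_d), 'V_P[Z k x]%E = 1%:E)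
    (hZindep : independent_processes P Z)
    (Delta : R) (hDelta : 0 < Delta)
    (hsep : forall (n : nat) (i j : 'I_n), i != j ->
      Delta <= enorm (s n i - s n j))
    (A alpha : R) (hA : 0 < A) (halpha : 0 < alpha)
    (hK : forall (k : 'I_p) (x : 'rV[R]_d),
      `|K k x| <= A / (1 + enorm x `^ (d%:R + alpha)))
    (f : 'rV[R]_d -> R)
    (hf : forall x : 'rV[R]_d,
      `|f x| <= A / (1 + enorm x `^ (d%:R + alpha)))
    (hfeven : forall x : 'rV[R]_d, f (- x) = f x)
    (dw : probability (borel_rV R (p * p + p * p)) R ->
          probability (borel_rV R (p * p + p * p)) R -> R)
    (hdw : metrizes_weak_topology dw) :
  ((fun n : nat =>
      dw (W2_law Omega Z (s n) f (@f_zero R d))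
         (normal_law (Vmat Omega Z (s n) f (@f_zero R d)))) @ \oo --> (0 : R)) /\
  (exists C : R, forall n : nat,
      `|largest_eigenvalue (Vmat Omega Z (s n) f (@f_zero R d))| <= C).
Proof.
have [C C0 pack] := packing hd hDelta halpha.
(* A C bounds the sums over f and the K_k, C those over f_0. *)
pose G := A * C + C.
have AC : 0 <= A * C by rewrite mulr_ge0// ltW.
have G0 : 0 <= G by rewrite addr_ge0.
have g0 : d%:R + alpha != 0 by rewrite gt_eqF// ltr_wpDl.
have decay (e : 'rV[R]_d -> R) :
    (forall x, `|e x| <= A / (1 + enorm x `^ (d%:R + alpha))) ->
    forall n i, \sum_j `|e (s n i - s n j)| <= G.
  move=> he n i; apply: (@le_trans _ _ (A * C)); last by rewrite lerDl.
  apply: (le_trans (ler_sum _ (fun j _ => he (s n i - s n j)))).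
  by rewrite -mulr_sumr ler_wpM2l ?(ltW hA)//; apply: pack; exact: hsep.
have fG := decay f hf; have KG n k := decay (K k) (hK k) n.
have zeroG n i : \sum_j `|f_zero (s n i - s n j)| <= G.
  apply: (@le_trans _ _ C); last by rewrite lerDr.
  apply: le_trans (pack n (s n) (@hsep n) i).
  by apply: ler_sum => j _; exact: f_zero_decay.
have zero_even (x : 'rV[R]_d) : f_zero (- x) = f_zero x :> R.
  by rewrite /f_zero oppr_eq0.
have [v Vv] := Vmat_bounded Omega hZgauss hZstat hZindep fG zeroG KG G0.
have Vv' n i j : `|Vmat Omega Z (s n) f (@f_zero R d) i j| <= `|v|.
  exact: le_trans (Vv n i j) (ler_norm v).
split; last first.
  by eexists => n; apply: largest_eigenvalue_bound (Vv' n).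
apply: (normal_approximation hdw _ _ Vv').
- by move=> n; exact: tr_Vmat.
- by move=> n c; exact: (Vmat_psd Omega s hZgauss hZstat hZindep hfeven zero_even).
- move=> c th.
  have [b b0 rateb] := W2_cos_rate Omega hZgauss hZstat hZindep
    hfeven zero_even fG zeroG KG G0 c.
  apply/cvgr0Pnorm_le => e e0.
  have b1 : 0 < b + 1 by rewrite ltr_wpDl.
  have /cvgr0Pnorm_le/(_ _ (divr_gt0 e0 b1)) := @rate_cvg0 R.
  apply: filterS => n; rewrite ger0_norm ?rate_ge0// => raten.
  rewrite (Rintegral_distribution P _ (cos_dot_bounded_continuous th c)).
  apply: le_trans (rateb n th) _; apply: (@le_trans _ _ ((b + 1) * rate R n)).
    by rewrite ler_wpM2r ?rate_ge0// lerDl.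
  by rewrite -ler_pdivlMl// mulrC.
move=> e e0.
have [B B0 vB] := exists_tail_radius (ler0n R (p * p + p * p)) (normr_ge0 v) e0.
exists B => n; apply: le_trans vB.
exact: (W2_tail hZgauss hZstat hZindep hfeven zero_even B0 (fun i => Vv' n i i)).
Qed.
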